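(* Consider the family of assemble-to-order systems indexed by their longest lead time $L$, operated under the replenishment and allocation policy described in the context. If $$\limsup_{L\to\infty}\Big\{\sup_{t\ge-\hat L^{(L)}_{k_j}}\mathbf E\Big[\big|\widehat{IP}^{(L)}_j(t)-\widehat{\mathbb{IP}}^{(L)}_j(t)\big|\Big]\Big\}=0,\qquad 1\le j\le n,$$ and $$\limsup_{L\to\infty}\Big\{\sup_{t\ge0}\mathbf E\Big[\big|\hat B^{(L)}_i(t)-\hat{\mathbb B}^{*(L)}_i(t)\big|\Big]\Big\}=0,\qquad 1\le i\le m,$$ then $$\lim_{L\to\infty}\frac{\mathcal C^{(L)}-\underline C^{(L)}}{\sqrt L}=0$$ (the policy is asymptotically optimal on the diffusion scale), and as a consequence $$\lim_{L\to\infty}\frac{\mathcal C^{(L)}-\mathcal C^{(L)}_{\min}}{\mathcal C^{(L)}_{\min}}=0.$$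
   Context: **Fixed data.** $m$ products, $n$ components, $K$ lead-time classes. $A=(a_{ji})$ is an $n\times m$ non-negative integer matrix ($a_{ji}$ = units of component $j$ needed per unit of product $i$) with a non-zero entry in every row and column; $\mathbf A_j$ is its $j$th row. Class $k$ contains $n_k$ components, $\bar n_0=0$, $\bar n_k=\sum_{k'\le k}n_{k'}$, $\bar n_K=n$, and components $\bar n_{k-1}+1,\dots,\bar n_k$ form class $k$; $k_j$ is the class of component $j$; $A^k$ consists of the class-$k$ rows of $A$. Holding costs $h_j>0$, backlog costs $b_i>0$; $\mathbf h^k$ is the class-$k$ part of $\mathbf h$; $\mathbf c=\mathbf b+\sum_k(A^k)'\mathbf h^k$. **The $L$th system.** Class-$k$ components have lead time $L^{(L)}_k$, with $0=L^{(L)}_0<L^{(L)}_1<\dots<L^{(L)}_K=L$ otherwise arbitrary; $\hat L^{(L)}_k=L^{(L)}_k/L$. The system is empty at time $-L$, when the demand process starts. Demand $\mathcal D^{(L)}(t)$, $t\ge-L$ (cumulative over $[-L,t]$), is a right-continuous compound Poisson process with rate $\underline\lambda>0$ and i.i.d. non-negative integer-vector order sizes $\mathbf S=(S_1,\dots,S_m)$ (coordinates may be dependent), $\mathbf E[S_i^6]<\infty$; the rate and order-size law are the same for all $L$. $\boldsymbol\mu=\underline\lambda\mathbf E[\mathbf S]$ with $\mu_i>0$. $\mathbf D^{(L)}(t_1,t_2)=\mathcal D^{(L)}(t_2)-\mathcal D^{(L)}(t_1)$; $\mathbf d^{(L)}(t)$ is the jump of $\mathcal D^{(L)}$ at $t$.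 **Feasible policies.** A policy consists of non-negative, integer-valued, non-decreasing, right-continuous, non-anticipating vector processes $\mathcal R^k(t)$, $t\ge-L_k^{(L)}$ (cumulative orders of class-$k$ components), and $\mathcal Z(t)$, $t\ge-L$ (cumulative demand served), with $\mathcal Z(t)=0$ for $t<0$, $\mathcal Z(t)\le\mathcal D^{(L)}(t)$ and $A^k\mathcal Z(t)\le\mathcal R^k(t-L^{(L)}_k)$ for $t\ge0$, $1\le k\le K$. Then inventory is $\mathbf I^k(t)=\mathcal R^k(t-L_k^{(L)})-A^k\mathcal Z(t)$, backlog is $\mathbf B(t)=\mathcal D^{(L)}(t)-\mathcal Z(t)$, inventory position is $\mathbf{IP}^k(t)=\mathcal R^k(t)-A^k\mathcal D^{(L)}(t)$, and the cost is $\limsup_{T\to\infty}\frac1T\int_0^T\big(\sum_k\mathbf h^k\cdot\mathbf E[\mathbf I^k(t)]+\mathbf b\cdot\mathbf E[\mathbf B(t)]\big)dt$. $\mathcal C^{(L)}_{\min}$ is the infimum of this cost over feasible policies; $\mathcal C^{(L)}$ is the cost of the policy below. **Stochastic program and lower bound.** $\mathbf D^{1(L)},\dots,\mathbf D^{K(L)}$ are independent, $\mathbf D^{k(L)}$ distributed as the demand over an interval of length $L^{(L)}_k-L^{(L)}_{k-1}$. Define $\varphi^0(\mathbf y^1,\dots,\mathbf y^K,\mathbf x)=-\max_{\mathbf z\in\mathbb R^m}\{\mathbf c\cdot\mathbf z\mid\mathbf z\le\mathbf x,A^k\mathbf z\le\mathbf y^k,1\le k\le K\}$; for $1\le k<K$,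 $\varphi^k(\mathbf y^{k+1},\dots,\mathbf y^K,\mathbf x)=\inf_{\mathbf y^k\in\mathbb R^{n_k}}\{\mathbf h^k\cdot\mathbf y^k+\mathbf E[\varphi^{k-1}(\mathbf y^k,\dots,\mathbf y^K,\mathbf x+\mathbf D^{k(L)})]\}$; $\varphi^{K(L)}=\inf_{\mathbf y^K}\{\mathbf h^K\cdot\mathbf y^K+\mathbf E[\varphi^{K-1}(\mathbf y^K,\mathbf D^{K(L)})]\}$. The cost lower bound is $\underline C^{(L)}=\varphi^{K(L)}+\mathbf b\cdot\mathbf E[\mathbf D^{(L)}(t-L,t)]$. **Replenishment policy.** $\mathbb Y^{K(L)}$ is the (constant) minimizer of $\mathbf h^K\cdot\mathbf y^K+\mathbf E[\varphi^{K-1}(\mathbf y^K,\mathbf D^{K(L)})]$. Recursively for $k=K-1,\dots,1$ and $t\ge-L_k^{(L)}$, $\mathbb Y^{k(L)}(t)$ is the minimizer over $\mathbf y^k$ of $\mathbf h^k\cdot\mathbf y^k+\mathbf E[\varphi^{k-1}(\mathbf y^k,\mathbb Y^{k+1(L)}(t+L^{(L)}_k-L^{(L)}_{k+1}),\dots,\mathbb Y^{K(L)},\mathbf x+\mathbf D^{k(L)})]$ with $\mathbf x=\mathbf D^{(L)}(t+L^{(L)}_k-L,t)$, the expectation being over $\mathbf D^{k(L)}$ only. Inventory position targets: $\mathbb{IP}^{k(L)}(t)=\mathbb Y^{k(L)}(t)-A^k\mathbf D^{(L)}(t+L^{(L)}_k-L,t)$, $t\ge-L_k^{(L)}$. Actual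 positions: $\mathbf{IP}^{k(L)-}(-L_k^{(L)})=-A^k\mathcal D^{(L)}(-L_k^{(L)})$; $\mathbf{IP}^{k(L)}(t)=\lceil\mathbb{IP}^{k(L)}(t)\rceil\vee\mathbf{IP}^{k(L)-}(t)$ for $t\ge-L_k^{(L)}$ (componentwise); $\mathbf{IP}^{k(L)-}(t)=\mathbf{IP}^{k(L)}(t^-)-A^k\mathbf d^{(L)}(t)$ for $t>-L_k^{(L)}$. **Allocation policy.** For $t\ge0$ let $\mathbb Q^{k(L)}(t)=A^k\mathbf D^{(L)}(t-L^{(L)}_k,t)-\mathbb{IP}^{k(L)}(t-L^{(L)}_k)$ and $\mathbf Q^{k(L)}(t)=A^k\mathbf D^{(L)}(t-L^{(L)}_k,t)-\mathbf{IP}^{k(L)}(t-L^{(L)}_k)$. The backlog target $\mathbb B^{(L)}(t)$ is the minimizer of $\mathbf c\cdot\mathbf x$ over $\{\mathbf x\ge0,\ A^k\mathbf x\ge\mathbf Q^{k(L)}(t),1\le k\le K\}$, and $\mathbb B^{*(L)}(t)$ is the minimizer of the same LP with $\mathbb Q^{k(L)}(t)$ in place of $\mathbf Q^{k(L)}(t)$. All minimizers above are assumed unique, so these processes are well defined. No demand is served before time 0. For $t\ge0$, at time $0$ and whenever some $Q_j^{(L)}$ changes, the backlog vector $\mathbf B^{(L)}(t)$ is any integer vector (chosen non-anticipatively) such that, with $B_i^{(L)-}(t)=B^{(L)}_i(t^-)+d^{(L)}_i(t)$ and $I^{(L)}_j(t)=\sum_{i'}a_{ji'}B^{(L)}_{i'}(t)-Q^{(L)}_j(t)$: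 for all $i$, $\big[\lfloor B^{(L)}_i(t)-\mathbb B^{(L)}_i(t)\rfloor\big]^+\wedge\min_{j:a_{ji}>0}\{(I^{(L)}_j(t)-a_{ji}+1)^+\}=0$ and $B_i^{(L)-}(t)\wedge\mathbb B^{(L)}_i(t)\le B^{(L)}_i(t)\le B^{(L)-}_i(t)$; and for all $j$, $I_j^{(L)}(t)\ge0$. The served amount is $\mathcal Z=\mathcal D^{(L)}-\mathbf B^{(L)}$. **Scaling.** $\widehat{IP}^{(L)}_j(t)=\big(IP_j^{(L)}(Lt)-L^{(L)}_{k_j}\mathbf A_j\cdot\boldsymbol\mu\big)/\sqrt L$, $\widehat{\mathbb{IP}}^{(L)}_j(t)=\big(\mathbb{IP}_j^{(L)}(Lt)-L^{(L)}_{k_j}\mathbf A_j\cdot\boldsymbol\mu\big)/\sqrt L$, $\hat B^{(L)}_i(t)=B^{(L)}_i(Lt)/\sqrt L$, $\hat{\mathbb B}^{*(L)}_i(t)=\mathbb B^{*(L)}_i(Lt)/\sqrt L$. *)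

(* Defs.v *)
From HB Require Import structures.
From mathcomp Require Import all_boot all_order all_algebra.
From mathcomp Require Import all_classical all_reals all_analysis.
Set Implicit Arguments.
Unset Strict Implicit.
Unset Printing Implicit Defensive.
Import Order.TTheory GRing.Theory Num.Theory numFieldNormedType.Exports.
Local Open Scope classical_set_scope.
Local Open Scope ring_scope.

Definition toR (R : realType) (p : nat) (v : 'cV[nat]_p) : 'cV[R]_p :=
  \col_i (v i 0)%:R.

Definition dot (R : realType) (p : nat) (u v : 'cV[R]_p) : R :=
  \sum_i u i 0 * v i 0.

Definition lev (R : realType) (p : nat) (u v : 'cV[R]_p) : Prop :=
  forall i, u i 0 <= v i 0.

Definition leftlim (R : realType) (f : R -> R) (t : R) : R :=
  lim (f s @[s --> t^'-]).

(* Classes are numbered 1, ..., K and [class_of j] is the class k_j of component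
   j; [nbar k] is \bar n_k. With 0-based component indices, class k is
   {j | nbar (k-1) <= j < nbar k}. [osize] is the probability mass function of
   the order-size vector S. *)
Definition nbar (csize : nat -> nat) (k : nat) : nat :=
  (\sum_(1 <= l < k.+1) csize l)%N.

Record network (R : realType) := Network {
  nprod : nat;
  ncomp : nat;
  nclass : nat;
  bom : 'M[nat]_(ncomp, nprod);
  class_size : nat -> nat;
  class_of : 'I_ncomp -> nat;
  hcost : 'cV[R]_ncomp;
  bcost : 'cV[R]_nprod;
  rate : R;
  osize : 'cV[nat]_nprod -> R;
  nclass_gt0 : (0 < nclass)%N;
  class_size_gt0 : forall k, (1 <= k <= nclass)%N -> (0 < class_size k)%N;
  nbar_nclass : nbar class_size nclass = ncomp;
  class_ofP : forall j, (1 <= class_of j <= nclass)%N /\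
    (nbar class_size (class_of j).-1 <= j < nbar class_size (class_of j))%N;
  bom_row : forall j, exists i, (0 < bom j i)%N;
  bom_col : forall i, exists j, (0 < bom j i)%N;
  hcost_gt0 : forall j, 0 < hcost j 0;
  bcost_gt0 : forall i, 0 < bcost i 0;
  rate_gt0 : 0 < rate;
  osize_ge0 : forall v, 0 <= osize v;
  osize_sum : (\esum_(v in [set: 'cV[nat]_nprod]) (osize v)%:E = 1)%E;
  osize_moment6 : forall i,
    (\esum_(v in [set: 'cV[nat]_nprod]) (osize v * (v i 0)%:R ^+ 6)%:E < +oo)%E
}.

Definition bomR (R : realType) (M : network R) : 'M[R]_(ncomp M, nprod M) :=
  map_mx (fun a : nat => a%:R) (bom M).

Definition mu (R : realType) (M : network R) : 'cV[R]_(nprod M) :=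
  \col_i (rate M *
    fine (\esum_(v in [set: 'cV[nat]_(nprod M)]) (osize v * (v i 0)%:R)%:E)%E).

Definition ccost (R : realType) (M : network R) : 'cV[R]_(nprod M) :=
  bcost M + (bomR M)^T *m hcost M.

(* [filt] is the information available over time, [lead k] the lead time of class
   k (with [lead 0] = 0), and [dem] the cumulative demand. Processes are total
   functions of time; their values before the relevant starting time are never
   used. *)
Record system (R : realType) (M : network R) := System {
  sdisp : measure_display;
  sspace : measurableType sdisp;
  sprob : probability sspace R;
  filt : R -> set (set sspace);
  lead : nat -> R;
  dem : R -> sspace -> 'cV[nat]_(nprod M)
}.
Arguments filt {R M} s _ _.
Arguments dem {R M} s _ _.

(* D = S_0 + ... + S_(N-1), where N is a right-continuous counting process
   started at t0 and the S_q are the order sizes. The product formula says that N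
   is a Poisson process, that the S_q are i.i.d. with law [osize], and that N and
   (S_q) are independent. Times are strictly increasing because
   [poisson_pmf 0 k] is a default value. *)
Definition compound_poisson (R : realType) (M : network R) (d : measure_display)
    (T : measurableType d) (P : probability T R) (t0 : R)
    (D : R -> T -> 'cV[nat]_(nprod M)) : Prop :=
  exists (N : R -> T -> nat) (S : nat -> T -> 'cV[nat]_(nprod M)),
  [/\ forall (t : R) c, t0 <= t -> measurable [set w | N t w = c],
      forall q v, measurable [set w | S q w = v],
      forall w, [/\ N t0 w = 0%N,
        forall s t : R, t0 <= s -> s <= t -> (N s w <= N t w)%N &
        forall t : R, t0 <= t -> N s w @[s --> t^'+] --> N t w],
      forall (r p : nat) (s : nat -> R) (c : nat -> nat)
          (v : nat -> 'cV[nat]_(nprod M)),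
        t0 <= s 0%N -> (forall l, (l < r)%N -> s l < s l.+1) ->
        P ([set w | forall l, (l < r)%N -> N (s l.+1) w = (N (s l) w + c l)%N]
           `&` [set w | forall q, (q < p)%N -> S q w = v q])
        = (\prod_(l < r) poisson_pmf (rate M * (s l.+1 - s l)) (c l)
           * \prod_(q < p) osize (v q))%:E &
      forall (t : R) w, t0 <= t -> D t w = \sum_(q < N t w) S q w].

(* [dem] is adapted to [filt] and its future increments are independent of the
   past; the natural filtration of [dem] is a particular case. *)
Record is_system (R : realType) (M : network R) (L : R) (S : system M) : Prop :=
  IsSystem {
  lead0 : lead S 0 = 0;
  lead_lt : forall k, (k < nclass M)%N -> lead S k < lead S k.+1;
  leadK : lead S (nclass M) = L;
  filt_sigma : forall t : R, - L <= t -> sigma_algebra setT (filt S t);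
  filt_measurable : forall t : R, - L <= t -> filt S t `<=` measurable;
  filt_incr : forall s t : R, - L <= s -> s <= t -> filt S s `<=` filt S t;
  dem_poisson : compound_poisson (sprob S) (- L) (dem S);
  dem_adapted : forall (t : R) v, - L <= t -> filt S t [set w | dem S t w = v];
  dem_indep : forall (s t : R) E v, - L <= s -> s <= t -> filt S s E ->
    sprob S (E `&` [set w | dem S t w = dem S s w + v])
    = (sprob S E * sprob S [set w | dem S t w = (dem S s w + v)%R])%E
}.

Definition dinc (R : realType) (M : network R) (S : system M) (t1 t2 : R)
    (w : sspace S) : 'cV[R]_(nprod M) :=
  toR R (dem S t2 w) - toR R (dem S t1 w).

Definition djump (R : realType) (M : network R) (S : system M) (t : R)
    (w : sspace S) : 'cV[R]_(nprod M) :=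
  \col_i ((dem S t w i 0)%:R - leftlim (fun s => (dem S s w i 0)%:R) t).

Definition leadc (R : realType) (M : network R) (S : system M)
  (j : 'I_(ncomp M)) : R := lead S (class_of j).

(* Coordinate j of the replenishment process [ro] is relevant from time
   - leadc j on, the service process [zs] from time - L on. *)
Definition policy_process (R : realType) (M : network R) (S : system M) (t0 : R)
    (X : R -> sspace S -> nat) : Prop :=
  [/\ forall w (s t : R), t0 <= s -> s <= t -> (X s w <= X t w)%N,
      forall w (t : R), t0 <= t -> X s w @[s --> t^'+] --> X t w &
      forall (t : R) c, t0 <= t -> filt S t [set w | X t w = c]].

Definition is_policy (R : realType) (M : network R) (L : R) (S : system M)
    (ro : R -> sspace S -> 'cV[nat]_(ncomp M))
    (zs : R -> sspace S -> 'cV[nat]_(nprod M)) : Prop :=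
  (forall j, policy_process (- leadc S j) (fun t w => ro t w j 0)) /\
  (forall i, policy_process (- L) (fun t w => zs t w i 0)).

Definition inventory (R : realType) (M : network R) (S : system M)
    (ro : R -> sspace S -> 'cV[nat]_(ncomp M))
    (zs : R -> sspace S -> 'cV[nat]_(nprod M)) (t : R) (w : sspace S) :
    'cV[R]_(ncomp M) :=
  \col_j ((ro (t - leadc S j) w j 0)%:R - (bomR M *m toR R (zs t w)) j 0).

Definition backlog (R : realType) (M : network R) (S : system M)
    (zs : R -> sspace S -> 'cV[nat]_(nprod M)) (t : R) (w : sspace S) :
    'cV[R]_(nprod M) :=
  toR R (dem S t w) - toR R (zs t w).

Definition feasible (R : realType) (M : network R) (L : R) (S : system M)
    (ro : R -> sspace S -> 'cV[nat]_(ncomp M))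
    (zs : R -> sspace S -> 'cV[nat]_(nprod M)) : Prop :=
  [/\ is_policy L ro zs,
      forall (t : R) w, - L <= t -> t < 0 -> zs t w = 0,
      forall (t : R) w, 0 <= t -> lev 0 (backlog zs t w) &
      forall (t : R) w, 0 <= t -> lev 0 (inventory ro zs t w)].

Definition cost (R : realType) (M : network R) (S : system M)
    (ro : R -> sspace S -> 'cV[nat]_(ncomp M))
    (zs : R -> sspace S -> 'cV[nat]_(nprod M)) : \bar R :=
  (limf_esup (fun T : R =>
    (T^-1)%:E * \int[@lebesgue_measure R]_(t in `[0%R, T])
      (\sum_j (hcost M j 0%R)%:E *
         'E_(sprob S)[fun w => (inventory ro zs t w j 0)%R] +
       \sum_i (bcost M i 0%R)%:E *
         'E_(sprob S)[fun w => (backlog zs t w i 0)%R]))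
    +oo%R)%E.

Definition min_cost (R : realType) (M : network R) (L : R) (S : system M) :
    \bar R :=
  ereal_inf [set u | exists ro zs, feasible L ro zs /\ u = cost (S := S) ro zs].

(* The vectors y^1, ..., y^K are stored together as one vector y of R^n, y^k
   being its class-k coordinates. *)
Definition agree_off (R : realType) (M : network R) (k : nat)
    (y y' : 'cV[R]_(ncomp M)) : Prop :=
  forall j, class_of j != k -> y' j 0 = y j 0.

(* Demand over [-L, -L + lead k - lead (k-1)] represents D^k; each expectation
   is taken with the other arguments fixed, hence the independence of the D^k. *)
Definition stage_obj (R : realType) (M : network R) (L : R) (S : system M)
    (k : nat) (f : 'cV[R]_(ncomp M) -> 'cV[R]_(nprod M) -> \bar R)
    (y : 'cV[R]_(ncomp M)) (x : 'cV[R]_(nprod M)) : \bar R :=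
  ((\sum_(j | class_of j == k) hcost M j 0 * y j 0)%R%:E +
   \int[sprob S]_w
     f y (x + dinc (- L) (- L + (lead S k - lead S k.-1)) w)%R)%E.

(* [phi k y x] ignores the coordinates of y of class at most k. The supremum in
   [phi 0] is a maximum: the program is feasible and bounded. *)
Fixpoint phi (R : realType) (M : network R) (L : R) (S : system M) (k : nat)
    (y : 'cV[R]_(ncomp M)) (x : 'cV[R]_(nprod M)) {struct k} : \bar R :=
  match k with
  | 0 => (- ereal_sup [set (dot (ccost M) z)%:E |
             z in [set z | lev z x /\ lev (bomR M *m z) y]])%E
  | k'.+1 => ereal_inf [set stage_obj L S k (phi L S k') y' x |
             y' in [set y' | agree_off k y y']]
  end.

(* The increments of the demand are stationary, so the expected demand over
   [t - L, t] is taken at t = 0. *)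
Definition lower_bound (R : realType) (M : network R) (L : R) (S : system M) :
    \bar R :=
  (phi L S (nclass M) 0%R 0%R +
   \sum_i (bcost M i 0%R)%:E *
     'E_(sprob S)[fun w => (dinc (S := S) (- L) 0 w i 0)%R])%E.

(* Coordinate j of [Y t] is coordinate j of Y^{k_j}(t). [target_at k t] is
   (Y^k(t), Y^{k+1}(t + L_k - L_{k+1}), ..., Y^K(t + L_k - L_K)) on the
   coordinates of class at least k; the other coordinates are ignored by the
   objective of stage k. For k = K the demand vector is 0. *)
Definition target_at (R : realType) (M : network R) (S : system M)
    (Y : R -> sspace S -> 'cV[R]_(ncomp M)) (k : nat) (t : R) (w : sspace S) :
    'cV[R]_(ncomp M) :=
  \col_j Y (t + lead S k - leadc S j) w j 0.

Definition is_targets (R : realType) (M : network R) (L : R) (S : system M)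
    (Y : R -> sspace S -> 'cV[R]_(ncomp M)) : Prop :=
  forall k (t : R) w, (1 <= k <= nclass M)%N -> - lead S k <= t ->
  forall y, agree_off k (target_at Y k t w) y -> y <> target_at Y k t w ->
  (stage_obj L S k (phi L S k.-1) (target_at Y k t w)
     (dinc (t + lead S k - L)%R t w)
   < stage_obj L S k (phi L S k.-1) y (dinc (t + lead S k - L)%R t w))%E.

Definition IP (R : realType) (M : network R) (S : system M)
    (ro : R -> sspace S -> 'cV[nat]_(ncomp M)) (t : R) (w : sspace S) :
    'cV[R]_(ncomp M) :=
  toR R (ro t w) - bomR M *m toR R (dem S t w).

Definition IP_target (R : realType) (M : network R) (L : R) (S : system M)
    (Y : R -> sspace S -> 'cV[R]_(ncomp M)) (t : R) (w : sspace S) :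
    'cV[R]_(ncomp M) :=
  \col_j (Y t w j 0 - (bomR M *m dinc (t + leadc S j - L) t w) j 0).

Definition IP_minus (R : realType) (M : network R) (S : system M)
    (ro : R -> sspace S -> 'cV[nat]_(ncomp M)) (t : R) (w : sspace S) :
    'cV[R]_(ncomp M) :=
  \col_j (if t == - leadc S j then - (bomR M *m toR R (dem S t w)) j 0
          else leftlim (fun s => IP ro s w j 0) t - (bomR M *m djump t w) j 0).

Definition replenishment_rule (R : realType) (M : network R) (L : R)
    (S : system M) (Y : R -> sspace S -> 'cV[R]_(ncomp M))
    (ro : R -> sspace S -> 'cV[nat]_(ncomp M)) : Prop :=
  forall (t : R) w j, - leadc S j <= t ->
  IP ro t w j 0
  = Num.max (Num.ceil (IP_target L Y t w j 0))%:~R (IP_minus ro t w j 0).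

(* Q when [ip] is the inventory position, \mathbb{Q} when it is its target. *)
Definition shortfall (R : realType) (M : network R) (S : system M)
    (ip : R -> sspace S -> 'cV[R]_(ncomp M)) (t : R) (w : sspace S) :
    'cV[R]_(ncomp M) :=
  \col_j ((bomR M *m dinc (t - leadc S j) t w) j 0 - ip (t - leadc S j) w j 0).

Definition lp_feasible (R : realType) (M : network R) (q : 'cV[R]_(ncomp M))
    (x : 'cV[R]_(nprod M)) : Prop :=
  lev 0 x /\ lev q (bomR M *m x).

Definition lp_minimizer (R : realType) (M : network R) (q : 'cV[R]_(ncomp M))
    (x : 'cV[R]_(nprod M)) : Prop :=
  lp_feasible q x /\
  forall x', lp_feasible q x' -> x' <> x ->
    dot (ccost M) x < dot (ccost M) x'.

Definition is_backlog_target (R : realType) (M : network R) (S : system M)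
    (ip : R -> sspace S -> 'cV[R]_(ncomp M))
    (BT : R -> sspace S -> 'cV[R]_(nprod M)) : Prop :=
  forall (t : R) w, 0 <= t -> lp_minimizer (shortfall ip t w) (BT t w).

Definition review_epoch (R : realType) (M : network R) (S : system M)
    (ro : R -> sspace S -> 'cV[nat]_(ncomp M)) (t : R) (w : sspace S) : Prop :=
  t = 0 \/ 0 < t /\ exists j, shortfall (IP ro) t w j 0 <>
                       leftlim (fun s => shortfall (IP ro) s w j 0) t.

Definition backlog_minus (R : realType) (M : network R) (S : system M)
    (zs : R -> sspace S -> 'cV[nat]_(nprod M)) (t : R) (w : sspace S) :
    'cV[R]_(nprod M) :=
  \col_i (leftlim (fun s => backlog zs s w i 0) t + djump t w i 0).

Definition alloc_inventory (R : realType) (M : network R) (S : system M)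
    (ro : R -> sspace S -> 'cV[nat]_(ncomp M))
    (zs : R -> sspace S -> 'cV[nat]_(nprod M)) (t : R) (w : sspace S) :
    'cV[R]_(ncomp M) :=
  bomR M *m backlog zs t w - shortfall (IP ro) t w.

(* In [ar_no_slack], \big[min/x]_j y_j is the minimum of x and of all the y_j.
   By [ar_idle] nothing is served between review epochs. *)
Record allocation_rule (R : realType) (M : network R) (L : R) (S : system M)
    (ro : R -> sspace S -> 'cV[nat]_(ncomp M))
    (BT : R -> sspace S -> 'cV[R]_(nprod M))
    (zs : R -> sspace S -> 'cV[nat]_(nprod M)) : Prop := AllocationRule {
  ar_before0 : forall (t : R) w, - L <= t -> t < 0 -> zs t w = 0;
  ar_no_slack : forall (t : R) w i, review_epoch ro t w ->
    \big[Num.min /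
         Num.max 0 (Num.floor (backlog zs t w i 0 - BT t w i 0))%:~R]_
      (j | (0 < bom M j i)%N)
      Num.max 0 (alloc_inventory ro zs t w j 0 - bomR M j i + 1) = 0 :> R;
  ar_bounds : forall (t : R) w i, review_epoch ro t w ->
    Num.min (backlog_minus zs t w i 0) (BT t w i 0) <= backlog zs t w i 0
      <= backlog_minus zs t w i 0;
  ar_inventory : forall (t : R) w j, review_epoch ro t w ->
    0 <= alloc_inventory ro zs t w j 0;
  ar_idle : forall (t : R) w, 0 < t -> ~ review_epoch ro t w ->
    backlog zs t w = backlog_minus zs t w
}.

Definition scale_IP (R : realType) (M : network R) (L : R) (S : system M)
    (ip : R -> sspace S -> 'cV[R]_(ncomp M)) (t : R) (w : sspace S) :
    'cV[R]_(ncomp M) :=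
  \col_j ((ip (L * t) w j 0 - leadc S j * (bomR M *m mu M) j 0) / Num.sqrt L).

Definition scale_B (R : realType) (M : network R) (L : R) (S : system M)
    (B : R -> sspace S -> 'cV[R]_(nprod M)) (t : R) (w : sspace S) :
    'cV[R]_(nprod M) :=
  (Num.sqrt L)^-1 *: B (L * t) w.

(* Main.v *)
Require Import Defs.
From HB Require Import structures.
From mathcomp Require Import all_boot all_order all_algebra.
From mathcomp Require Import all_classical all_reals all_analysis.
From mathcomp Require Import measurable_realfun.
From mathcomp Require Import lra ring zify.
Set Implicit Arguments.
Unset Strict Implicit.
Unset Printing Implicit Defensive.
Import Order.TTheory GRing.Theory Num.Theory numFieldNormedType.Exports.
Local Open Scope classical_set_scope.
Local Open Scope ring_scope.

(** Let C be the lower bound, the value of the stochastic program plus the mean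
    backlog cost of the demand in a window of length L. The first limit follows from

      C <= cost of any feasible policy      and      cost of the policy <= C + o(sqrt L),

    and the second one from these and from C >= eps * sqrt L for large L.

    Everything is computed with psi^k, which is phi^k plus the holding cost of
    the components already ordered and plus the expected backlog cost of the
    demand in the window, as if none of it were served. It
    obeys the recursion of phi^k with psi^0 equal to the least holding and backlog
    cost of an allocation. Unlike phi^k it is non-negative, so that all the
    integrals involved are integrals of non-negative functions and the lower bound
    is psi^K(0, 0) ([phi_psi], [lower_bound_psi]).

    Fix t >= 0. In a feasible policy the class-k components that can be used at
    time t were ordered by time t - L_k, with no knowledge of the demand after
    that time, and this later demand is independent of the past. Freezing the
    past, class after class, turns E psi^0 into at least psi^K(0, 0)
    ([integral_psi_step], [psi_le_nonanticipating]). Hence the cost rate is at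
    least C at every t >= 0 ([cost_rate_ge]). With the targets Y as order
    quantities each infimum of the recursion is attained, and the same
    computation gives exactly C ([psi_targets]). It requires the targets at time
    t - L_k to be known then: being unique minimizers, they are functions of the
    demand observed so far ([target_determined]).

    The policy keeps the inventory positions and the backlog close to their
    targets, and the cost rate is Lipschitz in them, so that the two hypotheses
    bound the excess over C by o(sqrt L), uniformly in t ([cost_rate_le]). The
    policy is feasible because nothing is served unless the inventories stay
    non-negative ([policy_feasible]).

    For the growth of C, take a component j of the slowest class. Its target is
    a constant, and any allocation pays at least a multiple of the distance
    between this constant and the demand for j over an interval of length L
    ([alloc_cost_ge_imbalance]). The number of orders in that interval is Poisson
    with mean of order L. The Poisson weights are at most of order 1 / sqrt L,
    so there are two levels at a distance of order sqrt L which are passed,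
    respectively not passed, with probability at least 1/4 ([poisson_spread]);
    since order sizes are non-negative and independent of the order counts, the
    demand for j then has mean distance of order sqrt L from any constant
    ([window_sum_deviation], [psi_sqrt_lower]).

    All the random variables are functions of finitely many integer vectors,
    such as past orders and demands. This makes measurability and independence
    statements about level sets, and expectations become countable sums. *)

(** * Discrete random variables *)

Section Discrete.
Variables (Om : Type).
Implicit Types F : set (set Om).

(** A variable is discrete with respect to a family of events when it factors
    through an integer code whose level sets belong to the family. The target of
    the variable carries no structure, so that any function of such a variable,
    for instance an optimal value or a minimizer, is again of this kind. *)
Definition discrete_wrt F (T : Type) (X : Om -> T) : Prop :=
  exists (U : Om -> nat) (f : nat -> T),
    (forall c, F [set w | U w = c]) /\ forall w, X w = f (U w).

Lemma discrete_sub F G (T : Type) (X : Om -> T) :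
  F `<=` G -> discrete_wrt F X -> discrete_wrt G X.
Proof. by move=> FG [U [f [FU XE]]]; exists U, f; split=> // c; exact/FG. Qed.

Lemma discrete_comp F (T T' : Type) (h : T -> T') (X : Om -> T) :
  discrete_wrt F X -> discrete_wrt F (fun w => h (X w)).
Proof.
by move=> [U [f [FU XE]]]; exists U, (h \o f); split=> // w /=; rewrite XE.
Qed.

Lemma discrete_countable F (T : countType) (x0 : T) (X : Om -> T) :
  F set0 -> (forall x, F [set w | X w = x]) -> discrete_wrt F X.
Proof.
move=> F0 FX; exists (pickle \o X), (odflt x0 \o unpickle); split; last first.
  by move=> w /=; rewrite pickleK.
move=> c /=; case: (pselect (exists x : T, pickle x = c)) => [[x <-]|nc].
  rewrite (_ : [set w | _] = [set w | X w = x])//.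
  by apply/seteqP; split=> w /= [] //; [move/(pcan_inj pickleK)|move=> ->].
rewrite (_ : [set w | _] = set0)//.
by apply/seteqP; split=> w //= Xc; apply: nc; exists (X w).
Qed.

Lemma discrete_nat F (X : Om -> nat) :
  (forall x, F [set w | X w = x]) -> discrete_wrt F X.
Proof. by move=> FX; exists X, id. Qed.

Lemma discrete_cst F (T : Type) (x : T) :
  sigma_algebra setT F -> discrete_wrt F (fun=> x).
Proof.
move=> [F0 FC _]; have FT : F setT.
  by rewrite -[setT]setD0; exact: FC.
exists (fun=> 0%N), (fun=> x); split=> // -[|c]; last first.
  by rewrite (_ : [set w | _] = set0)//; apply/seteqP; split.
by rewrite (_ : [set w | _] = setT)//; apply/seteqP; split.
Qed.

Lemma sigma_algebra_bigcap_ord F (n : nat) (A : 'I_n -> set Om) :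
  sigma_algebra setT F -> (forall i, F (A i)) -> F [set w | forall i, A i w].
Proof.
move=> [F0 FC FU] FA.
rewrite (_ : [set w | _] =
  setT `\` \bigcup_k (if insub k is Some i then setT `\` A i else set0)).
  by apply: (FC); apply: (FU) => k; case: insub => [i|//]; exact: (FC).
apply/seteqP; split=> w /=.
  by move=> Aw; split=> // -[k _]; case: insub => //= i [_]; apply; exact: Aw.
move=> [_ nAw] i; apply: contrapT => nAi; apply: nAw; exists (i : nat) => //.
by rewrite insubT//= => h; rewrite (_ : Sub _ _ = i)//; exact: val_inj.
Qed.

Lemma discrete_preimage F (T : Type) (X : Om -> T) (B : set T) :
  sigma_algebra setT F -> discrete_wrt F X -> F (X @^-1` B).
Proof.
move=> [F0 _ FU] [U [f [FUc XE]]].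
rewrite (_ : X @^-1` B =
    \bigcup_c (if pselect (B (f c)) then [set w | U w = c] else set0)).
  by apply: (FU) => c; case: pselect => h //=; exact: FUc.
apply/seteqP; split=> w /=; rewrite XE.
  by move=> Bw; exists (U w) => //; case: pselect.
by move=> [c _]; case: pselect => //= Bc ->.
Qed.

(** For objects known to be determined by others without an explicit formula, such
    as unique minimizers. *)
Lemma discrete_factor F (T T' : Type) (x0 : T') (U : Om -> T) (X : Om -> T') :
  discrete_wrt F U -> (forall w w', U w = U w' -> X w = X w') -> discrete_wrt F X.
Proof.
move=> [V [f [FV UE]]] UX.
exists V, (fun c => if pselect (exists w, V w = c) is left e
                    then X (projT1 (cid e)) else x0); split=> // w.
case: pselect => [e|]; last by case; exists w.
by apply: UX; case: cid => w' /= Vw; rewrite !UE Vw.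
Qed.

(** A compound sum is a sequence of partial sums read at a random index. *)
Lemma discrete_random_index F (T : countType) (x0 : T) (N : Om -> nat)
    (X : nat -> Om -> T) :
  sigma_algebra setT F -> (forall c, F [set w | N w = c]) ->
  (forall n, discrete_wrt F (X n)) -> discrete_wrt F (fun w => X (N w) w).
Proof.
move=> sF FN dX; apply: (discrete_countable x0) => [|x]; first by case: sF.
rewrite (_ : [set w | _] = \bigcup_n ([set w | N w = n] `&` X n @^-1` [set x])).
  have [_ _ FU] := sF; apply: (FU) => n.
  rewrite (_ : _ `&` _ =
     [set w | forall i : 'I_2, [set w | if i == 0 then N w = n else X n w = x] w]).
    apply: sigma_algebra_bigcap_ord => // i; case: eqP => _; first exact: FN.
    by apply: (discrete_preimage [set x]).
  apply/seteqP; split=> w /=; first by move=> [-> ->] i; case: eqP.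
  by move=> h; split; [exact: (h 0)|exact: (h 1)].
apply/seteqP; split=> w /=; first by move=> <-; exists (N w).
by move=> [n _ [-> ->]].
Qed.

Lemma discrete_fin F (I : finType) (T : Type) (X : I -> Om -> T) :
  sigma_algebra setT F -> (forall i, discrete_wrt F (X i)) ->
  discrete_wrt F (fun w i => X i w).
Proof.
move=> sF /choice[U]/choice[f UfP].
have d : discrete_wrt F (fun w => [ffun i => U i w] : {ffun I -> nat}).
  apply: (discrete_countable [ffun=> 0%N]) => [|x]; first by case: sF.
  rewrite (_ : [set w | _] =
      [set w | forall k : 'I_#|I|, [set w | U (enum_val k) w = x (enum_val k)] w]).
    by apply: sigma_algebra_bigcap_ord => // k; exact: (UfP _).1.
  apply/seteqP; split=> w /=; first by move=> <- k; rewrite ffunE.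
  by move=> Ux; apply/ffunP => i; have := Ux (enum_rank i); rewrite enum_rankK ffunE.
have := discrete_comp (fun (u : {ffun I -> nat}) i => f i (u i)) d.
congr discrete_wrt; apply/funext => w; apply/funext => i.
by rewrite ffunE (UfP i).2.
Qed.

Lemma discrete_comp2 F (T1 T2 T' : Type) (h : T1 -> T2 -> T')
    (X : Om -> T1) (Y : Om -> T2) :
  sigma_algebra setT F -> discrete_wrt F X -> discrete_wrt F Y ->
  discrete_wrt F (fun w => h (X w) (Y w)).
Proof.
move=> sF [U [f [FU XE]]] [V [g [FV YE]]].
have d : discrete_wrt F (fun w => fun b : bool => (if b then U else V) w).
  by apply: discrete_fin => // -[]; exact: discrete_nat.
have := discrete_comp (fun u : bool -> nat => h (f (u true)) (g (u false))) d.
by congr discrete_wrt; apply/funext => w; rewrite XE YE.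
Qed.

Lemma discrete_col F (T : Type) (n : nat) (X : Om -> 'cV[T]_n) :
  sigma_algebra setT F -> (forall i, discrete_wrt F (fun w => X w i 0)) ->
  discrete_wrt F X.
Proof.
move=> sF dX.
have := discrete_comp (fun x : 'I_n -> T => \col_i x i) (discrete_fin sF dX).
congr discrete_wrt; apply/funext => w; apply/matrixP => i j.
by rewrite mxE ord1.
Qed.

End Discrete.

(** The integral of a non-negative function is a supremum over the simple functions
    below it, hence monotone even for non-measurable functions, such as possibly the
    cost rate as a function of time. *)
Lemma ge0_le_lower_integral d (T : measurableType d) (R : realType)
    (mu : {measure set T -> \bar R}) (D : set T) (f g : T -> \bar R) :
  (forall x, D x -> 0 <= f x)%E -> (forall x, D x -> f x <= g x)%E ->
  (\int[mu]_(x in D) f x <= \int[mu]_(x in D) g x)%E.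
Proof.
move=> f0 fg; have g0 x : D x -> (0 <= g x)%E.
  by move=> Dx; apply: le_trans (fg _ Dx); exact: f0.
rewrite !ge0_integralE//; apply: le_ereal_sup => _ [h /= hf <-].
exists h => // x; apply: le_trans (hf x) _.
by rewrite /patch; case: ifPn => //; rewrite inE => /fg.
Qed.

Section DiscreteIntegral.
Context {d : measure_display} {Om : measurableType d} {R : realType}.
Variable P : probability Om R.
Local Open Scope ereal_scope.

Lemma discrete_measurable d' (T : measurableType d') (X : Om -> T) :
  discrete_wrt measurable X -> measurable_fun setT X.
Proof.
move=> [U [f [mU XE]]] _ B _; rewrite setTI.
rewrite (_ : X @^-1` B = \bigcup_(c in [set c | B (f c)]) [set w | U w = c]).
  by apply: bigcup_measurable => c _; exact: mU.
apply/seteqP; split=> w /=; rewrite XE; first by move=> Bw; exists (U w).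
by move=> [c Bc ->].
Qed.

Lemma discrete_emeasurable (f : Om -> \bar R) :
  discrete_wrt measurable f -> measurable_fun setT f.
Proof. exact: discrete_measurable. Qed.

Lemma integral_level_sets (E : set Om) (U : Om -> nat) (f : Om -> \bar R) :
  measurable E -> (forall c, measurable [set w | U w = c]) ->
  measurable_fun setT f -> (forall w, 0 <= f w) ->
  \int[P]_(w in E) f w = \sum_(c <oo) \int[P]_(w in E `&` [set w | U w = c]) f w.
Proof.
move=> mE mU mf f0.
have UT : \bigcup_c (E `&` [set w | U w = c]) = E.
  by apply/seteqP; split=> [w [c _ []]//|w Ew]; exists (U w).
rewrite -[in LHS]UT ge0_integral_bigcup//.
- by move=> c; exact: measurableI.
- by rewrite UT; exact: measurable_funTS.
by apply/trivIsetP => i j _ _ /eqP ij; apply/seteqP; split=> w //=;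
  move=> [[_ wi] [_ wj]]; apply: ij; rewrite -wi.
Qed.

Lemma integral_proportional_laws_nat (U U' : Om -> nat) (E : set Om)
    (c : R) (f : nat -> \bar R) :
  (0 <= c)%R -> measurable E ->
  (forall x, measurable [set w | U w = x]) ->
  (forall x, measurable [set w | U' w = x]) ->
  (forall x, P (E `&` [set w | U w = x]) = c%:E * P [set w | U' w = x]) ->
  (forall x, 0 <= f x) ->
  \int[P]_(w in E) f (U w) = c%:E * \int[P]_w f (U' w).
Proof.
move=> c0 mE mU mU' hU f0.
have mf (V : Om -> nat) : (forall x, measurable [set w | V w = x]) ->
    measurable_fun setT (fun w => f (V w)).
  by move=> mV; apply: discrete_emeasurable; exists V, f.
have lev (A : set Om) (V : Om -> nat) n : measurable A ->
    (forall x, measurable [set w | V w = x]) ->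
    \int[P]_(w in A `&` [set w | V w = n]) f (V w) =
    f n * P (A `&` [set w | V w = n]).
  move=> mA mV; rewrite -integral_cst; last exact: measurableI.
  by apply: eq_integral => w; rewrite inE => -[_ /= ->].
rewrite (integral_level_sets mE mU)//; last exact: mf.
rewrite (integral_level_sets measurableT mU')//; last exact: mf.
rewrite -nneseriesZl; last by move=> i _; exact: integral_ge0.
apply: eq_eseriesr => n _; rewrite !lev// hU setTI muleCA //.
Qed.

(** The mechanism behind all the independence arguments: if on E the law of X is c
    times the law of X', the same holds for the integrals of any function. *)
Lemma integral_proportional_laws (T : countType) (X X' : Om -> T) (E : set Om)
    (c : R) (f : T -> \bar R) :
  (0 <= c)%R -> measurable E ->
  (forall x, measurable [set w | X w = x]) ->
  (forall x, measurable [set w | X' w = x]) ->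
  (forall x, P (E `&` [set w | X w = x]) = c%:E * P [set w | X' w = x]) ->
  (forall x, 0 <= f x) ->
  \int[P]_(w in E) f (X w) = c%:E * \int[P]_w f (X' w).
Proof.
move=> c0 mE mX mX' hX f0.
pose g n := odflt 0 (omap f (unpickle n)).
have fg x : f x = g (pickle x) by rewrite /g pickleK.
have pickle_level n : (exists x, forall Y : Om -> T,
      [set w | pickle (Y w) = n] = [set w | Y w = x]) \/
    (forall Y : Om -> T, [set w | pickle (Y w) = n] = set0).
  case: (pselect (exists x : T, pickle x = n)) => [[x <-]|nx]; [left|right].
    exists x => Y.
    by apply/seteqP; split=> w /=; [move/(pcan_inj pickleK)|move=> ->].
  move=> Y; apply/seteqP; split=> w //= Yn; apply: nx; by exists (Y w).
have mp (Y : Om -> T) n : (forall x, measurable [set w | Y w = x]) ->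
    measurable [set w : Om | pickle (Y w : T) = n].
  by case: (pickle_level n) => [[x ->]|->].
under eq_integral do rewrite fg.
under [in RHS]eq_integral do rewrite fg.
apply: (integral_proportional_laws_nat (U := pickle \o X) (U' := pickle \o X') (f := g)) => //.
- by move=> n; exact: mp.
- by move=> n; exact: mp.
- move=> n /=; case: (pickle_level n) => [[x lx]|l0]; first by rewrite !lx.
  by rewrite !l0 setI0 measure0 mule0.
by move=> n; rewrite /g; case: unpickle => //= x.
Qed.

Lemma integral_countable_esum (T : countType) (X : Om -> T) (f : T -> \bar R) :
  (forall x, measurable [set w | X w = x]) -> (forall x, 0 <= f x) ->
  \int[P]_w f (X w) = \esum_(x in setT) (f x * P [set w | X w = x]).
Proof.
move=> mX f0.
have [[x0]|nT] := pselect (inhabited T); last first.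
  have Om0 (A : set Om) : A = set0.
    by apply/seteqP; split=> w // Aw; apply: nT; constructor; exact: X w.
  have -> : [set: T] = set0.
    by apply/seteqP; split=> x // _; apply: nT; constructor; exact: x.
  by rewrite (Om0 setT) integral_set0 esum_set0.
have dX : discrete_wrt measurable X by apply: (discrete_countable x0).
rewrite (@integral_level_sets setT (pickle \o X))//; last 2 first.
- move=> c; apply: (discrete_preimage [set c] (@sigma_algebra_measurable _ Om)).
  exact: (discrete_comp pickle dX).
- by apply: discrete_emeasurable; exact: (discrete_comp f dX).
pose g n := if unpickle n is Some x then
  (if pickle x == n then f x * P [set w | X w = x] else 0) else 0 : \bar R.
have g0 n : 0 <= g n.
  by rewrite /g; case: unpickle => // x; case: ifP => // _; exact: mule_ge0.
rewrite (eq_eseriesr (g := g)); last first.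
  move=> n _; rewrite setTI /g.
  have lev x : pickle x = n -> [set w | pickle (X w) = n] = [set w | X w = x].
    by move=> <-; apply/seteqP; split=> w /=; [move/(pcan_inj pickleK)|move=> ->].
  have nolev : (forall x : T, pickle x <> n) -> [set w | pickle (X w) = n] = set0.
    by move=> h; apply/seteqP; split=> w //= /h.
  case E : (unpickle n) => [x|]; last first.
    by rewrite nolev ?integral_set0// => x xn; move: E; rewrite -xn pickleK.
  case: eqP => xn; last first.
    rewrite nolev ?integral_set0// => y yn; apply: xn.
    by move: E; rewrite -yn pickleK => -[->].
  rewrite (lev x)// -integral_cst//.
  by apply: eq_integral => w; rewrite inE => /= ->.
rewrite nneseries_esumT//.
transitivity (\esum_(n in (@pickle T) @` setT) g n).
  rewrite [RHS]esum_mkcond; apply: eq_esum => n _; case: ifPn => //.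
  rewrite notin_setE /= => nr; rewrite /g; case: unpickle => // x.
  by case: eqP => // xn; exfalso; apply: nr; exists x.
rewrite esum_image; last by move=> x y _ _; exact: (pcan_inj pickleK).
by apply: eq_esum => x _; rewrite /g pickleK eqxx.
Qed.

Lemma integral_prob_cst (c : \bar R) : \int[P]_w c = c.
Proof.
transitivity (c * P setT); first exact: integral_cst.
by rewrite probability_setT mule1.
Qed.

(** Additivity when the sum f is non-negative and its integral may be infinite: the
    negative part of g = f - r is dominated by |r|. *)
Lemma integral_ge0_addr (f g : Om -> \bar R) (r : Om -> R) :
  measurable_fun setT f -> (forall w, 0 <= f w) ->
  P.-integrable setT (EFin \o r) -> (forall w, g w + (r w)%:E = f w) ->
  \int[P]_w g w + \int[P]_w (r w)%:E = \int[P]_w f w.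
Proof.
move=> mf f0 ir gf.
have gE : g = fun w => f w - (r w)%:E by apply/funext => w; rewrite -gf addeK.
have mr : measurable_fun setT (EFin \o r) by exact: measurable_int ir.
have rfin : \int[P]_w (r w)%:E \is a fin_num by exact: integrable_fin_num ir.
have mg : measurable_fun setT g by rewrite gE; exact: emeasurable_funB.
have [ffin|] := boolP (\int[P]_w f w < +oo).
  have fi : P.-integrable setT f.
    apply/integrableP; split=> //.
    by under eq_integral do rewrite gee0_abs//.
  rewrite gE integralB// subeK//.
rewrite -leNgt leye_eq => /eqP fy; rewrite fy.
suff -> : \int[P]_w g w = +oo by rewrite addye//; move: rfin; rewrite fin_numE => /andP[].
have gle w : f w <= g^\+ w + `|(r w)%:E|.
  rewrite -gf; apply: leeD; first by rewrite funeposE le_max lexx.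
  exact: lee_abs.
have gn w : g^\- w <= `|(r w)%:E|.
  rewrite funenegE ge_max abse_ge0 andbT gE oppeB ?fin_num_adde_defl//.
  apply: (@le_trans _ _ (r w)%:E); last exact: lee_abs.
  by rewrite addeC -[leRHS]adde0 leeD2l// leeNl oppe0.
have ri : \int[P]_w `|(r w)%:E| < +oo by case/integrableP: ir.
rewrite integralE.
have gpy : \int[P]_w g^\+ w = +oo.
  apply/eqP; rewrite -leye_eq leNgt; apply/negP => gpf.
  have : \int[P]_w f w < +oo.
    apply: (@le_lt_trans _ _ (\int[P]_w (g^\+ w + `|(r w)%:E|))).
      apply: ge0_le_integral => //.
      by apply: emeasurable_funD; [exact: measurable_funepos|exact: measurableT_comp].
    rewrite ge0_integralD//; first exact: lte_add_pinfty.
      exact: measurable_funepos.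
    exact: measurableT_comp.
  by rewrite fy ltxx.
rewrite gpy; have : \int[P]_w g^\- w < +oo.
  apply: le_lt_trans ri; apply: ge0_le_integral => //.
    exact: measurable_funeneg.
  exact: measurableT_comp.
by case: (\int[P]_w g^\- w).
Qed.

(** Conditioning on a discrete X reduces Fubini to a sum over its values, so that no
    product measure appears. Taking V' different from V allows a variable with the
    same law in the inner integral. *)
Lemma integral_discrete_indep (T1 : Type) (T2 : countType) (F : set (set Om))
    (X : Om -> T1) (V V' : Om -> T2) (g : T1 -> T2 -> \bar R) :
  F `<=` measurable -> discrete_wrt F X ->
  (forall x, measurable [set w | V w = x]) ->
  (forall x, measurable [set w | V' w = x]) ->
  (forall E v, F E -> P (E `&` [set w | V w = v]) = P E * P [set w | V' w = v]) ->
  (forall x v, 0 <= g x v) ->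
  \int[P]_w g (X w) (V w) = \int[P]_w \int[P]_w' g (X w) (V' w').
Proof.
move=> Fm [U [f [FU XE]]] mV mV' hind g0.
have mU c : measurable [set w | U w = c] by apply: Fm.
have [v0|nT2] := pselect (inhabited T2); last first.
  have Om0 (A : set Om) : A = set0.
    by apply/seteqP; split=> w // Aw; apply: nT2; constructor; exact: V w.
  by rewrite (Om0 setT) !integral_set0.
have {v0}[v0] := v0.
have dV : discrete_wrt measurable V by apply: (discrete_countable v0).
have dX : discrete_wrt measurable X by apply: discrete_sub Fm _; exists U, f.
have sm := @sigma_algebra_measurable _ Om.
rewrite (integral_level_sets measurableT mU)//; last first.
  by apply: discrete_emeasurable; exact: discrete_comp2.
rewrite [RHS](integral_level_sets measurableT mU)//; last 2 first.
- by apply: discrete_emeasurable; apply: (discrete_comp (fun x => \int[P]_w' g x (V' w'))).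
- by move=> w; exact: integral_ge0.
apply: eq_eseriesr => n _; rewrite !setTI.
transitivity (\int[P]_(w in [set w | U w = n]) g (f n) (V w)).
  by apply: eq_integral => w; rewrite inE XE => /= ->.
transitivity (\int[P]_(w in [set w | U w = n]) (cst (\int[P]_w' g (f n) (V' w')) w)); last first.
  by apply: eq_integral => w; rewrite inE XE => /= ->.
rewrite integral_cst//.
have Pn : P [set w | U w = n] = (fine (P [set w | U w = n]))%:E.
  by rewrite fineK// fin_num_measure.
rewrite [X in _ * X]Pn [RHS]muleC.
apply: (integral_proportional_laws (X := V) (X' := V') (f := g (f n))) => //.
  by rewrite fine_ge0.
by move=> v; rewrite hind// -Pn.
Qed.
End DiscreteIntegral.

(** * Spread of the Poisson distribution *)

Section PoissonSpread.
Context {R : realType}.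
Variable l : R.
Hypothesis l2 : 2 <= l.
Local Notation p := (poisson_pmf l).

Lemma l_gt0 : 0 < l.
Proof. by have := l2; lra. Qed.

Lemma poisson_pmfS n : p n.+1 = p n * (l / n.+1%:R).
Proof.
have l0 := l_gt0; have l2' := l2.
rewrite /poisson_pmf l0 factS natrM exprS invfM; ring.
Qed.

(** Consecutive weights have ratio l / (n + 1), which passes 1 at the integer part of l. *)
Lemma poisson_pmf_le_mode n : p n <= p (Num.truncn l).
Proof.
have l0 := l_gt0; have l2' := l2.
set n0 := Num.truncn l.
have /andP[n0l ln0] : n0%:R <= l < n0.+1%:R by apply: truncn_itv; exact: ltW.
have up k : (k < n0)%N -> p k <= p k.+1.
  move=> kn; rewrite poisson_pmfS ler_peMr ?poisson_pmf_ge0//.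
  by rewrite ler_pdivlMr ?ltr0n// mul1r; apply: le_trans n0l; rewrite ler_nat.
have down k : p (n0 + k.+1)%N <= p (n0 + k)%N.
  rewrite addnS poisson_pmfS ler_piMr ?poisson_pmf_ge0//.
  rewrite ler_pdivrMr ?ltr0n// mul1r; apply: (le_trans (ltW ln0)).
  by rewrite ler_nat ltnS leq_addr.
have [nn0|n0n] := leqP n n0.
  rewrite -(subKn nn0); move: (n0 - n)%N (leq_subr n n0) => k.
  elim: k => [|k IH] kn; first by rewrite subn0.
  apply: le_trans (IH (ltnW kn)).
  have -> : (n0 - k = (n0 - k.+1).+1)%N by lia.
  by apply: up; lia.
rewrite -(subnKC (ltnW n0n)); move: (n - n0)%N => k.
elim: k => [|k IH]; first by rewrite addn0.
by apply: le_trans (down k) IH.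
Qed.

(** Within about sqrt (l / 2) of the mode the ratios of consecutive weights are so close
    to 1 that their product stays above 1/2. *)
Lemma poisson_pmf_near_mode k : (2 * k ^ 2 <= Num.truncn l)%N ->
  p (Num.truncn l) / 2 <= p (Num.truncn l + k)%N.
Proof.
have l0 := l_gt0; have l2' := l2.
set n0 := Num.truncn l.
have /andP[n0l ln0] : n0%:R <= l < n0.+1%:R by apply: truncn_itv; exact: ltW.
have n00 : 0 < n0%:R :> R by lra.
have p0 := poisson_pmf_ge0 l n0.
suff H : (2 * k ^ 2 <= n0)%N -> p n0 * (1 - (k ^ 2)%:R / n0%:R) <= p (n0 + k)%N.
  move=> kn; apply: le_trans (H kn); apply: ler_wpM2l => //.
  rewrite lerBrDr -lerBrDl ler_pdivrMr//.
  have : (2 * k ^ 2)%:R <= n0%:R :> R by rewrite ler_nat.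
  by rewrite natrM; lra.
elim: k => [|k IH] kn; first by rewrite mul0r subr0 mulr1 addn0.
have kn' : (2 * k ^ 2 <= n0)%N by rewrite (leq_trans _ kn)// leq_mul2l leq_sqr leqnSn.
rewrite addnS poisson_pmfS.
have r0 : 0 <= l / (n0 + k).+1%:R by rewrite divr_ge0// ltW.
apply: le_trans (ler_wpM2r r0 (IH kn')).
rewrite -mulrA; apply: ler_wpM2l => //.
have x1 : (k ^ 2)%:R / n0%:R <= 1 :> R.
  by rewrite ler_pdivrMr// mul1r ler_nat (leq_trans _ kn')// leq_pmull.
have r1 : 1 - k.+1%:R / n0%:R <= l / (n0 + k).+1%:R.
  rewrite ler_pdivlMr ?ltr0n//; apply: le_trans n0l.
  rewrite -addnS natrD mulrBl mul1r mulrDr divfK ?gt_eqF//.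
  have : 0 <= k.+1%:R / n0%:R * k.+1%:R :> R by rewrite mulr_ge0// divr_ge0// ltW.
  by lra.
have : 0 <= (1 - (k ^ 2)%:R / n0%:R) * (l / (n0 + k).+1%:R - (1 - k.+1%:R / n0%:R)).
  by rewrite mulr_ge0 ?subr_ge0.
have : (k.+1 ^ 2)%:R / n0%:R = (k ^ 2)%:R / n0%:R + 2 * k%:R / n0%:R + n0%:R^-1 :> R.
  rewrite -[k.+1]addn1 !natrX natrD; field; by rewrite gt_eqF.
have : k.+1%:R / n0%:R = k%:R / n0%:R + n0%:R^-1 :> R.
  by rewrite -[k.+1]addn1 natrD mulrDl mul1r.
have : 0 <= (k ^ 2)%:R / n0%:R * (k.+1%:R / n0%:R) :> R by rewrite mulr_ge0// divr_ge0// ltW.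
have : 0 <= k%:R / n0%:R :> R by rewrite divr_ge0// ltW.
move: (l / _) (k.+1%:R / _) ((k.+1 ^ 2)%:R / _) ((k ^ 2)%:R / n0%:R) => *; nra.
Qed.

(** About sqrt l / 2 of the weights next to the mode are at least half the largest one,
    and their sum is at most 1. *)
Lemma poisson_pmf_bound : (forall n, \sum_(i < n) p i <= 1) ->
  forall n, p n <= 4 / Num.sqrt l.
Proof.
move=> sum1 n; apply: le_trans (poisson_pmf_le_mode n) _.
have l0 := l_gt0; have l2' := l2.
have sl0 : 0 < Num.sqrt l by rewrite sqrtr_gt0.
set n0 := Num.truncn l.
have /andP[n0l ln0] : n0%:R <= l < n0.+1%:R by apply: truncn_itv; exact: ltW.
(* k is of order sqrt l and 2 k^2 <= l / 2, so that the k + 1 weights from the mode on count *)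
pose k := Num.truncn (Num.sqrt l / 2).
have /andP[kl lk] : k%:R <= Num.sqrt l / 2 < k.+1%:R by apply: truncn_itv; rewrite divr_ge0// ltW.
have kn : (2 * k ^ 2 <= n0)%N.
  rewrite -ltnS -(ltr_nat R); apply: le_lt_trans ln0.
  have : (k%:R) ^+ 2 <= (Num.sqrt l / 2) ^+ 2 :> R by rewrite lerXn2r// nnegrE ?divr_ge0// ltW.
  rewrite expr_div_n sqr_sqrtr ?(ltW l0)// natrM natrX; lra.
have half i : (i < k.+1)%N -> p n0 / 2 <= p (n0 + i)%N.
  move=> ik; apply: poisson_pmf_near_mode; apply: leq_trans kn.
  by rewrite leq_mul2l leq_sqr -ltnS.
have : p n0 / 2 * k.+1%:R <= 1.
  apply: le_trans (sum1 (n0 + k.+1)%N).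
  rewrite big_split_ord /= -[leLHS]add0r; apply: lerD.
    by apply: sumr_ge0 => i _; exact: poisson_pmf_ge0.
  rewrite mulr_natr -[X in _ *+ X]card_ord -sumr_const; apply: ler_sum => i _.
  exact: half.
rewrite ler_pdivlMr// => h.
have p0 := poisson_pmf_ge0 l n0.
have : p n0 * (Num.sqrt l / 2) <= p n0 * k.+1%:R by rewrite ler_wpM2l// ltW.
lra.
Qed.

(** Take the first level whose distribution function reaches 1/4; by the bound on the
    weights, going sqrt l / 16 further adds at most another 1/4. *)
Lemma poisson_spread : (forall n, \sum_(i < n) p i <= 1) ->
  (exists n, 1 / 4 <= \sum_(i < n) p i) -> 32 <= Num.sqrt l ->
  exists m1 m2 : nat, [/\ (m1 < m2)%N, 1 / 4 <= \sum_(i < m1.+1) p i,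
    \sum_(i < m2) p i <= 1 / 2 & Num.sqrt l / 32 <= (m2 - m1)%:R].
Proof.
move=> sum1 ex sl32; have l0 := l_gt0; have l2' := l2.
have sl0 : 0 < Num.sqrt l by rewrite sqrtr_gt0.
case: (ex_minnP ex) => -[|m1] hm1 mmin; first by move: hm1; rewrite big_ord0; lra.
(* w weights of size at most 4 / sqrt l sum to at most 1/4 *)
pose w := Num.truncn (Num.sqrt l / 16).
have /andP[wl lw] : w%:R <= Num.sqrt l / 16 < w.+1%:R by apply: truncn_itv; rewrite divr_ge0// ltW.
have lw' : Num.sqrt l / 16 < w%:R + 1 by rewrite natr1.
have wlow : Num.sqrt l / 32 <= w%:R by lra.
exists m1, (m1 + w)%N; split => //.
- by rewrite -[ltnLHS]addn0 ltn_add2l -(ltr_nat R); lra.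
- rewrite big_split_ord /=.
  have h1 : \sum_(i < m1) p i < 1 / 4.
    by rewrite ltNge; apply/negP => /mmin; rewrite ltnn.
  have h2 : \sum_(i < w) p (m1 + i)%N <= 1 / 4.
    apply: (@le_trans _ _ (\sum_(i < w) (4 / Num.sqrt l))).
      by apply: ler_sum => i _; exact: poisson_pmf_bound.
    rewrite sumr_const card_ord -[leLHS]mulr_natl mulrA ler_pdivrMr//; lra.
  by lra.
- by rewrite addKn.
Qed.

End PoissonSpread.

(** * Compound Poisson demand *)

Definition vecsub (n : nat) (x y : 'cV[nat]_n) : 'cV[nat]_n :=
  \col_i subn (x i 0) (y i 0).

Section CompoundPoisson.
Context {R : realType} {M : network R} {d : measure_display}.
Context {Om : measurableType d} {P : probability Om R}.
Variables (t0 : R) (D : R -> Om -> 'cV[nat]_(nprod M)).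
Variables (N : R -> Om -> nat) (S : nat -> Om -> 'cV[nat]_(nprod M)).
Hypothesis mN : forall (t : R) c, t0 <= t -> measurable [set w | N t w = c].
Hypothesis mS : forall q v, measurable [set w | S q w = v].
Hypothesis N0 : forall w, N t0 w = 0%N.
Hypothesis Nmono : forall w (s t : R), t0 <= s -> s <= t -> (N s w <= N t w)%N.
Hypothesis NSlaw : forall (r p : nat) (s : nat -> R) (c : nat -> nat)
          (v : nat -> 'cV[nat]_(nprod M)),
        t0 <= s 0%N -> (forall l, (l < r)%N -> s l < s l.+1) ->
        P ([set w | forall l, (l < r)%N -> N (s l.+1) w = (N (s l) w + c l)%N]
           `&` [set w | forall q, (q < p)%N -> S q w = v q])
        = (\prod_(l < r) poisson_pmf (rate M * (s l.+1 - s l)) (c l)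
           * \prod_(q < p) osize (v q))%:E.
Hypothesis DE : forall (t : R) w, t0 <= t -> D t w = \sum_(q < N t w) S q w.
Local Open Scope ereal_scope.
Local Notation vec := 'cV[nat]_(nprod M).

(** Stated through the probabilities of the values of the first order sizes, which is
    the form in which a compound Poisson process is given. *)
Definition indep_sizes (E : set Om) : Prop :=
  measurable E /\ forall p (v : nat -> vec),
    P (E `&` [set w | forall q, (q < p)%N -> S q w = v q]) =
    P E * (\prod_(q < p) osize (v q))%:E.

Lemma measurable_sizes p (v : nat -> vec) :
  measurable [set w | forall q, (q < p)%N -> S q w = v q].
Proof.
rewrite (_ : [set w | _] = \bigcap_(q in [set q | (q < p)%N]) [set w | S q w = v q]).
  by apply: bigcap_measurableType.
by apply/seteqP; split=> w /=.
Qed.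

Lemma counts_law (r : nat) (s : nat -> R) (c : nat -> nat) :
  (t0 <= s 0%N)%R -> (forall l, (l < r)%N -> (s l < s l.+1)%R) ->
  P [set w | forall l, (l < r)%N -> N (s l.+1) w = (N (s l) w + c l)%N] =
  (\prod_(l < r) poisson_pmf (rate M * (s l.+1 - s l)) (c l))%:E.
Proof.
move=> ht hs; have := NSlaw 0 c (fun=> 0%R) ht hs.
rewrite big_ord0 mulr1 (_ : [set w | forall q, (q < 0)%N -> _] = setT) ?setIT//.
by apply/seteqP; split.
Qed.

Lemma indep_sizes_counts (r : nat) (s : nat -> R) (c : nat -> nat) :
  (t0 <= s 0%N)%R -> (forall l, (l < r)%N -> (s l < s l.+1)%R) ->
  measurable [set w | forall l, (l < r)%N -> N (s l.+1) w = (N (s l) w + c l)%N] ->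
  indep_sizes [set w | forall l, (l < r)%N -> N (s l.+1) w = (N (s l) w + c l)%N].
Proof.
by move=> ht hs mE; split=> // p v; rewrite NSlaw// counts_law// EFinM.
Qed.

Lemma indep_sizesT : indep_sizes setT.
Proof.
have -> : [set: Om] =
    [set w | forall l, (l < 0)%N -> N ((fun=> t0) l.+1) w = (N ((fun=> t0) l) w + 0)%N].
  by apply/seteqP; split.
apply: (@indep_sizes_counts 0%N (fun=> t0) (fun=> 0%N)) => //.
by rewrite (_ : [set w | _] = setT)//; apply/seteqP; split.
Qed.

Lemma indep_sizes0 : indep_sizes set0.
Proof. by split=> // p v; rewrite set0I measure0 mul0e. Qed.

(** At s = t0 the count N s is 0, so that one interval of the product formula is
    needed instead of two. *)
Lemma indep_sizes_window s t a c : (t0 <= s)%R -> (s < t)%R ->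
  indep_sizes ([set w | N s w = a] `&` [set w | N t w = (N s w + c)%N]).
Proof.
move=> t0s st; have t0t : (t0 <= t)%R by rewrite (le_trans t0s)// ltW.
have mE : measurable ([set w | N s w = a] `&` [set w | N t w = (N s w + c)%N]).
  rewrite (_ : _ `&` _ = [set w | N s w = a] `&` [set w | N t w = (a + c)%N]).
    by apply: measurableI; exact: mN.
  by apply/seteqP; split=> w [/= <- ->].
move: t0s; rewrite le_eqVlt => /orP[/eqP t0s|t0s].
  have [->|a0] := eqVneq a 0%N.
    have E2 : [set w | N s w = 0%N] `&` [set w | N t w = (N s w + c)%N] =
        [set w | forall l, (l < 1)%N -> N (nth t [:: s; t] l.+1) w =
                     (N (nth t [:: s; t] l) w + c)%N].
      apply/seteqP; split=> w /=; first by move=> [_ h] [|[|]].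
      by move=> h; have := h 0%N isT; rewrite /= -t0s N0.
    rewrite E2; apply: (@indep_sizes_counts 1 (nth t [:: s; t]) (fun=> c)).
    - by rewrite -t0s.
    - by case.
    - rewrite -E2 (_ : _ `&` _ = [set w | N t w = c]); first exact: mN.
      by apply/seteqP; split=> w; rewrite /= -t0s N0; [move=> [_ ->]|move=> ->].
  rewrite (_ : _ `&` _ = set0); first exact: indep_sizes0.
  by apply/seteqP; split=> w //=; rewrite -t0s N0 => -[/eqP]; rewrite eq_sym (negbTE a0).
have E2 : [set w | N s w = a] `&` [set w | N t w = (N s w + c)%N] =
    [set w | forall l, (l < 2)%N -> N (nth t [:: t0; s; t] l.+1) w =
                 (N (nth t [:: t0; s; t] l) w + nth 0%N [:: a; c] l)%N].
  apply/seteqP; split=> w /=; first by move=> [h1 h2] [|[|]]//= _; rewrite ?N0.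
  by move=> h; have := h 0%N isT; have := h 1%N isT; rewrite /= N0 add0n.
rewrite E2; apply: indep_sizes_counts => //; last by rewrite -E2.
by case=> [|[|]].
Qed.

Lemma law_window s t c : (t0 <= s)%R -> (s < t)%R ->
  P [set w | N t w = (N s w + c)%N] = (poisson_pmf (rate M * (t - s)) c)%:E.
Proof.
move=> t0s st; have := @counts_law 1 (nth t [:: s; t]) (fun=> c) t0s.
rewrite big_ord1 /= => <-; last by case.
congr (P _); apply/seteqP; split=> w /=; first by move=> h [|[|]].
by move=> h; exact: (h 0%N isT).
Qed.

(** The sizes are exchangeable: the product of the weights does not see the order in
    which the first n of them are listed. *)
Lemma sizes_law p (x : 'I_p -> vec) (sg : 'I_p -> nat) (n : nat)
    (tau : 'I_n -> 'I_p) :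
  bijective tau -> (forall j : 'I_n, sg (tau j) = j) -> 
  P [set w | forall i, S (sg i) w = x i] = (\prod_(i < p) osize (x i))%:E.
Proof.
move=> btau sgtau.
(* the default value is never read: only q < n matters *)
pose v q := if insub q is Some j then x (tau j) else 0%R.
have vE (j : 'I_n) : v j = x (tau j) by rewrite /v valK.
rewrite (_ : [set w | _] = setT `&` [set w | forall q, (q < n)%N -> S q w = v q]).
  rewrite indep_sizesT.2 probability_setT mul1e (reindex tau); last exact: onW_bij.
  by congr (_%:E); apply: eq_bigr => j _; rewrite vE.
rewrite setTI; case: btau => tau' tauK tau'K.
apply/seteqP; split=> w /= h.
  by move=> q qn; have := h (tau (Ordinal qn)); rewrite sgtau -vE.
move=> i; have := h (tau' i) (ltn_ord _); rewrite vE tau'K => <-.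
by rewrite -sgtau tau'K.
Qed.

(** A block of c sizes has the same joint law whether it starts at 0 or at a: rotate
    the first a + c sizes, which are exchangeable. *)
Lemma integral_sizes_shift E a c (h : vec -> \bar R) :
  indep_sizes E -> (forall x, 0 <= h x) ->
  \int[P]_(w in E) h (\sum_(q < c) S (a + q)%N w)%R =
  P E * \int[P]_w h (\sum_(q < c) S q w)%R.
Proof.
move=> [mE iE] h0.
pose f (x : {ffun 'I_(a + c) -> vec}) := h (\sum_(q < c) x (rshift a q))%R.
(* tau and sg exchange the first a and the last c positions *)
pose tau (j : 'I_(c + a)) : 'I_(a + c) :=
  match fintype.split j with inl q => rshift a q | inr k => lshift c k end.
pose sg (i : 'I_(a + c)) : 'I_(c + a) :=
  match fintype.split i with inl k => rshift c k | inr q => lshift a q end.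
have split_l m n (q : 'I_m) : fintype.split (lshift n q) = inl q.
  by rewrite -[lshift n q]/(unsplit (inl q)) unsplitK.
have split_r m n (q : 'I_n) : fintype.split (rshift m q) = inr q.
  by rewrite -[rshift m q]/(unsplit (inr q)) unsplitK.
have tauK : cancel tau sg.
  by move=> j; rewrite /tau /sg; case: (split_ordP j) => q ->; rewrite ?split_l ?split_r.
have sgK : cancel sg tau.
  by move=> j; rewrite /tau /sg; case: (split_ordP j) => q ->; rewrite ?split_l ?split_r.
have btau : bijective tau by exists sg.
pose X (w : Om) := [ffun q : 'I_(a + c) => S q w].
pose X' (w : Om) := [ffun q : 'I_(a + c) => S (sg q) w].
have XE (x : {ffun 'I_(a + c) -> vec}) : [set w | X w = x] =
    [set w | forall q, (q < a + c)%N -> S q w = if insub q is Some j then x j else 0%R].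
  apply/seteqP; split=> w /=.
    by move=> <- q qn; rewrite insubT ffunE.
  move=> hw; apply/ffunP => j; rewrite ffunE hw ?ltn_ord// valK//.
have X'E (x : {ffun 'I_(a + c) -> vec}) :
    [set w | X' w = x] = [set w | forall i, S (sg i) w = x i].
  by apply/seteqP; split=> w /=; [move=> <- i; rewrite ffunE|move=> hw; apply/ffunP => j; rewrite ffunE hw].
have mX' x : measurable [set w | X' w = x].
  rewrite X'E (_ : [set w | _] = \bigcap_(i in setT) [set w | S (sg i) w = x i]).
    by apply: fin_bigcap_measurable => //; exact: finite_finset.
  by apply/seteqP; split=> w /=; [move=> hw i _; exact: hw|move=> hw i; exact: hw].
have lawX' x : P [set w | X' w = x] = (\prod_(i < a + c) osize (x i))%:E.
  by rewrite X'E (@sizes_law _ x sg _ tau)// => j; rewrite tauK.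
have Pfin : P E = (fine (P E))%:E by rewrite fineK// fin_num_measure.
rewrite Pfin.
transitivity (\int[P]_(w in E) f (X w)).
  by apply: eq_integral => w _; congr h; apply: eq_bigr => q _; rewrite ffunE.
rewrite (integral_proportional_laws (X' := X') (c := fine (P E)))//.
- congr (_ * _); apply: eq_integral => w _; congr h; apply: eq_bigr => q _.
  by rewrite ffunE /sg split_r.
- by rewrite fine_ge0.
- by move=> x; rewrite XE; exact: measurable_sizes.
- move=> x; rewrite XE iE -Pfin lawX'; congr (_ * _%:E).
  by apply: eq_bigr => i _; rewrite valK.
- by move=> x; exact: h0.
Qed.

Definition window_sum s t (w : Om) : vec := (\sum_(q < N t w - N s w) S (N s w + q)%N w)%R.

Lemma D_window_sum s t w : (t0 <= s)%R -> (s <= t)%R -> D t w = (D s w + window_sum s t w)%R.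
Proof.
move=> t0s st; rewrite !DE ?(le_trans t0s)// /window_sum.
rewrite -[in LHS](subnKC (Nmono w t0s st)).
rewrite -(big_mkord xpredT (fun q => S q w)) /index_iota subn0 iotaD big_cat /=.
rewrite -{1}[N s w]subn0 -/(index_iota 0 (N s w)) big_mkord; congr (_ + _)%R.
by rewrite add0n -{1}[N s w]addn0 iotaDl big_map -[X in iota 0 X]subn0 -/(index_iota 0 _) big_mkord.
Qed.

Lemma vecsub_window_sum s t w : (t0 <= s)%R -> (s <= t)%R -> vecsub (D t w) (D s w) = window_sum s t w.
Proof.
move=> t0s st; apply/matrixP => i j.
by rewrite (D_window_sum w t0s st) !mxE ord1 addrC; exact: addnK.
Qed.

Lemma discrete_size_sum c :
  discrete_wrt measurable (fun w => \sum_(q < c) S q w)%R.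
Proof.
have sm := @sigma_algebra_measurable _ Om.
elim: c => [|c IH].
  under eq_fun do rewrite big_ord0; exact: discrete_cst.
under eq_fun do rewrite big_ord_recr /=.
apply: (discrete_comp2 +%R) => //.
by apply: (discrete_countable (0%R : vec)) => // x; exact: mS.
Qed.

Lemma discrete_D t : (t0 <= t)%R -> discrete_wrt measurable (D t).
Proof.
move=> t0t; rewrite (_ : D t = fun w => (\sum_(q < N t w) S q w)%R); last first.
  by apply/funext => w; rewrite DE.
apply: (discrete_random_index (0%R : vec) (X := fun c w => (\sum_(q < c) S q w)%R)).
- exact: sigma_algebra_measurable.
- by move=> c; exact: mN.
- exact: discrete_size_sum.
Qed.

Lemma discrete_window_sum s t : (t0 <= s)%R -> (s <= t)%R ->
  discrete_wrt measurable (window_sum s t).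
Proof.
move=> t0s st.
have -> : window_sum s t = fun w => vecsub (D t w) (D s w).
  apply/funext => w; apply/matrixP => i j; rewrite (D_window_sum w t0s st) !mxE ord1.
  by rewrite addrC; symmetry; exact: addnK.
apply: (discrete_comp2 (@vecsub _)); first exact: sigma_algebra_measurable.
- by apply: discrete_D; exact: le_trans st.
- exact: discrete_D.
Qed.

(** The law of an increment depends on the window only through its length. Conditioning on
    the number of orders before and within the window leaves a block of order sizes
    independent of these numbers. *)
Lemma integral_window_sum (h : vec -> \bar R) s t : (t0 <= s)%R -> (s < t)%R ->
  (forall x, 0 <= h x) ->
  \int[P]_w h (window_sum s t w) =
  \sum_(c <oo) (poisson_pmf (rate M * (t - s)) c)%:E * \int[P]_w h (\sum_(q < c) S q w)%R.
Proof.
move=> t0s st h0; have st' := ltW st.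
have dN c : [set w | (N t w - N s w)%N = c] = [set w | N t w = (N s w + c)%N].
  apply/seteqP; split=> w /=; first by move=> <-; rewrite subnKC// Nmono.
  by move=> ->; rewrite addKn.
have mNs c : measurable [set w | N s w = c] by exact: mN.
have mNt c : measurable [set w | N t w = (N s w + c)%N].
  rewrite -dN.
  apply: (discrete_preimage [set c] (@sigma_algebra_measurable _ Om)).
  apply: (discrete_comp2 subn); first exact: sigma_algebra_measurable.
    by apply: discrete_nat => x; apply: mN; exact: le_trans st'.
  exact: discrete_nat.
rewrite (@integral_level_sets _ _ _ P setT (fun w => (N t w - N s w)%N))//; last 2 first.
- by move=> c; rewrite dN.
- apply: discrete_emeasurable.
  by apply: discrete_comp; exact: discrete_window_sum.
apply: eq_eseriesr => c _; rewrite setTI dN -law_window//.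
rewrite (@integral_level_sets _ _ _ P _ (N s))//; last first.
  apply: discrete_emeasurable.
  by apply: discrete_comp; exact: discrete_window_sum.
set k := \int[P]_w _.
have k0 : 0 <= k by exact: integral_ge0.
rewrite muleC -integral_cst// (@integral_level_sets _ _ _ P _ (N s))//.
apply: eq_eseriesr => a _; rewrite integral_cst; last exact: measurableI.
rewrite setIC [RHS]muleC -(@integral_sizes_shift _ a c h (indep_sizes_window a c t0s st) h0).
apply: eq_integral => w; rewrite inE => -[/= <- Nt].
by rewrite /window_sum Nt addKn.
Qed.

Lemma integral_size q (h : vec -> \bar R) : (forall x, 0 <= h x) ->
  \int[P]_w h (S q w) = \int[P]_w h (S 0%N w).
Proof.
move=> h0; have := @integral_sizes_shift _ q 1 _ indep_sizesT h0.
rewrite probability_setT mul1e.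
under eq_integral do rewrite big_ord1 addn0.
by under [in RHS]eq_integral do rewrite big_ord1.
Qed.

Lemma size0_law x : P [set w | S 0%N w = x] = (osize x)%:E.
Proof.
have := indep_sizesT.2 1%N (fun=> x); rewrite setTI probability_setT mul1e big_ord1 => <-.
congr (P _); apply/seteqP; split=> w /=; first by move=> h [|].
by move=> h; exact: (h 0%N isT).
Qed.

Hypothesis mu_gt0 : forall i, (0 < mu M i 0)%R.

Lemma integral_size_mean i : \int[P]_w (S 0%N w i 0%R)%:R%:E = (mu M i 0%R / rate M)%:E.
Proof.
have := mu_gt0 i; rewrite mxE mulrAC mulfV ?mul1r ?gt_eqF ?rate_gt0//.
rewrite (pmulr_rgt0 _ (rate_gt0 M)); set E := esum _ _ => Egt0.
rewrite (@integral_countable_esum _ _ _ P _ _ (fun v : vec => (v i 0%R)%:R%:E))//.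
rewrite fineK; last first.
  by move: Egt0; case: E => //=; rewrite ltxx.
by apply: eq_esum => v _; rewrite size0_law -EFinM mulrC.
Qed.

Lemma poisson_pmf_sum s t : (t0 <= s)%R -> (s < t)%R ->
  \sum_(c <oo) (poisson_pmf (rate M * (t - s)) c)%:E = 1.
Proof.
move=> t0s st; have := @integral_window_sum (fun=> 1) s t t0s st (fun=> lee01).
have int1 : \int[P]__ 1 = 1 by rewrite integral_cst// mul1e; exact: probability_setT.
rewrite int1 => ->.
by apply: eq_eseriesr => c _; rewrite mule1.
Qed.

Lemma poisson_pmf_mean s t : (t0 <= s)%R -> (s < t)%R ->
  \sum_(c <oo) (poisson_pmf (rate M * (t - s)) c * c%:R)%:E = (rate M * (t - s))%:E.
Proof.
move=> t0s st; set l := (rate M * (t - s))%R.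
have l0 : (0 < l)%R by rewrite mulr_gt0 ?rate_gt0 ?subr_gt0.
have p0 c : 0 <= (poisson_pmf l c * c%:R)%:E.
  by rewrite lee_fin mulr_ge0 ?poisson_pmf_ge0.
rewrite nneseries_recl// mulr0 add0e -nneseries_addn//.
transitivity (\sum_(c <oo) l%:E * (poisson_pmf l c)%:E); last first.
  rewrite nneseriesZl ?poisson_pmf_sum ?mule1//.
  by move=> c _; rewrite lee_fin poisson_pmf_ge0.
apply: eq_eseriesr => c _; rewrite -EFinM; congr (_%:E).
rewrite /poisson_pmf l0 addn1 factS natrM exprS invfM.
have c0 : (c.+1%:R != 0 :> R)%R by rewrite pnatr_eq0.
have f0 : (c`!%:R != 0 :> R)%R by rewrite pnatr_eq0 -lt0n fact_gt0.
move: c0 f0; move: (c.+1%:R)%R (c`!%:R)%R (expR _) => x y z x0 y0.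
by field; rewrite x0 y0.
Qed.

Lemma integral_size_sum i c e : \int[P]_w (S 0%N w i 0%R)%:R%:E = e%:E ->
  \int[P]_w ((\sum_(q < c) S q w)%R i 0%R)%:R%:E = (c%:R * e)%:E.
Proof.
move=> he.
transitivity (\int[P]_w \sum_(q < c) (S q w i 0%R)%:R%:E).
  by apply: eq_integral => w _; rewrite summxE natr_sum sumEFin.
rewrite ge0_integral_sum//; last first.
  move=> q; apply: discrete_emeasurable.
  apply: (discrete_comp (fun v : vec => (v i 0%R)%:R%:E)).
  by apply: (discrete_countable (0%R : vec)) => // x; exact: mS.
transitivity (\sum_(q < c) e%:E); last first.
  by rewrite sumEFin big_const_ord iter_addr addr0 mulr_natl.
apply: eq_bigr => q _; rewrite -he.
by rewrite (@integral_size q (fun v : vec => (v i 0%R)%:R%:E))// => x; rewrite lee_fin.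
Qed.

Lemma integral_D_fin t i : (t0 <= t)%R ->
  \int[P]_w (D t w i 0%R)%:R%:E < +oo.
Proof.
move=> t0t; have D0 w : D t0 w = 0%R by rewrite DE// N0 big_ord0.
move: t0t; rewrite le_eqVlt => /orP[/eqP <-|t0t].
  under eq_integral do rewrite D0 mxE.
  by rewrite integral0.
have he := integral_size_mean i; set e := (mu M i 0%R / rate M)%R in he.
rewrite (eq_integral (fun w => (fun v : vec => (v i 0%R)%:R%:E) (window_sum t0 t w))); last first.
  by move=> w _; rewrite (D_window_sum w (lexx _) (ltW t0t)) D0 add0r.
rewrite (@integral_window_sum (fun v : vec => (v i 0%R)%:R%:E))//.
rewrite (eq_eseriesr (g := fun c => e%:E * (poisson_pmf (rate M * (t - t0)) c * c%:R)%:E)).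
  rewrite nneseriesZl ?poisson_pmf_mean// -?EFinM ?ltry//.
  by move=> c _; rewrite lee_fin mulr_ge0 ?poisson_pmf_ge0.
move=> c _; rewrite (integral_size_sum c he) -!EFinM; congr (_%:E); ring.
Qed.

Lemma integral_increment_stationary (h : vec -> \bar R) s t :
  (t0 <= s)%R -> (s < t)%R -> (forall x, 0 <= h x) ->
  \int[P]_w h (vecsub (D t w) (D s w)) =
  \int[P]_w h (vecsub (D (t0 + (t - s))%R w) (D t0 w)).
Proof.
move=> t0s st h0.
have t0' : (t0 < t0 + (t - s))%R by rewrite ltrDl subr_gt0.
under eq_integral do rewrite vecsub_window_sum ?(ltW st)//.
under [in RHS]eq_integral do rewrite vecsub_window_sum ?(ltW t0')//.
by rewrite !integral_window_sum// (addrC t0) addrK.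
Qed.

Lemma integral_weighted_size_sum (a : 'I_(nprod M) -> nat) c :
  \int[P]_w (\sum_i a i * (\sum_(q < c) S q w)%R i 0%R)%N%:R%:E =
  (c%:R * \sum_i (a i)%:R * (mu M i 0%R / rate M))%:E.
Proof.
transitivity (\int[P]_w \sum_i (a i)%:R%:E * ((\sum_(q < c) S q w)%R i 0%R)%:R%:E).
  apply: eq_integral => w _; rewrite natr_sum -sumEFin; apply: eq_bigr => i _.
  by rewrite natrM.
rewrite ge0_integral_sum//; last first.
  move=> i; apply: discrete_emeasurable.
  exact: (discrete_comp (fun v : vec => (a i)%:R%:E * (v i 0%R)%:R%:E) (discrete_size_sum c)).
rewrite mulr_sumr -sumEFin; apply: eq_bigr => i _.
rewrite ge0_integralZl_EFin//; last first.
  apply: discrete_emeasurable.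
  exact: (discrete_comp (fun v : vec => (v i 0%R)%:R%:E) (discrete_size_sum c)).
rewrite (integral_size_sum c (integral_size_mean i)) -EFinM; congr (_%:E); ring.
Qed.

Lemma poisson_partial_sum s t n : (t0 <= s)%R -> (s < t)%R ->
  (\sum_(c < n) poisson_pmf (rate M * (t - s)) c <= 1)%R.
Proof.
move=> t0s st; rewrite -lee_fin -(poisson_pmf_sum t0s st) -sumEFin.
rewrite (@nneseries_split _ _ 0 n); last by move=> k _; rewrite lee_fin poisson_pmf_ge0.
rewrite add0n big_mkord leeDl// nneseries_ge0// => k _.
by rewrite lee_fin poisson_pmf_ge0.
Qed.

Lemma poisson_partial_sum_ge s t : (t0 <= s)%R -> (s < t)%R ->
  exists n, (1 / 4 <= \sum_(c < n) poisson_pmf (rate M * (t - s)) c)%R.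
Proof.
move=> t0s st; apply: contrapT => nex.
have : \sum_(c <oo) (poisson_pmf (rate M * (t - s)) c)%:E <= (1 / 4)%:E.
  apply: lime_le; first by apply: is_cvg_nneseries => k _ _; rewrite lee_fin poisson_pmf_ge0.
  apply: nearW => n; rewrite big_mkord sumEFin lee_fin leNgt; apply/negP => h.
  by apply: nex; exists n; exact: ltW.
by rewrite poisson_pmf_sum// lee_fin; lra.
Qed.

(** Write f n for the total weight of the first n orders. If y is below f m2 it is far from
    f n for all n >= m2, if it is above f m1 it is far from f n for all n <= m1, and the
    two distances add up to at least f m2 - f m1, of mean (m2 - m1) times the mean weight
    of an order. *)
Lemma window_sum_deviation (a : 'I_(nprod M) -> nat) (y : R) s t m1 m2 :
  (t0 <= s)%R -> (s < t)%R -> (m1 < m2)%N ->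
  (1 / 4 <= \sum_(n < m1.+1) poisson_pmf (rate M * (t - s)) n)%R ->
  (\sum_(n < m2) poisson_pmf (rate M * (t - s)) n <= 1 / 2)%R ->
  ((m2 - m1)%:R / 4 * \sum_i (a i)%:R * (mu M i 0%R / rate M))%:E <=
  \int[P]_w (`|(\sum_i a i * window_sum s t w i 0%R)%N%:R - y|)%:E.
Proof.
move=> t0s st m12 h1 h2; set p := poisson_pmf _ in h1 h2.
pose nu (v : vec) := (\sum_i a i * v i 0%R)%N.
pose f m w := nu (\sum_(q < m) S q w)%R.
set e := (\sum_i (a i)%:R * (mu M i 0%R / rate M))%R.
have intf m : \int[P]_w (f m w)%:R%:E = (m%:R * e)%:E by exact: integral_weighted_size_sum.
have e0 : (0 <= e)%R.
  by rewrite -lee_fin -[e]mul1r -(intf 1%N); exact: integral_ge0.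
have nuD u v : nu (u + v)%R = (nu u + nu v)%N.
  rewrite /nu -big_split; apply: eq_bigr => i _; rewrite mxE; exact: mulnDr.
have fmono m n w : (m <= n)%N -> (f m w <= f n w)%N.
  move=> mn; rewrite /f -(subnKC mn) big_split_ord nuD; exact: leq_addr.
have mf m (h : nat -> \bar R) : measurable_fun setT (fun w => h (f m w)).
  apply: discrete_emeasurable.
  exact: (discrete_comp (fun v => h (nu v)) (discrete_size_sum m)).
pose al := \int[P]_w (Num.max 0 (y - (f m1 w)%:R))%:E.
pose be := \int[P]_w (Num.max 0 ((f m2 w)%:R - y))%:E.
have al0 : 0 <= al by apply: integral_ge0 => w _; rewrite lee_fin le_max lexx.
have be0 : 0 <= be by apply: integral_ge0 => w _; rewrite lee_fin le_max lexx.
(* (y - f m1)^+ + (f m2 - y)^+ >= f m2 - f m1 pointwise *)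
have albe : ((m2 - m1)%:R * e)%:E <= al + be.
  have fd : \int[P]_w ((f m2 w)%:R - (f m1 w)%:R)%:E = ((m2 - m1)%:R * e)%:E.
    have : \int[P]_w ((f m2 w)%:R - (f m1 w)%:R)%:E + \int[P]_w (f m1 w)%:R%:E =
        \int[P]_w (f m2 w)%:R%:E.
      rewrite -ge0_integralD//.
      - by apply: eq_integral => w _; rewrite -EFinD subrK.
      - by move=> w _; rewrite lee_fin subr_ge0 ler_nat fmono// ltnW.
      - apply: discrete_emeasurable; apply: (discrete_comp2 (fun x y : nat => (x%:R - y%:R)%:E)).
        + exact: sigma_algebra_measurable.
        + exact: (discrete_comp nu (discrete_size_sum m2)).
        + exact: (discrete_comp nu (discrete_size_sum m1)).
      - exact: (mf m1 (fun n => n%:R%:E)).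
    rewrite !intf natrB ?(ltnW m12)// => h.
    have -> : \int[P]_w ((f m2 w)%:R - (f m1 w)%:R)%:E = (m2%:R * e)%:E - (m1%:R * e)%:E.
      by rewrite -h addeK.
    by rewrite -EFinB mulrBl.
  rewrite -fd -ge0_integralD//; last 4 first.
  - by move=> w _; rewrite lee_fin le_max lexx.
  - exact: (mf m1 (fun n => (Num.max 0 (y - n%:R))%:E)).
  - by move=> w _; rewrite lee_fin le_max lexx.
  - exact: (mf m2 (fun n => (Num.max 0 (n%:R - y))%:E)).
  apply: ge0_le_lower_integral => w _.
    by rewrite lee_fin subr_ge0 ler_nat fmono// ltnW.
  rewrite -EFinD lee_fin.
  have : (y - (f m1 w)%:R <= Num.max 0 (y - (f m1 w)%:R))%R by rewrite le_max lexx orbT.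
  have : ((f m2 w)%:R - y <= Num.max 0 ((f m2 w)%:R - y))%R by rewrite le_max lexx orbT.
  by lra.
rewrite (@integral_window_sum (fun v => (`|(nu v)%:R - y|)%:E))// -/p.
pose g n := \int[P]_w (`|(f n w)%:R - y|)%:E.
have g0 n : 0 <= g n by exact: integral_ge0.
have p0 n : 0 <= (p n)%:E by rewrite lee_fin poisson_pmf_ge0.
have galpha n : (n <= m1)%N -> al <= g n.
  move=> nm; apply: ge0_le_lower_integral => w _; first by rewrite lee_fin le_max lexx.
  rewrite lee_fin ge_max normr_ge0/= distrC; apply: le_trans (ler_norm _).
  by rewrite lerB// ler_nat fmono.
have gbeta n : (m2 <= n)%N -> be <= g n.
  move=> nm; apply: ge0_le_lower_integral => w _; first by rewrite lee_fin le_max lexx.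
  rewrite lee_fin ge_max normr_ge0/=; apply: le_trans (ler_norm _).
  by rewrite lerB// ler_nat fmono.
have pg0 n : 0 <= (p n)%:E * g n by exact: mule_ge0.
rewrite (@nneseries_split _ (fun n => (p n)%:E * g n) 0 m1.+1)// add0n.
have low : (1 / 4)%:E * al <= \sum_(0 <= n < m1.+1) (p n)%:E * g n.
  rewrite big_mkord; apply: (@le_trans _ _ (\sum_(n < m1.+1) (p n)%:E * al)).
    by rewrite -ge0_sume_distrl// sumEFin lee_wpmul2r// lee_fin.
  by apply: lee_sum => n _; rewrite lee_wpmul2l// galpha// -ltnS.
have high : (1 / 4)%:E * be <= \sum_(m1.+1 <= n <oo) (p n)%:E * g n.
  rewrite (@nneseries_split _ (fun n => (p n)%:E * g n) m1.+1 (m2 - m1.+1))// subnKC//.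
  apply: (@le_trans _ _ (\sum_(m2 <= n <oo) (p n)%:E * g n)); last first.
    by rewrite leeDr// sume_ge0.
  have tail : (1 / 4)%:E <= \sum_(m2 <= n <oo) (p n)%:E.
    have := poisson_pmf_sum t0s st; rewrite -/p (@nneseries_split _ _ 0 m2)// add0n big_mkord sumEFin.
    have : 0 <= \sum_(m2 <= n <oo) (p n)%:E by exact: nneseries_ge0.
    case: (\sum_(m2 <= n <oo) (p n)%:E) => //= r r0 [E].
    by rewrite lee_fin; lra.
  have befin : be = (fine be)%:E.
    rewrite fineK// ge0_fin_numE//.
    apply: (@le_lt_trans _ _ (\int[P]_w ((f m2 w)%:R%:E + `|y|%:E))).
      apply: ge0_le_lower_integral => w _; first by rewrite lee_fin le_max lexx.
      rewrite -EFinD lee_fin ge_max addr_ge0//=.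
      by rewrite lerD2l -normrN ler_norm.
    rewrite ge0_integralD//; last exact: (mf m2 (fun n => n%:R%:E)).
    by rewrite intf integral_prob_cst -EFinD ltry.
  apply: (@le_trans _ _ (be * \sum_(m2 <= n <oo) (p n)%:E)).
    by rewrite muleC lee_wpmul2l.
  rewrite befin -nneseriesZl//.
  rewrite -(@nneseries_addn _ (fun n => (p n)%:E * g n) m2)//.
  rewrite -(@nneseries_addn _ (fun n => (fine be)%:E * (p n)%:E) m2); last first.
    by move=> n; rewrite mule_ge0// lee_fin fine_ge0.
  apply: lee_nneseries => n _; first by rewrite mule_ge0// lee_fin fine_ge0.
  by rewrite -befin muleC lee_wpmul2l// gbeta// leq_addl.
apply: le_trans (leeD low high); rewrite -ge0_muleDr//.
apply: le_trans (lee_wpmul2l _ albe); last by rewrite lee_fin.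
by rewrite -EFinM lee_fin; lra.
Qed.

End CompoundPoisson.

Section CompoundPoissonFacts.
Context {R : realType} {M : network R} {d : measure_display}.
Context {Om : measurableType d} {P : probability Om R}.
Variables (t0 : R) (D : R -> Om -> 'cV[nat]_(nprod M)).
Hypothesis cpD : compound_poisson P t0 D.
Hypothesis mu_gt0 : forall i, 0 < mu M i 0.

Lemma compound_poisson_mono s t w i : t0 <= s -> s <= t -> (D s w i 0%R <= D t w i 0%R)%N.
Proof.
have [N [S [mN mS /all_and3[N0 Nm _] NSlaw DE]]] := cpD => t0s st.
by rewrite (D_window_sum Nm DE w t0s st) mxE leq_addr.
Qed.

Lemma compound_poisson_mean_fin t i : t0 <= t ->
  (\int[P]_w (D t w i 0)%:R%:E < +oo)%E.
Proof.
have [N [S [mN mS /all_and3[N0 Nm _] NSlaw DE]]] := cpD.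
exact: (integral_D_fin mN mS N0 Nm NSlaw DE mu_gt0).
Qed.

Lemma compound_poisson_stationary (h : 'cV[nat]_(nprod M) -> \bar R) s t :
  t0 <= s -> s < t -> (forall x, 0 <= h x)%E ->
  (\int[P]_w h (vecsub (D t w) (D s w)) =
  \int[P]_w h (vecsub (D (t0 + (t - s)) w) (D t0 w)))%E.
Proof.
have [N [S [mN mS /all_and3[N0 Nm _] NSlaw DE]]] := cpD.
exact: (integral_increment_stationary mN mS N0 Nm NSlaw DE).
Qed.

Lemma compound_poisson_deviation (a : 'I_(nprod M) -> nat) (y : R) t :
  t0 < t -> 2 <= rate M * (t - t0) -> 32 <= Num.sqrt (rate M * (t - t0)) ->
  ((Num.sqrt (rate M * (t - t0)) / 128 * \sum_i (a i)%:R * (mu M i 0%R / rate M))%:E <=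
  \int[P]_w (`|(\sum_i a i * vecsub (D t w) (D t0 w) i 0%R)%N%:R - y|)%:E)%E.
Proof.
have [N [S [mN mS /all_and3[N0 Nm _] NSlaw DE]]] := cpD => t0t l2 sl.
have [|||m1 [m2 [m12 h1 h2 hm]]] := @poisson_spread _ _ l2.
- by move=> n; exact: (poisson_partial_sum mN mS N0 Nm NSlaw DE).
- exact: (poisson_partial_sum_ge mN mS N0 Nm NSlaw DE).
- exact: sl.
have e0 : 0 <= \sum_i (a i)%:R * (mu M i 0 / rate M).
  by apply: sumr_ge0 => i _; rewrite mulr_ge0// divr_ge0// ltW// rate_gt0.
have := window_sum_deviation mN mS N0 Nm NSlaw DE mu_gt0 a y (lexx _) t0t m12 h1 h2.
under [X in _ -> (_ <= X)%E]eq_integral do rewrite (vecsub_window_sum Nm DE _ (lexx _) (ltW t0t)).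
apply: le_trans; rewrite lee_fin ler_wpM2r//; lra.
Qed.

End CompoundPoissonFacts.

(** * The demand of a system and its filtration *)

Section SystemFacts.
Context {R : realType} {M : network R}.
Hypothesis mu_gt0 : forall i, 0 < mu M i 0.
Context {L : R} {S : system M}.
Hypothesis hS : is_system L S.
Local Notation P := (sprob S).
Local Notation K := (nclass M).
Local Notation vec := 'cV[R]_(nprod M).

Lemma lead_mono k l : (k <= l)%N -> (l <= K)%N -> lead S k <= lead S l.
Proof.
elim: l => [|l IH]; first by rewrite leqn0 => /eqP ->.
rewrite leq_eqVlt => /orP[/eqP -> //|]; rewrite ltnS => kl lK.
by apply: (le_trans (IH kl (ltnW lK))); apply/ltW/(lead_lt hS).
Qed.

Lemma lead_ge0 k : (k <= K)%N -> 0 <= lead S k.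
Proof. by move=> kK; rewrite -(lead0 hS); exact: lead_mono. Qed.

Lemma lead_leL k : (k <= K)%N -> lead S k <= L.
Proof. by move=> kK; rewrite -(leadK hS); exact: lead_mono. Qed.

Lemma L_gt0 : 0 < L.
Proof.
have K0 := nclass_gt0 M.
rewrite -(leadK hS) -(prednK K0); apply: le_lt_trans (lead_lt hS _); last by rewrite prednK.
by apply: lead_ge0; rewrite leq_pred.
Qed.

Lemma dem_mono s t w i : - L <= s -> s <= t -> (dem S s w i 0%R <= dem S t w i 0%R)%N.
Proof. exact: (compound_poisson_mono (dem_poisson hS)). Qed.

Lemma dinc_vecsub s t w : - L <= s -> s <= t ->
  dinc s t w = toR R (vecsub (dem S t w) (dem S s w)).
Proof.
move=> Ls st; apply/matrixP => i j.
by rewrite !mxE natrB// dem_mono.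
Qed.

Lemma dincD (s t u : R) (w : sspace S) : dinc s u w = dinc s t w + dinc t u w.
Proof. by rewrite /dinc [RHS]addrC subrKA. Qed.

Lemma dincxx (s : R) (w : sspace S) : dinc s s w = 0.
Proof. by rewrite /dinc subrr. Qed.

Lemma dinc_ge0 s t w i : - L <= s -> s <= t -> 0 <= dinc (S := S) s t w i 0.
Proof. by move=> Ls st; rewrite dinc_vecsub// mxE. Qed.

Lemma dem_discrete_filt s t : - L <= s -> s <= t ->
  discrete_wrt (filt S t) (dem S s).
Proof.
move=> Ls st; apply: (discrete_sub (filt_incr hS Ls st)).
apply: (discrete_countable (0 : 'cV[nat]_(nprod M))).
  by have [] := filt_sigma hS Ls.
by move=> v; exact: (dem_adapted hS).
Qed.

Lemma dinc_discrete_filt s t u : - L <= s -> s <= u -> - L <= t -> t <= u ->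
  discrete_wrt (filt S u) (dinc (S := S) s t).
Proof.
move=> Ls su Lt tu.
apply: (discrete_comp2 (fun x y : 'cV[nat]_(nprod M) => toR R y - toR R x)).
- by apply: (filt_sigma hS); exact: le_trans su.
- exact: dem_discrete_filt.
- exact: dem_discrete_filt.
Qed.

Lemma filt_discrete_measurable t (T : Type) (X : sspace S -> T) : - L <= t ->
  discrete_wrt (filt S t) X -> discrete_wrt measurable X.
Proof. by move=> Lt; apply: discrete_sub; exact: (filt_measurable hS). Qed.

Lemma dinc_discrete s t : - L <= s -> - L <= t ->
  discrete_wrt measurable (dinc (S := S) s t).
Proof.
move=> Ls Lt; apply: (@filt_discrete_measurable (Num.max s t)).
  by rewrite le_max Ls.
by apply: dinc_discrete_filt => //; rewrite le_max lexx ?orbT.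
Qed.

Lemma integral_dinc_stationary (h : vec -> \bar R) s t :
  - L <= s -> s < t -> (forall x, 0 <= h x)%E ->
  (\int[P]_w h (dinc s t w) = \int[P]_w h (dinc (- L) (- L + (t - s)) w))%E.
Proof.
move=> Ls st h0.
have Lt : - L <= - L + (t - s) by rewrite lerDl subr_ge0 ltW.
under eq_integral do rewrite (dinc_vecsub _ Ls (ltW st)).
under [in RHS]eq_integral do rewrite (dinc_vecsub _ (lexx _) Lt).
exact: (compound_poisson_stationary (dem_poisson hS) (h := fun v => h (toR R v))).
Qed.

(** The demand in (s, t] is independent of the information at time s and has the law of an
    increment of the same length starting at - L, as in the stages of phi. *)
Lemma integral_dinc_indep (T : Type) (X : sspace S -> T) (g : T -> vec -> \bar R) s t :
  - L <= s -> s < t -> discrete_wrt (filt S s) X -> (forall x v, 0 <= g x v)%E ->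
  (\int[P]_w g (X w) (dinc s t w) =
   \int[P]_w \int[P]_w' g (X w) (dinc (- L) (- L + (t - s)) w'))%E.
Proof.
move=> Ls st dX g0; have st' := ltW st.
transitivity (\int[P]_w \int[P]_w' g (X w) (dinc s t w'))%E; last first.
  by apply: eq_integral => w _; exact: integral_dinc_stationary.
under eq_integral do rewrite (dinc_vecsub _ Ls st').
under [in RHS]eq_integral do under eq_integral do rewrite (dinc_vecsub _ Ls st').
have incE v : [set w | vecsub (dem S t w) (dem S s w) = v] =
    [set w | dem S t w = dem S s w + v].
  apply/seteqP; split=> w /= => [<-|->].
    by apply/matrixP => i j; rewrite !mxE ord1; symmetry; apply: subnKC; exact: dem_mono.
  by apply/matrixP => i j; rewrite !mxE ord1; exact: addKn.
have minc v : measurable [set w | vecsub (dem S t w) (dem S s w) = v].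
  apply: (discrete_preimage [set v] (@sigma_algebra_measurable _ _)).
  apply: (discrete_comp2 (@vecsub _)); first exact: sigma_algebra_measurable.
    apply: (@filt_discrete_measurable t); first exact: le_trans st'.
    by apply: dem_discrete_filt => //; exact: le_trans st'.
  by apply: (filt_discrete_measurable Ls); exact: dem_discrete_filt.
apply: (integral_discrete_indep (F := filt S s) (g := fun x v => g x (toR R v))) => //.
- exact: (filt_measurable hS).
- by move=> E v FE; rewrite incE; exact: (dem_indep hS).
Qed.

Definition mean_dem (t : R) (i : 'I_(nprod M)) : R :=
  fine (\int[P]_w ((dem S t w i 0)%:R)%:E).

Lemma integral_dem t i : - L <= t ->
  (\int[P]_w ((dem S t w i 0)%:R)%:E = (mean_dem t i)%:E)%E.
Proof.
move=> Lt; rewrite /mean_dem fineK// ge0_fin_numE; last exact: integral_ge0.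
exact: (compound_poisson_mean_fin (dem_poisson hS) mu_gt0).
Qed.

Lemma integrable_dem t i : - L <= t ->
  P.-integrable setT (fun w => ((dem S t w i 0)%:R)%:E).
Proof.
move=> Lt; apply/integrableP; split.
  apply: discrete_emeasurable; apply: (filt_discrete_measurable Lt).
  exact: (discrete_comp (fun v : 'cV[nat]_(nprod M) => ((v i 0)%:R)%:E) (dem_discrete_filt Lt (lexx _))).
under eq_integral do rewrite gee0_abs//.
exact: (compound_poisson_mean_fin (dem_poisson hS) mu_gt0).
Qed.

Lemma integrable_dinc s t i : - L <= s -> - L <= t ->
  P.-integrable setT (fun w => (dinc (S := S) s t w i 0)%:E).
Proof.
move=> Ls Lt.
under eq_fun do rewrite !mxE EFinB.
by apply: integrableB => //; exact: integrable_dem.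
Qed.

Lemma integral_dinc s t i : - L <= s -> - L <= t ->
  (\int[P]_w (dinc (S := S) s t w i 0)%:E = (mean_dem t i - mean_dem s i)%:E)%E.
Proof.
move=> Ls Lt.
under eq_integral do rewrite !mxE EFinB.
by rewrite integralB ?integral_dem//; exact: integrable_dem.
Qed.

End SystemFacts.

(** * The stochastic program with non-negative costs *)

Section LinearAlgebra.
Context {R : realType}.

Lemma dotDr p (u v w : 'cV[R]_p) : dot u (v + w) = dot u v + dot u w.
Proof. by rewrite /dot -big_split; apply: eq_bigr => i _; rewrite mxE mulrDr. Qed.

Lemma dotNr p (u v : 'cV[R]_p) : dot u (- v) = - dot u v.
Proof. by rewrite /dot -sumrN; apply: eq_bigr => i _; rewrite mxE mulrN. Qed.

Lemma dotBr p (u v w : 'cV[R]_p) : dot u (v - w) = dot u v - dot u w.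
Proof. by rewrite /dot -sumrB; apply: eq_bigr => i _; rewrite !mxE mulrBr. Qed.

Lemma dotDl p (u v w : 'cV[R]_p) : dot (u + v) w = dot u w + dot v w.
Proof. by rewrite /dot -big_split; apply: eq_bigr => i _; rewrite mxE mulrDl. Qed.

Lemma dotE p (u v : 'cV[R]_p) : dot u v = (u^T *m v) 0 0.
Proof. by rewrite !mxE; apply: eq_bigr => i _; rewrite mxE. Qed.

Lemma dot_trmx m n (A : 'M[R]_(m, n)) u v : dot (A^T *m u) v = dot u (A *m v).
Proof. by rewrite !dotE trmx_mul trmxK mulmxA. Qed.

Lemma dot0r p (u : 'cV[R]_p) : dot u 0 = 0.
Proof. by rewrite /dot big1// => i _; rewrite mxE mulr0. Qed.

Lemma dot_ge0 p (u v : 'cV[R]_p) : (forall i, 0 <= u i 0) -> lev 0 v -> 0 <= dot u v.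
Proof.
move=> u0 v0; apply: sumr_ge0 => i _; apply: mulr_ge0 => //.
by have := v0 i; rewrite mxE.
Qed.

Lemma lev_subr p (u v : 'cV[R]_p) : lev u v -> lev 0 (v - u).
Proof. by move=> uv i; rewrite !mxE subr_ge0. Qed.

Lemma ereal_infD_EFin (A : set (\bar R)) (r : R) :
  (ereal_inf A + r%:E = ereal_inf [set u + r%:E | u in A])%E.
Proof.
apply/eqP; rewrite eq_le; apply/andP; split.
  apply: le_ereal_inf_tmp => _ [u Au <-]; apply: leeD2r; exact: ereal_inf_lbound.
rewrite -leeBlDr//; apply: le_ereal_inf_tmp => u Au.
by rewrite leeBlDr//; apply: ereal_inf_lbound; exists u.
Qed.

End LinearAlgebra.

Section Psi.
Context {R : realType} {M : network R}.
Local Notation K := (nclass M).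
Local Notation vecm := 'cV[R]_(nprod M).
Local Notation vecn := 'cV[R]_(ncomp M).

(** The cost rate when z is served: y - A z stays in stock and x - z is backlogged. *)
Definition alloc_cost (y : vecn) (x z : vecm) : R :=
  dot (hcost M) (y - bomR M *m z) + dot (bcost M) (x - z).

(** The recursion of phi with the initial value replaced by the minimal allocation cost; see
    [phi_psi] for the relation between the two. *)
Fixpoint psi (L : R) (S : system M) (k : nat) (y : vecn) (x : vecm) {struct k} : \bar R :=
  match k with
  | 0 => ereal_inf [set (alloc_cost y x z)%:E | z in [set z | lev z x /\ lev (bomR M *m z) y]]
  | k'.+1 => ereal_inf [set (\int[sprob S]_w
       psi L S k' y' (x + dinc (- L) (- L + (lead S k - lead S k')) w)%R)%E |
       y' in [set y' | agree_off k y y']]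
  end.

Definition psi_stage (L : R) (S : system M) k (y : vecn) (x : vecm) : \bar R :=
  (\int[sprob S]_w psi L S k.-1 y (x + dinc (- L) (- L + (lead S k - lead S k.-1)) w)%R)%E.

Lemma alloc_cost_ge0 y x z : lev z x -> lev (bomR M *m z) y -> 0 <= alloc_cost y x z.
Proof.
move=> zx zy; apply: addr_ge0; apply: dot_ge0; try exact: lev_subr.
  by move=> j; exact/ltW/hcost_gt0.
by move=> i; exact/ltW/bcost_gt0.
Qed.

Lemma psi_ge0 L S k y x : (0 <= psi L S k y x)%E.
Proof.
elim: k y x => [|k IH] y x /=.
  by apply: le_ereal_inf_tmp => _ [z [zx zy] <-]; rewrite lee_fin alloc_cost_ge0.
by apply: le_ereal_inf_tmp => _ [y' _ <-]; exact: integral_ge0.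
Qed.

(** The infima in psi^k replace the coordinates of the classes at most k. *)
Lemma psi_ext L S k (y y' : vecn) x :
  (forall j, (k < class_of j)%N -> y j 0 = y' j 0) -> psi L S k y x = psi L S k y' x.
Proof.
elim: k y y' x => [|k IH] y y' x yy' /=.
  suff -> : y = y' by [].
  apply/matrixP => j i; rewrite ord1; apply: yy'.
  by have [/andP[]] := class_ofP j.
have half (u v : vecn) : (forall j, (k.+1 < class_of j)%N -> u j 0 = v j 0) ->
    forall y1, agree_off k.+1 u y1 -> exists2 y2, agree_off k.+1 v y2 &
      forall x, psi L S k y1 x = psi L S k y2 x.
  move=> uv y1 uy1.
  exists (\col_j if class_of j == k.+1 then y1 j 0 else v j 0).
    by move=> j /negbTE jk; rewrite mxE jk.
  move=> x'; apply: IH => j kj; rewrite mxE; case: eqP => // /eqP jk.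
  by rewrite uy1// uv// ltn_neqAle eq_sym jk.
congr ereal_inf; apply/seteqP; split=> _ [y1 /= h1 <-].
  have [y2 h2 E] := half _ _ yy' _ h1; exists y2 => //.
  by apply: eq_integral => w _; rewrite E.
have [|y2 h2 E] := half y' y _ _ h1; first by move=> j /yy'.
by exists y2 => //; apply: eq_integral => w _; rewrite E.
Qed.

Lemma psiS L S k y x :
  psi L S k.+1 y x = ereal_inf [set psi_stage L S k.+1 y' x | y' in [set y' | agree_off k.+1 y y']].
Proof. by []. Qed.

Lemma psi_le_stage L S k y x : (psi L S k.+1 y x <= psi_stage L S k.+1 y x)%E.
Proof. by rewrite psiS; apply: ereal_inf_lbound; exists y. Qed.

Hypothesis mu_gt0 : forall i, 0 < mu M i 0.
Context {L : R} {S : system M}.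
Hypothesis hS : is_system L S.
Local Notation P := (sprob S).

Definition mean_backlog_charge (k : nat) : R :=
  \sum_i bcost M i 0 * (mean_dem (S:=S) 0 i - mean_dem (S:=S) (- lead S k) i).

(** What must be added to phi^k to make it non-negative: the holding cost of the components of
    classes above k, the backlog cost of the demand x seen so far, and that of the expected
    demand D^1 + ... + D^k. *)
Definition psi_offset (k : nat) (y : vecn) (x : vecm) : R :=
  \sum_(j | (k < class_of j)%N) hcost M j 0 * y j 0 + dot (bcost M) x + mean_backlog_charge k.

Lemma mean_dem_stationary s t i : - L <= s -> s < t ->
  mean_dem (S:=S) t i - mean_dem (S:=S) s i =
  mean_dem (S:=S) (- L + (t - s)) i - mean_dem (S:=S) (- L) i.
Proof.
move=> Ls st; have Lt : - L <= t by rewrite (le_trans Ls)// ltW.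
have Lts : - L <= - L + (t - s) by rewrite lerDl subr_ge0 ltW.
apply: EFin_inj; rewrite -!(integral_dinc mu_gt0 hS)//.
have normE u v : - L <= u -> u <= v -> (\int[P]_w (dinc u v w i 0)%:E =
    \int[P]_w (fun x : vecm => (`|x i 0|)%:E) (dinc u v w))%E.
  by move=> Lu uv; apply: eq_integral => w _ /=; rewrite ger0_norm// (dinc_ge0 hS).
by rewrite !normE ?(ltW st)//;
  apply: (@integral_dinc_stationary _ _ _ _ hS (fun x : vecm => (`|x i 0|)%:E) _ _ Ls st).
Qed.

Lemma integral_dot_dinc (b : vecm) s t (c : R) : - L <= s -> - L <= t ->
  P.-integrable setT (fun w => (c + dot b (dinc (S := S) s t w))%:E) /\
  (\int[P]_w (c + dot b (dinc (S := S) s t w))%:E =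
   (c + \sum_i b i 0 * (mean_dem (S:=S) t i - mean_dem (S:=S) s i))%:E)%E.
Proof.
move=> Ls Lt.
have int1 i : P.-integrable setT (fun w => ((b i 0)%:E * (dinc (S := S) s t w i 0)%:E)%E).
  by apply: integrableZl => //; exact: (integrable_dinc mu_gt0 hS).
have E : (fun w => (c + dot b (dinc (S := S) s t w))%:E) =
    (fun w => (cst c%:E w + \sum_i (b i 0)%:E * (dinc (S := S) s t w i 0)%:E)%E).
  by apply/funext => w; rewrite EFinD /dot -sumEFin.
have intc : P.-integrable setT (cst c%:E).
  exact: finite_measure_integrable_cst.
have ints : P.-integrable setT (fun w => (\sum_i (b i 0)%:E * (dinc (S := S) s t w i 0)%:E)%E).
  by apply: integrable_sum => // i _.
rewrite E; split; first exact: integrableD.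
rewrite integralD//= integral_prob_cst EFinD; congr (_ + _)%E.
rewrite integral_sum// -sumEFin; apply: eq_bigr => i _.
by rewrite integralZl ?(integral_dinc mu_gt0 hS)//; exact: (integrable_dinc mu_gt0 hS).
Qed.

(** Passing from phi to psi adds an integrable function under the expectation; its mean moves
    the backlog charge by one stage. *)
Lemma stage_obj_psi_offset k (y y' : vecn) x : (k < K)%N ->
  (forall y x, phi L S k y x + (psi_offset k y x)%:E = psi L S k y x)%E ->
  agree_off k.+1 y y' ->
  (stage_obj L S k.+1 (phi L S k) y' x + (psi_offset k.+1 y x)%:E = psi_stage L S k.+1 y' x)%E.
Proof.
move=> kK IH yy'.
have lk : lead S k < lead S k.+1 by exact: (lead_lt hS).
have Lk : - L <= - lead S k.+1 by rewrite lerN2 (lead_leL hS).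
have Lk0 : - L <= - L + (lead S k.+1 - lead S k) by rewrite lerDl subr_ge0 ltW.
set D := fun w : sspace S => dinc (- L) (- L + (lead S k.+1 - lead S k)) w.
have shD w : psi_offset k y' (x + D w) = psi_offset k y' x + dot (bcost M) (D w).
  by rewrite /psi_offset dotDr; ring.
have [iD ID] := integral_dot_dinc (bcost M) (psi_offset k y' x) (lexx (- L)) Lk0.
have dD : discrete_wrt measurable D by exact: (dinc_discrete hS).
have := @integral_ge0_addr _ _ _ P (fun w => psi L S k y' (x + D w))
  (fun w => phi L S k y' (x + D w)) (fun w => psi_offset k y' (x + D w)).
rewrite /psi_stage /= -/D => <-; first last.
- by move=> w; rewrite IH.
- by under eq_fun do rewrite /= shD.
- by move=> w; exact: psi_ge0.
- apply: discrete_emeasurable; exact: (discrete_comp (fun v => psi L S k y' (x + v)) dD).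
under [X in _ = (_ + X)%E]eq_integral do rewrite shD.
rewrite ID /stage_obj /= -/D [RHS]addeC [LHS]addeAC -EFinD; congr (_%:E + _)%E.
have -> : \sum_i bcost M i 0 * (mean_dem (S:=S) (- L + (lead S k.+1 - lead S k)) i
      - mean_dem (S:=S) (- L) i) = mean_backlog_charge k.+1 - mean_backlog_charge k.
  rewrite /mean_backlog_charge -sumrB; apply: eq_bigr => i _.
  rewrite -mulrBr; congr (_ * _).
  have := @mean_dem_stationary (- lead S k.+1) (- lead S k) i Lk.
  by rewrite ltrN2 opprK [- lead S k + _]addrC => <-//; ring.
rewrite /psi_offset (bigID (fun j => class_of j == k.+1) (fun j => (k < class_of j)%N))/=.
have -> : \sum_(j | (k < class_of j)%N && (class_of j == k.+1)) hcost M j 0 * y' j 0 =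
   \sum_(j | class_of j == k.+1) hcost M j 0 * y' j 0.
  by apply: eq_bigl => j; case: eqP => [->|]; rewrite ?ltnSn ?andbF.
have -> : \sum_(j | (k < class_of j)%N && (class_of j != k.+1)) hcost M j 0 * y' j 0 =
   \sum_(j | (k.+1 < class_of j)%N) hcost M j 0 * y j 0.
  apply: eq_big => [j|j /andP[_ jk]]; last by rewrite yy'.
  by rewrite [RHS]ltn_neqAle andbC eq_sym.
ring.
Qed.

(** The offset does not involve the coordinates over which the infimum is taken. *)
Lemma phi_psi k y x : (k <= K)%N ->
  (phi L S k y x + (psi_offset k y x)%:E = psi L S k y x)%E.
Proof.
elim: k y x => [|k IH] y x kK.
  rewrite /=.
  have -> : psi_offset 0 y x = dot (hcost M) y + dot (bcost M) x.
    have -> : psi_offset 0 y x = \sum_(j | (0 < class_of j)%N) hcost M j 0 * y j 0 + dot (bcost M) x.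
      rewrite /psi_offset /mean_backlog_charge (lead0 hS) oppr0 [X in _ + X]big1 ?addr0//.
      by move=> i _; rewrite subrr mulr0.
    congr (_ + _); apply: eq_bigl => j.
    by have [/andP[]] := class_ofP j.
  rewrite -ereal_infN ereal_infD_EFin; congr ereal_inf.
  have E z : - dot (ccost M) z + (dot (hcost M) y + dot (bcost M) x) = alloc_cost y x z.
    by rewrite /alloc_cost /ccost !dotBr dotDl dot_trmx; ring.
  apply/seteqP; split=> [_ [_ [_ [z hz <-] <-] <-]|_ [z hz <-]] /=.
    by exists z => //; rewrite -EFinD E.
  by exists (- (dot (ccost M) z)%:E)%E; [exists (dot (ccost M) z)%:E => //; exists z|rewrite -EFinD E].
rewrite psiS /= ereal_infD_EFin.
have E y' : agree_off k.+1 y y' ->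
    (stage_obj L S k.+1 (phi L S k) y' x + (psi_offset k.+1 y x)%:E = psi_stage L S k.+1 y' x)%E.
  by apply: stage_obj_psi_offset => // *; apply: IH; exact: ltnW.
congr ereal_inf; apply/seteqP; split.
  by move=> _ [_ [y' hy' <-] <-] /=; exists y' => //; rewrite E.
move=> _ [y' hy' <-] /=.
by exists (stage_obj L S k.+1 (phi L S k) y' x); [exists y'|exact: E].
Qed.

Lemma stage_obj_psi k (y y' : vecn) x : (k < K)%N -> agree_off k.+1 y y' ->
  (stage_obj L S k.+1 (phi L S k) y' x + (psi_offset k.+1 y x)%:E = psi_stage L S k.+1 y' x)%E.
Proof. by move=> kK; apply: stage_obj_psi_offset => // *; apply: phi_psi; exact: ltnW. Qed.

Lemma lower_bound_psi : lower_bound L S = psi L S K 0 0.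
Proof.
rewrite /lower_bound -phi_psi//; congr (_ + _)%E.
have L0 : - L <= 0 by rewrite oppr_le0 ltW// (L_gt0 hS).
rewrite /psi_offset dot0r [X in X + _ + _]big1; last by move=> j _; rewrite mxE mulr0.
rewrite !add0r /mean_backlog_charge (leadK hS) -sumEFin; apply: eq_bigr => i _.
by rewrite unlock (integral_dinc mu_gt0 hS)// EFinM.
Qed.

End Psi.

(** * Order quantities chosen over time *)

Section Chain.
Context {R : realType} {M : network R}.
Local Notation K := (nclass M).
Local Notation vecm := 'cV[R]_(nprod M).
Local Notation vecn := 'cV[R]_(ncomp M).
Hypothesis mu_gt0 : forall i, 0 < mu M i 0.
Context {L : R} {S : system M}.
Hypothesis hS : is_system L S.
Local Notation P := (sprob S).

Lemma class_le j : (class_of (n:=M) j <= K)%N.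
Proof. by have [/andP[]] := class_ofP j. Qed.

Lemma class_gt0 j : (0 < class_of (n:=M) j)%N.
Proof. by have [/andP[]] := class_ofP j. Qed.

Lemma psi_stage_ext k (y y' : vecn) x : (0 < k)%N ->
  (forall j, (k <= class_of j)%N -> y j 0 = y' j 0) ->
  psi_stage L S k y x = psi_stage L S k y' x.
Proof.
move=> k0 yy'; apply: eq_integral => w _; apply: psi_ext => j.
by rewrite prednK//; exact: yy'.
Qed.

Variable t : R.
Hypothesis t0 : 0 <= t.

Lemma order_time_ge k : (k <= K)%N -> - L <= t - lead S k.
Proof.
by move=> kK; rewrite -[leLHS]add0r lerD// lerN2 (lead_leL hS).
Qed.

Lemma window_start_le k : (k <= K)%N -> t - L <= t - lead S k.
Proof. by move=> kK; rewrite lerD2l lerN2 (lead_leL hS). Qed.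

Lemma window_start_ge : - L <= t - L. Proof. by rewrite lerDr. Qed.

(** Demand in the window [t - L, t] already observed when class k orders for time t. *)
Definition known_demand k : sspace S -> vecm := dinc (t - L) (t - lead S k).

Lemma known_demand_discrete k : (k <= K)%N -> discrete_wrt (filt S (t - lead S k)) (known_demand k).
Proof.
move=> kK; apply: (dinc_discrete_filt hS) => //.
- exact: window_start_ge.
- exact: window_start_le.
- exact: order_time_ge.
Qed.

(** The classes above k are fixed by time t - L_(k+1), so that averaging over the demand between
    the order times of classes k+1 and k produces the objective of stage k+1. *)
Lemma integral_psi_step k (y : sspace S -> vecn) : (k < K)%N ->
  (forall j, (k < class_of j)%N ->
     discrete_wrt (filt S (t - lead S k.+1)) (fun w => y w j 0)) ->
  (\int[P]_w psi L S k (y w) (known_demand k w) =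
   \int[P]_w psi_stage L S k.+1 (y w) (known_demand k.+1 w))%E.
Proof.
move=> kK dy.
(* the classes at most k are set to 0 because they may depend on later demand *)
pose mask (v : vecn) : vecn := \col_j if (k < class_of j)%N then v j 0 else 0.
have maskE v x : psi L S k v x = psi L S k (mask v) x.
  by apply: psi_ext => j kj; rewrite mxE kj.
have sF := filt_sigma hS (order_time_ge kK).
have dX : discrete_wrt (filt S (t - lead S k.+1)) (fun w => (mask (y w), known_demand k.+1 w)).
  apply: (discrete_comp2 pair) => //; last exact: known_demand_discrete.
  apply: discrete_col => // j.
  have [kj|kj] := boolP (k < class_of j)%N.
    by under eq_fun do rewrite mxE kj; exact: dy.
  by under eq_fun do rewrite mxE (negbTE kj); exact: discrete_cst.
have lk : t - lead S k.+1 < t - lead S k by rewrite ltrD2l ltrN2 (lead_lt hS).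
have := @integral_dinc_indep _ _ _ _ hS _ _
  (fun p v => psi L S k p.1 (p.2 + v)%R) _ _ (order_time_ge kK) lk dX.
rewrite /= => /(_ (fun _ _ => psi_ge0 _ _ _ _ _)) E.
transitivity (\int[P]_w psi L S k (mask (y w)) (known_demand k.+1 w + dinc (t - lead S k.+1) (t - lead S k) w)%R)%E.
  by apply: eq_integral => w _; rewrite maskE /known_demand -dincD.
rewrite E; apply: eq_integral => w _; rewrite /psi_stage /=.
apply: eq_integral => w' _; rewrite [RHS]maskE.
by congr psi; congr (_ + dinc _ _ _); ring.
Qed.

Lemma known_demand_top w : known_demand K w = 0.
Proof. by rewrite /known_demand (leadK hS) dincxx. Qed.

(** Each stage of psi minimizes after the averaging step, hence does at least as well as the
    given order quantities. *)
Lemma psi_le_nonanticipating (y : sspace S -> vecn) :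
  (forall j, discrete_wrt (filt S (t - leadc S j)) (fun w => y w j 0)) ->
  (psi L S K 0 0 <= \int[P]_w psi L S 0 (y w) (known_demand 0 w))%E.
Proof.
move=> dy.
suff H k : (k <= K)%N ->
    (\int[P]_w psi L S k (y w) (known_demand k w) <= \int[P]_w psi L S 0 (y w) (known_demand 0 w))%E.
  apply: le_trans (H K (leqnn K)).
  rewrite -[leLHS](integral_prob_cst P); apply: ge0_le_lower_integral => w _.
    exact: psi_ge0.
  rewrite known_demand_top (@psi_ext _ _ L S K 0 (y w))// => j.
  by rewrite ltnNge class_le.
elim: k => [//|k IH] kK.
apply: le_trans (IH (ltnW kK)); rewrite (integral_psi_step kK).
  apply: ge0_le_lower_integral => w _; first exact: psi_ge0.
  exact: psi_le_stage.
move=> j kj; apply: (discrete_sub _ (dy j)).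
have jK := class_le j.
apply: (filt_incr hS); first exact: order_time_ge.
by rewrite lerD2l lerN2 (lead_mono hS).
Qed.

Variable Y : R -> sspace S -> vecn.
Hypothesis hY : is_targets L Y.

(** Class-k targets set at t - L_k, that is, those whose orders are available at time t. *)
Definition arrived_targets (w : sspace S) : vecn := \col_j Y (t - leadc S j) w j 0.
Local Notation y := arrived_targets.

Lemma target_strict k w (y' : vecn) : (1 <= k <= K)%N ->
  agree_off k (y w) y' -> y' <> y w ->
  (psi_stage L S k (y w) (known_demand k w) < psi_stage L S k y' (known_demand k w))%E.
Proof.
move=> kK yy' ny; have [k0 kK'] := andP kK.
have tlk : - lead S k <= t - lead S k by rewrite lerDr.
have tE : target_at Y k (t - lead S k) w = y w.
  by apply/matrixP => j i; rewrite !mxE subrK.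
have := hY kK tlk (w := w); rewrite tE => /(_ y' yy' ny).
have -> : dinc (t - lead S k + lead S k - L) (t - lead S k) w = known_demand k w.
  by rewrite subrK.
case: k k0 {tlk tE} kK kK' yy' => // k _ _ kK yy' /=.
rewrite -!(stage_obj_psi mu_gt0 hS (y := y w))//.
by move=> h; exact: lte_leD.
Qed.

Lemma psi_at_target k w : (k < K)%N ->
  psi L S k.+1 (y w) (known_demand k.+1 w) = psi_stage L S k.+1 (y w) (known_demand k.+1 w).
Proof.
move=> kK; apply/eqP; rewrite eq_le psi_le_stage andTb.
rewrite psiS; apply: le_ereal_inf_tmp => _ [y' /= yy' <-].
have [->//|/eqP ny] := eqVneq y' (y w).
by apply/ltW/target_strict.
Qed.

(** Otherwise exchanging the class-k targets of two states of the world with the same observed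
    demand would yield strictly better targets in one of them. *)
Lemma target_determined_step k w w' : (1 <= k <= K)%N -> known_demand k w = known_demand k w' ->
  (forall j, (k < class_of j)%N -> y w j 0 = y w' j 0) ->
  forall j, (k <= class_of j)%N -> y w j 0 = y w' j 0.
Proof.
move=> kK sk above j; rewrite leq_eqVlt => /orP[/eqP jk|]; last exact: above.
have k0 : (0 < k)%N by case/andP: kK.
(* the targets of w with the class-k part of w', and conversely *)
pose y1 : vecn := \col_i if class_of i == k then y w' i 0 else y w i 0.
pose y2 : vecn := \col_i if class_of i == k then y w i 0 else y w' i 0.
have [E|/eqP n1] := eqVneq y1 (y w).
  by have := congr1 (fun v : vecn => v j 0) E; rewrite /y1 mxE -jk eqxx.
have n2 : y2 <> y w'.
  move=> E; apply: n1; apply/matrixP => i o; rewrite ord1 /y1 mxE.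
  by have := congr1 (fun v : vecn => v i 0) E; rewrite /y2 mxE; case: ifP.
have a1 : agree_off k (y w) y1 by move=> i /negbTE ik; rewrite /y1 mxE ik.
have a2 : agree_off k (y w') y2 by move=> i /negbTE ik; rewrite /y2 mxE ik.
have e1 x : psi_stage L S k y1 x = psi_stage L S k (y w') x.
  apply: psi_stage_ext => // i; rewrite leq_eqVlt /y1 mxE => /orP[/eqP <-|ki].
    by rewrite eqxx.
  by case: ifP => // _; rewrite above.
have e2 x : psi_stage L S k y2 x = psi_stage L S k (y w) x.
  apply: psi_stage_ext => // i; rewrite leq_eqVlt /y2 mxE => /orP[/eqP <-|ki].
    by rewrite eqxx.
  by case: ifP => // _; rewrite above.
have := lt_trans (target_strict kK a1 n1).
rewrite e1 sk => /(_ _ (target_strict kK a2 n2)).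
by rewrite e2 ltxx.
Qed.

Lemma target_determined k w w' : (1 <= k)%N -> (k <= K)%N ->
  (forall l, (k <= l <= K)%N -> known_demand l w = known_demand l w') ->
  forall j, (k <= class_of j)%N -> y w j 0 = y w' j 0.
Proof.
move=> k0 kK; move mE : (K - k)%N => m; elim: m k k0 kK mE => [|m IH] k k0 kK mE sE.
  apply: target_determined_step; rewrite ?k0//; first by apply: sE; rewrite leqnn.
  by move=> j kj; have := class_le j; lia.
apply: target_determined_step; rewrite ?k0//; first by apply: sE; rewrite leqnn.
move=> j kj; have jK := class_le j; apply: (IH k.+1) => //; try lia.
by move=> l /andP[kl lK]; apply: sE; rewrite lK ltnW.
Qed.

Lemma target_discrete j k : (1 <= k <= class_of j)%N ->
  discrete_wrt (filt S (t - lead S k)) (fun w => y w j 0).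
Proof.
move=> /andP[k0 kj]; have jK := class_le j; have kK := leq_trans kj jK.
have sF := filt_sigma hS (order_time_ge kK).
pose U w (l : 'I_K.+1) : vecm := if (k <= l)%N then known_demand l w else 0.
have dU : discrete_wrt (filt S (t - lead S k)) U.
  apply: (discrete_fin (X := fun l w => U w l)) => // l.
  have [kl|kl] := boolP (k <= l)%N; last first.
    rewrite (_ : (fun w => U w l) = fun=> 0); first exact: discrete_cst.
    by apply/funext => w; rewrite /U (negbTE kl).
  rewrite (_ : (fun w => U w l) = known_demand l); last by apply/funext => w; rewrite /U kl.
  have lK : (l <= K)%N by rewrite -ltnS.
  apply: (discrete_sub _ (known_demand_discrete lK)); apply: (filt_incr hS).
    exact: order_time_ge.
  by rewrite lerD2l lerN2 (lead_mono hS).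
apply: (discrete_factor (0 : R) dU) => w w' UE; apply: (target_determined k0 kK) => // l /andP[kl lK].
have := congr1 (fun u => u (Ordinal (lK : (l < K.+1)%N))) UE.
by rewrite /U /= kl.
Qed.

(** The targets attain the infimum of every stage, so the averaging steps are equalities. *)
Lemma psi_targets :
  (\int[P]_w psi L S 0 (y w) (known_demand 0 w) = psi L S K 0 0)%E.
Proof.
suff H k : (k <= K)%N ->
    (\int[P]_w psi L S 0 (y w) (known_demand 0 w) = \int[P]_w psi L S k (y w) (known_demand k w))%E.
  rewrite (H K)// -[RHS](integral_prob_cst P); apply: eq_integral => w _.
  rewrite known_demand_top; apply: psi_ext => j.
  by rewrite ltnNge class_le.
elim: k => [//|k IH] kK.
rewrite (IH (ltnW kK)) integral_psi_step//; last by move=> j kj; exact: target_discrete.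
by apply: eq_integral => w _; rewrite psi_at_target.
Qed.

(** When the slowest class orders, none of the demand in the window has been observed. *)
Lemma top_class_target_cst j w w' : class_of j = K -> y w j 0 = y w' j 0.
Proof.
move=> jK; apply: (@target_determined K) => //; last by rewrite jK.
  exact: nclass_gt0.
by move=> l Kl; rewrite -(eqP (_ : K == l)) ?eqn_leq// !known_demand_top.
Qed.

Lemma targets_nonanticipating j :
  discrete_wrt (filt S (t - leadc S j)) (fun w => y w j 0).
Proof. by apply: target_discrete; rewrite class_gt0 leqnn. Qed.

End Chain.

(** * Feasibility of the policy *)

Section Feasibility.
Context {R : realType} {M : network R}.
Local Notation K := (nclass M).
Local Notation vecm := 'cV[R]_(nprod M).
Local Notation vecn := 'cV[R]_(ncomp M).
Context {L : R} {S : system M}.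
Hypothesis hS : is_system L S.

(** Take a point where the largest value reached before s is attained. *)
Lemma monotone_left_constant (f : R -> nat) (a s : R) : a < s ->
  (forall u v : R, a <= u -> u <= v -> v <= s -> (f u <= f v)%N) ->
  exists c u0, [/\ a <= u0, u0 < s & forall u, u0 <= u < s -> f u = c].
Proof.
move=> as_ fm.
pose p := [pred n | `[< exists u, a <= u < s /\ f u = n >]].
have p0 : exists n, p n by exists (f a); apply/asboolP; exists a; rewrite lexx.
have pm n : p n -> (n <= f s)%N.
  by move=> /asboolP[u [/andP[au us] <-]]; apply: fm => //; exact: ltW.
case: (ex_maxnP p0 pm) => c /asboolP[u0 [/andP[au0 u0s] fu0]] cmax.
exists c, u0; split=> // u /andP[u0u us]; apply/eqP; rewrite eqn_leq; apply/andP; split.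
  by apply: cmax; apply/asboolP; exists u; rewrite us (le_trans au0).
by rewrite -fu0; apply: fm => //; exact: ltW.
Qed.

Lemma near_left (a s : R) (p : R -> Prop) : a < s ->
  (forall u, a <= u < s -> p u) -> \forall u \near s^'-, p u.
Proof.
move=> as_ h; near=> u; apply: h; apply/andP; split.
  by near: u; exact: nbhs_left_ge.
by near: u; exact: nbhs_left_lt.
Unshelve. all: by end_near.
Qed.

Lemma leftlim_constant (f : R -> R) (a s c : R) : a < s ->
  (forall u, a <= u < s -> f u = c) -> leftlim f s = c.
Proof.
by move=> as_ fc; apply: lim_near_cst => //; exact: near_left fc.
Qed.

Variables (ro : R -> sspace S -> 'cV[nat]_(ncomp M)).
Variables (zs : R -> sspace S -> 'cV[nat]_(nprod M)).
Variable BT : R -> sspace S -> vecm.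
Hypothesis hpol : is_policy L ro zs.
Hypothesis hBT : is_backlog_target (IP ro) BT.
Hypothesis hzs : allocation_rule L ro BT zs.

Lemma alloc_inventoryE t w : alloc_inventory ro zs t w = inventory ro zs t w.
Proof.
apply/matrixP => j o; rewrite ord1.
have subE (u v : vecm) : (bomR M *m (u - v)) j 0 = (bomR M *m u) j 0 - (bomR M *m v) j 0.
  by rewrite mulmxBr !mxE.
transitivity ((bomR M *m backlog zs t w) j 0 - ((bomR M *m dinc (t - leadc S j) t w) j 0
   - ((ro (t - leadc S j) w j 0)%:R - (bomR M *m toR R (dem S (t - leadc S j) w)) j 0))).
  by rewrite !mxE.
transitivity ((ro (t - leadc S j) w j 0)%:R - (bomR M *m toR R (zs t w)) j 0); last by rewrite [RHS]mxE.
rewrite /backlog /dinc !subE; ring.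
Qed.

Lemma service_mono i w u v : - L <= u -> u <= v -> (zs u w i 0%R <= zs v w i 0%R)%N.
Proof. by have [m _ _] := hpol.2 i; exact: m. Qed.

Lemma order_mono j w u v : - leadc S j <= u -> u <= v -> (ro u w j 0%R <= ro v w j 0%R)%N.
Proof. by have [m _ _] := hpol.1 j; exact: m. Qed.

Lemma service_left_constant a s w : - L <= a -> a < s ->
  exists (z d : 'cV[nat]_(nprod M)) u0, [/\ a <= u0, u0 < s,
    forall u, u0 <= u < s -> zs u w = z & forall u, u0 <= u < s -> dem S u w = d].
Proof.
move=> La as_.
have zc i : exists cu : nat * R, [/\ a <= cu.2, cu.2 < s & forall u, cu.2 <= u < s -> zs u w i 0 = cu.1].
  have [c [u0 [? ? h]]] := @monotone_left_constant (fun u => zs u w i 0) a s as_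
    (fun u v u0 uv _ => service_mono i w (le_trans La u0) uv).
  by exists (c, u0).
have dc i : exists cu : nat * R, [/\ a <= cu.2, cu.2 < s & forall u, cu.2 <= u < s -> dem S u w i 0 = cu.1].
  have [c [u0 [? ? h]]] := @monotone_left_constant (fun u => dem S u w i 0) a s as_
    (fun u v u0 uv _ => dem_mono hS w i (le_trans La u0) uv).
  by exists (c, u0).
move: zc => /choice[zu zuP]; move: dc => /choice[du duP].
pose u0 := Num.max (\big[Num.max/a]_i (zu i).2) (\big[Num.max/a]_i (du i).2).
have zu0 i : (zu i).2 <= u0 by rewrite le_max (le_bigmax _ (fun i => (zu i).2)).
have du0 i : (du i).2 <= u0 by rewrite le_max (le_bigmax _ (fun i => (du i).2)) orbT.
exists (\col_i (zu i).1), (\col_i (du i).1), u0; split.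
- by rewrite le_max bigmax_ge_id.
- rewrite gt_max; apply/andP; split; apply: bigmax_lt => // i _.
    by have [] := zuP i.
  by have [] := duP i.
- move=> u /andP[uu us]; apply/colP => i; rewrite mxE.
  by have [_ _ ->//] := zuP i; rewrite us (le_trans _ uu).
- move=> u /andP[uu us]; apply/colP => i; rewrite mxE.
  by have [_ _ ->//] := duP i; rewrite us (le_trans _ uu).
Qed.

(** The left limit of the demand cancels between the left limit of the backlog and the jump. *)
Lemma backlog_minus_left_constant s w u0 (z d : 'cV[nat]_(nprod M)) : u0 < s ->
  (forall u, u0 <= u < s -> zs u w = z) -> (forall u, u0 <= u < s -> dem S u w = d) ->
  backlog_minus zs s w = toR R (dem S s w) - toR R z.
Proof.
move=> us zc dc; apply/colP => i; rewrite !mxE.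
rewrite (@leftlim_constant (fun v => backlog zs v w i 0) u0 s ((d i 0)%:R - (z i 0)%:R))//.
  rewrite (@leftlim_constant (fun v => (dem S v w i 0)%:R) u0 s (d i 0)%:R)//; first by ring.
  by move=> u /dc ->.
by move=> u h; rewrite !mxE (zc _ h) (dc _ h).
Qed.

Definition nonneg_state (t : R) (w : sspace S) : Prop :=
  lev 0 (backlog zs t w) /\ lev 0 (inventory ro zs t w).

Lemma backlog_ge0P t w (z : 'cV[nat]_(nprod M)) :
  lev 0 (toR R (dem S t w) - toR R z) <-> forall i, (z i 0%R <= dem S t w i 0%R)%N.
Proof.
split=> h i; have := h i; rewrite !mxE subr_ge0 ler_nat//.
Qed.

Lemma inventory_le u v w : 0 <= u -> u <= v -> zs u w = zs v w ->
  lev 0 (inventory ro zs u w) -> lev 0 (inventory ro zs v w).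
Proof.
move=> u0 uv zE h j; apply: le_trans (h j) _; rewrite [leLHS]mxE [leRHS]mxE zE.
rewrite lerD2r ler_nat.
by apply: order_mono; rewrite ?lerD2r// lerDr.
Qed.

Lemma backlog_le u v w : - L <= u -> u <= v -> zs u w = zs v w ->
  lev 0 (backlog zs u w) -> lev 0 (backlog zs v w).
Proof.
move=> u0 uv zE /backlog_ge0P h; apply/backlog_ge0P => i.
rewrite -zE; apply: leq_trans (h i) _. exact: (dem_mono hS).
Qed.

Lemma service_right_constant s w : 0 <= s -> \forall u \near s^'+, zs u w = zs s w.
Proof.
move=> s0; have Ls : - L <= s by rewrite (le_trans _ s0)// oppr_le0 ltW// (L_gt0 hS).
have : \forall u \near s^'+, forall i, zs u w i 0 = zs s w i 0.
  apply: filter_forall => i; have [_ rc _] := hpol.2 i.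
  exact: (rc w s Ls [set zs s w i 0] (discrete_set1 _)).
by apply: filterS => u h; apply/colP.
Qed.

Lemma state_at_review t w : 0 <= t -> review_epoch ro t w ->
  lev 0 (backlog_minus zs t w) -> nonneg_state t w.
Proof.
move=> t0 rev bm; split=> i.
  have /andP[h _] := ar_bounds hzs i rev; apply: le_trans h; rewrite le_min.
  by rewrite bm /=; have [[+ _] _] := hBT w t0; apply.
by rewrite mxE -alloc_inventoryE (ar_inventory hzs).
Qed.

(** Nothing has been served before time 0, so the backlog just before the first allocation is
    the total demand. *)
Lemma nonneg_state0 w : nonneg_state 0 w.
Proof.
apply: state_at_review; rewrite ?lexx//; first by left.
have L0 : - L < 0 by rewrite oppr_lt0 (L_gt0 hS).
have [z [d [u0 [u0L u00 zc dc]]]] := service_left_constant w (lexx _) L0.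
have z0 : z = 0 by rewrite -(zc u0) ?lexx ?u00// (ar_before0 hzs).
rewrite (backlog_minus_left_constant u00 zc dc) z0.
by apply/backlog_ge0P => i; rewrite mxE.
Qed.

(** At a review epoch the allocation rule keeps inventories non-negative and never serves more
    than the backlog; at any other time the service process does not jump. *)
Lemma nonneg_state_left s w : 0 < s -> (forall u, 0 <= u < s -> nonneg_state u w) ->
  nonneg_state s w.
Proof.
move=> s0 h; have L0 : - L <= 0 by rewrite oppr_le0 ltW// (L_gt0 hS).
have [z [d [u0 [u00 us zc dc]]]] := service_left_constant w L0 s0.
have zu : zs u0 w = z by rewrite zc// lexx.
have du : dem S u0 w = d by rewrite dc// lexx.
have [bu iu] := h u0 (introT andP (conj u00 us)).
have bm : lev 0 (backlog_minus zs s w).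
  rewrite (backlog_minus_left_constant us zc dc); apply/backlog_ge0P => i.
  move: bu; rewrite /backlog zu => /backlog_ge0P/(_ i)/leq_trans; apply.
  exact: (dem_mono hS w i (le_trans L0 u00) (ltW us)).
have [rev|nrev] := pselect (review_epoch ro s w).
  by apply: state_at_review => //; exact: ltW.
have zE : zs u0 w = zs s w.
  rewrite zu; have := ar_idle hzs s0 nrev.
  rewrite (backlog_minus_left_constant us zc dc) /backlog => /addrI/oppr_inj E.
  apply/colP => i; apply/eqP; rewrite -(eqr_nat R); apply/eqP.
  by have := congr1 (fun v : vecm => v i 0) E; rewrite !mxE.
split; last exact: (inventory_le u00 (ltW us) zE iu).
exact: (backlog_le (le_trans L0 u00) (ltW us) zE bu).
Qed.

(** Induction along the half-line: consider the infimum of the times where the claim fails; it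
    holds there by the left-limit argument, and slightly later because service is right-continuous
    and integer-valued. *)
Lemma nonneg_state_always t w : 0 <= t -> nonneg_state t w.
Proof.
move=> t0; apply: contrapT => nt.
pose E := [set u : R | 0 <= u /\ ~ nonneg_state u w].
have Et : E t by [].
have E0 : has_inf E by split; [exists t|exists 0 => u []].
have s0 : 0 <= inf E by apply: lb_le_inf; [exists t|move=> u []].
have below u : 0 <= u < inf E -> nonneg_state u w.
  move=> /andP[u0 us]; apply: contrapT => nu.
  by have := ge_inf E0.2 (conj u0 nu : E u); rewrite leNgt us.
have st : nonneg_state (inf E) w.
  move: s0; rewrite le_eqVlt => /orP[/eqP <-|s0]; first exact: nonneg_state0.
  exact: nonneg_state_left.
have L0 : - L <= 0 by rewrite oppr_le0 ltW// (L_gt0 hS).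
have := service_right_constant w s0; rewrite /at_right.
move=> [e /= e0 he].
have [u [u0 nu] ue] := inf_adherent e0 E0.
have su : inf E <= u by apply: ge_inf => //; exact: E0.2.
have zE : zs (inf E) w = zs u w.
  move: su; rewrite le_eqVlt => /orP[/eqP <-//|su].
  symmetry; apply: he => //=; rewrite distrC ger0_norm ?subr_ge0 ?ltW//.
  by rewrite ltrBlDl.
apply: nu; split.
  by apply: (backlog_le _ su zE st.1); exact: le_trans s0.
exact: (inventory_le s0 su zE st.2).
Qed.

Lemma policy_feasible : feasible L ro zs.
Proof.
split=> //; first by move=> t w; exact: (ar_before0 hzs).
- by move=> t w t0; have [] := nonneg_state_always w t0.
- by move=> t w t0; have [] := nonneg_state_always w t0.
Qed.

End Feasibility.

(** * The cost rate at a fixed time *)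

Section LongRunAverage.
Context {R : realType}.
Implicit Types (f : R -> \bar R) (C T : R).
Local Open Scope ereal_scope.

Lemma average_cst C T : (0 < T)%R ->
  (T^-1)%:E * \int[@lebesgue_measure R]_(t in `[0%R, T]) C%:E = C%:E.
Proof.
move=> T0; transitivity ((T^-1)%:E * (C%:E * (@lebesgue_measure R `[0%R, T]))).
  by congr (_ * _); apply: integral_cst.
rewrite lebesgue_measure_itv/= lte_fin T0 sube0 -!EFinM; congr (_%:E).
by rewrite mulrCA mulVf ?mulr1// gt_eqF.
Qed.

Lemma limsup_average_ge f C : (0 <= C)%R -> (forall t : R, (0 <= t)%R -> C%:E <= f t) ->
  C%:E <= limf_esup (fun T : R =>
    (T^-1)%:E * \int[@lebesgue_measure R]_(t in `[0%R, T]) f t) +oo%R.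
Proof.
move=> C0 Cf; apply: le_ereal_inf_tmp => _ [V [x [xr xV]] <-].
pose T := (Num.max x 0 + 1)%R.
have T0 : (0 < T)%R by rewrite ltr_pwDr// le_max lexx orbT.
have VT : V T by apply: xV; rewrite /T (le_lt_trans (_ : _ <= Num.max x 0)%R)// ?le_max ?lexx// ltrDl.
apply: le_ereal_sup_tmp; exists ((T^-1)%:E * \int[@lebesgue_measure R]_(t in `[0%R, T]) f t).
  by exists T.
rewrite -(average_cst C T0); apply: lee_wpmul2l; first by rewrite lee_fin invr_ge0 ltW.
apply: ge0_le_lower_integral => t /=; rewrite in_itv/= => /andP[t0 _] //.
exact: Cf.
Qed.

Lemma limsup_average_le f C : (forall t : R, (0 <= t)%R -> 0 <= f t) ->
  (forall t : R, (0 <= t)%R -> f t <= C%:E) ->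
  limf_esup (fun T : R =>
    (T^-1)%:E * \int[@lebesgue_measure R]_(t in `[0%R, T]) f t) +oo%R <= C%:E.
Proof.
move=> f0 fC; apply: ereal_inf_le; exists
  (ereal_sup ((fun T : R => (T^-1)%:E * \int[@lebesgue_measure R]_(t in `[0%R, T]) f t)
    @` [set T | (0 < T)%R])).
  by exists [set T | (0 < T)%R] => //; exists 0%R; split.
apply: ge_ereal_sup => _ [T /= T0 <-].
rewrite -(average_cst C T0); apply: lee_wpmul2l; first by rewrite lee_fin invr_ge0 ltW.
apply: ge0_le_lower_integral => t /=; rewrite in_itv/= => /andP[t0 _] //.
  exact: f0.
exact: fC.
Qed.

End LongRunAverage.

Section CostRate.
Context {R : realType} {M : network R}.
Local Notation K := (nclass M).
Local Notation vecm := 'cV[R]_(nprod M).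
Local Notation vecn := 'cV[R]_(ncomp M).
Hypothesis mu_gt0 : forall i, 0 < mu M i 0.
Context {L : R} {S : system M}.
Hypothesis hS : is_system L S.
Local Notation P := (sprob S).

Lemma integral_weighted_sum (n : nat) (a : 'cV[R]_n) (g : sspace S -> 'cV[R]_n) :
  (forall i, 0 <= a i 0) -> (forall w, lev 0 (g w)) ->
  (forall i, discrete_wrt measurable (fun w => g w i 0)) ->
  (\int[P]_w (dot a (g w))%:E = \sum_i (a i 0)%:E * \int[P]_w (g w i 0)%:E)%E.
Proof.
move=> a0 g0 dg.
have g0' i w : 0 <= g w i 0 by have := g0 w i; rewrite mxE.
have mg i : measurable_fun setT (fun w => (g w i 0)%:E).
  by apply: discrete_emeasurable; apply: (discrete_comp EFin); exact: dg.
transitivity (\int[P]_w (\sum_i (a i 0)%:E * (g w i 0)%:E)%E)%E.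
  by apply: eq_integral => w _; rewrite /dot -sumEFin.
rewrite ge0_integral_sum//; last 2 first.
- by move=> i; apply: measurable_funeM; exact: mg.
- by move=> i w _; rewrite lee_fin mulr_ge0.
apply: eq_bigr => i _; rewrite ge0_integralZl_EFin//.
by move=> w _; rewrite lee_fin.
Qed.

Variables (ro : R -> sspace S -> 'cV[nat]_(ncomp M)).
Variables (zs : R -> sspace S -> 'cV[nat]_(nprod M)).

Definition cost_rate (t : R) : \bar R :=
  (\sum_j (hcost M j 0%R)%:E * 'E_(sprob S)[fun w => (inventory ro zs t w j 0)%R] +
   \sum_i (bcost M i 0%R)%:E * 'E_(sprob S)[fun w => (backlog zs t w i 0)%R])%E.

Hypothesis fea : feasible L ro zs.

Lemma order_discrete j t : 0 <= t ->
  discrete_wrt (filt S (t - leadc S j)) (fun w => ro (t - leadc S j) w j 0).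
Proof.
move=> t0; have [[hro _] _ _ _] := fea; have [_ _ ad] := hro j.
by apply: discrete_nat => x; apply: ad; rewrite lerDr.
Qed.

Lemma service_discrete t : 0 <= t -> discrete_wrt (filt S t) (zs t).
Proof.
move=> t0; have [[_ hzs] _ _ _] := fea.
have Lt : - L <= t by rewrite (le_trans _ t0)// oppr_le0 ltW// (L_gt0 hS).
apply: discrete_col; first exact: (filt_sigma hS).
by move=> i; have [_ _ ad] := hzs i; apply: discrete_nat => x; exact: ad.
Qed.

Lemma component_order_time_ge j t : 0 <= t -> - L <= t - leadc S j.
Proof. by move=> t0; apply: (order_time_ge hS t0); exact: class_le. Qed.

Lemma start_le t : 0 <= t -> - L <= t.
Proof. by move=> t0; rewrite (le_trans _ t0)// oppr_le0 ltW// (L_gt0 hS). Qed.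

Lemma dem_discrete t : - L <= t -> discrete_wrt measurable (dem S t).
Proof. by move=> Lt; apply: (filt_discrete_measurable hS Lt); exact: (dem_discrete_filt hS). Qed.

Lemma backlog_discrete t : 0 <= t -> discrete_wrt measurable (backlog zs t).
Proof.
move=> t0; have Lt := start_le t0.
apply: (discrete_comp2 (fun x y => toR R x - toR R y) (@sigma_algebra_measurable _ _)); first exact: dem_discrete.
by apply: (filt_discrete_measurable hS Lt); exact: service_discrete.
Qed.

Lemma inventory_discrete t j : 0 <= t ->
  discrete_wrt measurable (fun w => inventory ro zs t w j 0).
Proof.
move=> t0; have Lt := start_le t0.
under eq_fun do rewrite mxE.
apply: (discrete_comp2 (fun x y => x%:R - (bomR M *m toR R y) j 0) (@sigma_algebra_measurable _ _)).
  by apply: (filt_discrete_measurable hS (component_order_time_ge j t0)); exact: order_discrete.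
by apply: (filt_discrete_measurable hS Lt); exact: service_discrete.
Qed.

Lemma hcost_ge0 j : 0 <= hcost M j 0. Proof. exact/ltW/hcost_gt0. Qed.

Lemma bcost_ge0 i : 0 <= bcost M i 0. Proof. exact/ltW/bcost_gt0. Qed.

Definition holding_backlog t w : R :=
  dot (hcost M) (inventory ro zs t w) + dot (bcost M) (backlog zs t w).

Lemma holding_backlog_ge0 t w : 0 <= t -> 0 <= holding_backlog t w.
Proof.
move=> t0; have [_ _ hb hi] := fea.
apply: addr_ge0; apply: dot_ge0.
- exact: hcost_ge0.
- exact: hi.
- exact: bcost_ge0.
- exact: hb.
Qed.

Lemma dot_discrete n (a : 'cV[R]_n) (X : sspace S -> 'cV[R]_n) :
  (forall j, discrete_wrt measurable (fun w => X w j 0)) ->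
  discrete_wrt measurable (fun w => dot a (X w)).
Proof. by move=> dX; apply: (discrete_comp (dot a)); exact: (discrete_col (@sigma_algebra_measurable _ _)). Qed.

Lemma cost_rateE t : 0 <= t -> cost_rate t = (\int[P]_w (holding_backlog t w)%:E)%E.
Proof.
move=> t0; have [_ _ hb hi] := fea.
have di j := inventory_discrete j t0.
have db i : discrete_wrt measurable (fun w => backlog zs t w i 0).
  by apply: (discrete_comp (fun v : vecm => v i 0)); exact: backlog_discrete.
under eq_integral do rewrite EFinD.
rewrite ge0_integralD//.
- rewrite !integral_weighted_sum//.
  + by rewrite /cost_rate expectation.unlock.
  + exact: bcost_ge0.
  + by move=> w; exact: hb.
  + exact: hcost_ge0.
  + by move=> w; exact: hi.
- by move=> w _; rewrite lee_fin; apply: dot_ge0; [exact: hcost_ge0|exact: hi].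
- by apply: discrete_emeasurable; apply: (discrete_comp EFin); exact: dot_discrete.
- by move=> w _; rewrite lee_fin; apply: dot_ge0; [exact: bcost_ge0|exact: hb].
- by apply: discrete_emeasurable; apply: (discrete_comp EFin); exact: dot_discrete.
Qed.

Lemma cost_rate_ge0 t : 0 <= t -> (0 <= cost_rate t)%E.
Proof.
by move=> t0; rewrite cost_rateE//; apply: integral_ge0 => w _; rewrite lee_fin holding_backlog_ge0.
Qed.

(** Measure supply, demand and service from time t - L on. The supply of each component is then
    fixed by its order time, and the actual allocation is one of those allowed in psi^0. *)
Lemma cost_rate_ge t : 0 <= t -> (psi L S K 0 0 <= cost_rate t)%E.
Proof.
move=> t0; rewrite cost_rateE//; have [_ _ hb hi] := fea.
pose y w : vecn := \col_j ((ro (t - leadc S j) w j 0)%:R - (bomR M *m toR R (dem S (t - L) w)) j 0).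
apply: (@le_trans _ _ (\int[P]_w psi L S 0 (y w) (known_demand (L:=L) t 0 w))%E).
  apply: (psi_le_nonanticipating hS t0) => j; under eq_fun do rewrite mxE.
  have Ltj := component_order_time_ge j t0.
  apply: (discrete_comp2 (fun x y => x%:R - (bomR M *m toR R y) j 0)).
  - exact: (filt_sigma hS).
  - exact: order_discrete.
  - apply: (dem_discrete_filt hS); first exact: window_start_ge.
    by apply: (window_start_le hS); exact: class_le.
apply: ge0_le_lower_integral => w _; first exact: psi_ge0.
(* service measured from time t - L on; its coordinates may be negative *)
pose z := toR R (zs t w) - toR R (dem S (t - L) w).
have tl0 : t - lead S 0 = t by rewrite (lead0 hS) subr0.
have E1 : known_demand (L:=L) t 0 w - z = backlog zs t w.
  rewrite /known_demand tl0 /dinc /z /backlog.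
  by apply/matrixP => i o; rewrite !mxE; ring.
have E2 : y w - bomR M *m z = inventory ro zs t w.
  apply/matrixP => j o; rewrite /z mulmxBr.
  rewrite /y /inventory; move: (bomR M *m toR R (zs t w)) (bomR M *m toR R (dem S (t - L) w)) => u v.
  by rewrite !mxE (ord1 o); ring.
apply: ereal_inf_le; exists (alloc_cost (y w) (known_demand (L:=L) t 0 w) z)%:E; last first.
  by rewrite /alloc_cost E1 E2.
exists z => //; split=> i.
  by have := hb t w t0 i; rewrite -E1 !mxE subr_ge0.
have := hi t w t0 i; rewrite -E2 [_ 0 i 0]mxE.
by move: (bomR M *m z) => u; rewrite !mxE subr_ge0.
Qed.

Variables (Y : R -> sspace S -> vecn) (BTs : R -> sspace S -> vecm).
Hypothesis hY : is_targets L Y.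
Hypothesis hBTs : is_backlog_target (IP_target L Y) BTs.

Lemma ccost_ge0 i : 0 <= ccost M i 0.
Proof.
rewrite /ccost !mxE addr_ge0 ?bcost_ge0//; apply: sumr_ge0 => j _.
by rewrite !mxE mulr_ge0 ?hcost_ge0.
Qed.

Lemma alloc_costE (y : vecn) (x z : vecm) :
  alloc_cost y x z = dot (hcost M) (y - bomR M *m x) + dot (ccost M) (x - z).
Proof. by rewrite /alloc_cost /ccost !dotBr !dotDl !dot_trmx; ring. Qed.

Lemma shortfall_target t w :
  shortfall (IP_target L Y) t w = bomR M *m known_demand (L:=L) t 0 w - arrived_targets t Y w.
Proof.
apply/matrixP => j o; rewrite (ord1 o) /known_demand (lead0 hS) subr0.
rewrite (dincD (t - L) (t - leadc S j) t w) mulmxDr /shortfall /arrived_targets.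
transitivity ((bomR M *m dinc (t - leadc S j) t w) j 0 - (Y (t - leadc S j) w j 0 -
   (bomR M *m dinc (t - leadc S j + leadc S j - L) (t - leadc S j) w) j 0)).
  by rewrite !mxE.
rewrite subrK; move: (bomR M *m _) (bomR M *m _) => u v.
by rewrite !mxE; ring.
Qed.

(** The linear program of the backlog target, with x - z as variable, is that of psi^0: both costs
    differ by a term independent of the allocation. *)
Lemma psi0_backlog_target t w : 0 <= t ->
  psi L S 0 (arrived_targets t Y w) (known_demand (L:=L) t 0 w) =
  (alloc_cost (arrived_targets t Y w) (known_demand (L:=L) t 0 w) (known_demand (L:=L) t 0 w - BTs t w))%:E.
Proof.
move=> t0; have [[b0 bq] bmin] := hBTs w t0.
move: b0 bq bmin; rewrite shortfall_target.
move: (arrived_targets t Y w) (known_demand t 0 w) (BTs t w) => y x b b0 bq bmin.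
apply/eqP; rewrite eq_le; apply/andP; split.
  apply: ereal_inf_lbound; exists (x - b) => //; split=> i.
    by have := b0 i; rewrite !mxE => bi; rewrite gerBl.
  by have := bq i; rewrite mulmxBr; move: (bomR M *m x) (bomR M *m b) => u v; rewrite !mxE; lra.
apply: le_ereal_inf_tmp => _ [z [zx zy] <-]; rewrite lee_fin !alloc_costE lerD2l.
have [->//|/eqP nz] := eqVneq (x - z) b; first by rewrite opprB addrC subrK.
rewrite opprB addrC subrK; apply/ltW/bmin => //; split.
  exact: lev_subr.
move=> j; have := zy j; rewrite mulmxBr.
by move: (bomR M *m x) (bomR M *m z) => u v; rewrite !mxE; lra.
Qed.

Lemma lp_minimizer_unique (q : vecn) (x x' : vecm) :
  lp_minimizer q x -> lp_minimizer q x' -> x = x'.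
Proof.
move=> [fx mx] [fx' mx']; apply: contrapT => xx'.
by have := lt_trans (mx x' fx' (nesym xx')) (mx' x fx xx'); rewrite ltxx.
Qed.

Lemma arrived_targets_discrete t : 0 <= t ->
  discrete_wrt measurable (arrived_targets t Y).
Proof.
move=> t0; apply: (discrete_col (@sigma_algebra_measurable _ _)) => j.
apply: (filt_discrete_measurable hS (component_order_time_ge j t0)).
exact: (targets_nonanticipating mu_gt0 hS t0 hY).
Qed.

Lemma known_demand_measurable t : 0 <= t -> discrete_wrt measurable (known_demand (L:=L) (S:=S) t 0).
Proof.
move=> t0; apply: (filt_discrete_measurable hS (order_time_ge hS t0 (leq0n K))).
exact: known_demand_discrete.
Qed.

Lemma BTs_discrete t : 0 <= t -> discrete_wrt measurable (BTs t).
Proof.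
move=> t0; have d : discrete_wrt measurable (shortfall (IP_target L Y) t).
  rewrite (_ : shortfall _ _ = fun w => bomR M *m known_demand (L:=L) t 0 w - arrived_targets t Y w).
    apply: (discrete_comp2 (fun x y => bomR M *m x - y) (@sigma_algebra_measurable _ _)).
      exact: known_demand_measurable.
    exact: arrived_targets_discrete.
  by apply/funext => w; rewrite shortfall_target.
apply: (discrete_factor (0 : vecm) d) => w w' E.
by apply: (lp_minimizer_unique (hBTs w t0)); rewrite E; exact: hBTs.
Qed.

Definition IP_gap t w : vecn :=
  \col_j `|IP ro (t - leadc S j) w j 0 - IP_target L Y (t - leadc S j) w j 0|.

Definition backlog_gap t w : vecm := \col_i `|backlog zs t w i 0 - BTs t w i 0|.

(** The cost rate is linear in the backlog and in the inventory position, with coefficients ccost and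
    hcost, and equals psi^0 at the targets. *)
Lemma holding_backlog_le t w : 0 <= t ->
  ((holding_backlog t w)%:E <= psi L S 0 (arrived_targets t Y w) (known_demand (L:=L) t 0 w) +
    (dot (hcost M) (IP_gap t w))%:E + (dot (ccost M) (backlog_gap t w))%:E)%E.
Proof.
move=> t0; rewrite psi0_backlog_target// -!EFinD lee_fin.
rewrite alloc_costE (_ : known_demand t 0 w - _ = BTs t w); last by rewrite opprB addrC subrK.
rewrite -opprB -shortfall_target.
have -> : holding_backlog t w = dot (ccost M) (backlog zs t w) - dot (hcost M) (shortfall (IP ro) t w).
  by rewrite /holding_backlog -alloc_inventoryE /alloc_inventory /ccost dotDl dot_trmx dotBr; ring.
have h1 : dot (ccost M) (backlog zs t w - BTs t w) <= dot (ccost M) (backlog_gap t w).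
  apply: ler_sum => i _; apply: ler_wpM2l; first exact: ccost_ge0.
  by rewrite [leRHS]mxE; apply: le_trans (ler_norm _); rewrite !mxE.
have h2 : dot (hcost M) (shortfall (IP_target L Y) t w - shortfall (IP ro) t w) <=
    dot (hcost M) (IP_gap t w).
  apply: ler_sum => j _; apply: ler_wpM2l; first exact: hcost_ge0.
  rewrite [leRHS]mxE; apply: le_trans (ler_norm _).
  move: (IP ro) (IP_target L Y) => a c; rewrite 2!mxE /shortfall ![in leLHS]mxE; lra.
move: h1 h2; rewrite !dotBr dotNr; lra.
Qed.

Lemma IP_gap_discrete t j : 0 <= t -> discrete_wrt measurable (fun w => IP_gap t w j 0).
Proof.
move=> t0; have Ltj := component_order_time_ge j t0.
pose gap (p : nat * 'cV[nat]_(nprod M) * vecm) (y : vecn) :=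
  `|(p.1.1%:R - (bomR M *m toR R p.1.2) j 0) - (y j 0 - (bomR M *m p.2) j 0)|.
have -> : (fun w => IP_gap t w j 0) = fun w => gap
   (ro (t - leadc S j) w j 0, dem S (t - leadc S j) w, dinc (t - L) (t - leadc S j) w)
   (arrived_targets t Y w).
  apply/funext => w; rewrite mxE /IP /IP_target /arrived_targets.
  by rewrite /gap mxE [(\col_i _) j 0]mxE subrK; congr (`|_ - _|); rewrite !mxE.
apply: (discrete_comp2 gap (@sigma_algebra_measurable _ _)); last exact: arrived_targets_discrete.
apply: (discrete_comp2 pair (@sigma_algebra_measurable _ _)); last first.
  by apply: (dinc_discrete hS) => //; exact: window_start_ge.
apply: (discrete_comp2 pair (@sigma_algebra_measurable _ _)); last exact: dem_discrete.
exact: (filt_discrete_measurable hS Ltj (order_discrete j t0)).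
Qed.

Lemma backlog_gap_discrete t i : 0 <= t ->
  discrete_wrt measurable (fun w => backlog_gap t w i 0).
Proof.
move=> t0; under eq_fun do rewrite mxE.
apply: (discrete_comp2 (fun x y : vecm => `|x i 0 - y i 0|) (@sigma_algebra_measurable _ _)).
  exact: backlog_discrete.
exact: BTs_discrete.
Qed.

Lemma cost_rate_le t : 0 <= t ->
  (cost_rate t <= psi L S K 0 0 +
    \sum_j (hcost M j 0)%:E * \int[P]_w (IP_gap t w j 0)%:E +
    \sum_i (ccost M i 0)%:E * \int[P]_w (backlog_gap t w i 0)%:E)%E.
Proof.
move=> t0; rewrite cost_rateE// -(psi_targets mu_gt0 hS t0 hY).
have g1 w : lev 0 (IP_gap t w) by move=> j; rewrite !mxE.
have g2 w : lev 0 (backlog_gap t w) by move=> j; rewrite !mxE.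
have d1 j := IP_gap_discrete j t0; have d2 i := backlog_gap_discrete i t0.
have m1 : measurable_fun setT (fun w => (dot (hcost M) (IP_gap t w))%:E).
  by apply: discrete_emeasurable; apply: (discrete_comp EFin); exact: dot_discrete.
have m2 : measurable_fun setT (fun w => (dot (ccost M) (backlog_gap t w))%:E).
  by apply: discrete_emeasurable; apply: (discrete_comp EFin); exact: dot_discrete.
have m0 : measurable_fun setT (fun w => psi L S 0 (arrived_targets t Y w) (known_demand (L:=L) t 0 w)).
  apply: discrete_emeasurable; apply: (discrete_comp2 (psi L S 0) (@sigma_algebra_measurable _ _)).
    exact: arrived_targets_discrete.
  exact: known_demand_measurable.
have p1 w : (0 <= (dot (hcost M) (IP_gap t w))%:E)%E.
  by rewrite lee_fin; apply: dot_ge0; [exact: hcost_ge0|exact: g1].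
have p2 w : (0 <= (dot (ccost M) (backlog_gap t w))%:E)%E.
  by rewrite lee_fin; apply: dot_ge0; [exact: ccost_ge0|exact: g2].
rewrite -!integral_weighted_sum//; [|exact: ccost_ge0|exact: hcost_ge0].
rewrite -ge0_integralD//; last by move=> w _; exact: psi_ge0.
rewrite -ge0_integralD//; last 2 first.
- by move=> w _; apply: adde_ge0 => //; exact: psi_ge0.
- exact: emeasurable_funD.
apply: ge0_le_lower_integral => w _; last exact: holding_backlog_le.
by rewrite lee_fin holding_backlog_ge0.
Qed.

End CostRate.

Section LowerBoundFinite.
Context {R : realType} {M : network R}.
Hypothesis mu_gt0 : forall i, 0 < mu M i 0.
Context {L : R} {S : system M}.
Hypothesis hS : is_system L S.

(** Ordering and serving nothing leaves a backlog of finite mean. *)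
Lemma psi_fin : exists2 C : R, 0 <= C & psi L S (nclass M) 0 0 = C%:E.
Proof.
suff : (psi L S (nclass M) 0 0 < +oo)%E.
  move: (psi_ge0 L S (nclass M) 0 0); case: psi => [C| |]//.
  by rewrite lee_fin => C0 _; exists C.
have Lt0 : - L <= 0 by rewrite oppr_le0 ltW// (L_gt0 hS).
have := @psi_le_nonanticipating _ _ _ _ hS 0 (lexx _) (fun=> 0).
move=> /(_ (fun j => discrete_cst _ (filt_sigma hS (order_time_ge hS (lexx _) (class_le j))))).
move=> /le_lt_trans; apply.
have [iD ID] := @integral_dot_dinc _ _ mu_gt0 _ _ hS (bcost M) (- L) 0 0 (lexx _) Lt0.
apply: (@le_lt_trans _ _ (\int[sprob S]_w (0 + dot (bcost M) (dinc (- L) 0 w))%:E)%E); last by rewrite ID ltry.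
apply: ge0_le_lower_integral => w _; first exact: psi_ge0.
apply: ereal_inf_lbound; exists 0.
  split=> i; rewrite ?mulmx0// /known_demand (lead0 hS) sub0r subr0.
  by rewrite mxE; apply: (dinc_ge0 hS).
by rewrite /alloc_cost mulmx0 !subr0 dot0r /known_demand (lead0 hS) sub0r subr0.
Qed.

End LowerBoundFinite.

(** * Growth of the lower bound *)

Section SquareRootGrowth.
Context {R : realType} {M : network R}.
Local Notation K := (nclass M).
Local Notation vecm := 'cV[R]_(nprod M).
Local Notation vecn := 'cV[R]_(ncomp M).
Hypothesis mu_gt0 : forall i, 0 < mu M i 0.

Lemma nbarS (f : nat -> nat) k : nbar f k.+1 = (nbar f k + f k.+1)%N.
Proof. by rewrite /nbar big_nat_recr. Qed.

Lemma nbar_mono (f : nat -> nat) k l : (k <= l)%N -> (nbar f k <= nbar f l)%N.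
Proof.
move=> kl; rewrite -(subnKC kl); elim: (l - k)%N => [|m IH]; first by rewrite addn0.
by rewrite addnS nbarS (leq_trans IH) ?leq_addr.
Qed.

Lemma top_class_inhabited : exists j : 'I_(ncomp M), class_of j = K.
Proof.
have K0 := nclass_gt0 M; have nK := nbar_nclass M.
have sK : (0 < class_size M K)%N by apply: class_size_gt0; rewrite K0 leqnn.
have nK' : (nbar (class_size M) K.-1 + class_size M K = ncomp M)%N.
  by rewrite -nK -{2 3}(prednK K0) nbarS prednK.
have n0 : (0 < ncomp M)%N by lia.
have jn : ((ncomp M).-1 < ncomp M)%N by rewrite prednK.
exists (Ordinal jn); have [/andP[c1 cK] /andP[_ jc]] := class_ofP (Ordinal jn).
apply/eqP; rewrite eqn_leq cK /= leqNgt; apply/negP => cltK.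
have : (nbar (class_size M) (class_of (Ordinal jn)) <= nbar (class_size M) K.-1)%N.
  by apply: nbar_mono; rewrite -ltnS prednK.
by move: jc => /=; lia.
Qed.

(** The imbalance of component j is the difference between its unmet requirement and its leftover,
    both of which are non-negative and paid for. *)
Lemma alloc_cost_ge_imbalance (j : 'I_(ncomp M)) : exists2 de : R, 0 < de &
  forall (y : vecn) (x z : vecm), lev z x -> lev (bomR M *m z) y ->
    de * `|(bomR M *m x) j 0 - y j 0| <= alloc_cost y x z.
Proof.
(* 1 / s is at most hcost j, and times bom j i at most bcost i *)
pose s := (hcost M j 0)^-1 + \sum_i (bom M j i)%:R / bcost M i 0.
have h0 := hcost_gt0 j; have b0 := bcost_gt0 (n := M).
have t0 i : 0 <= (bom M j i)%:R / bcost M i 0 :> R by rewrite divr_ge0// ltW.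
have s0 : 0 < s by rewrite ltr_pwDl ?invr_gt0// sumr_ge0.
exists s^-1; first by rewrite invr_gt0.
have dh : s^-1 <= hcost M j 0.
  rewrite -[leRHS]invrK lef_pV2 ?posrE ?invr_gt0// lerDl sumr_ge0//.
have db i : s^-1 * (bom M j i)%:R <= bcost M i 0.
  rewrite mulrC ler_pdivrMr// mulrC -ler_pdivrMr// /s (bigD1 i)//= addrCA lerDl.
  by rewrite addr_ge0 ?invr_ge0 ?(ltW h0)// sumr_ge0.
move=> y x z zx zy.
have yz := lev_subr zy; have xz := lev_subr zx.
have hpart : s^-1 * (y - bomR M *m z) j 0 <= dot (hcost M) (y - bomR M *m z).
  rewrite /dot (bigD1 j)//= -[leLHS]addr0; apply: lerD.
    by apply: ler_wpM2r => //; have := yz j; rewrite mxE.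
  apply: sumr_ge0 => l _; apply: mulr_ge0; first exact: hcost_ge0.
  by have := yz l; rewrite [leLHS]mxE.
have bpart : s^-1 * (bomR M *m (x - z)) j 0 <= dot (bcost M) (x - z).
  rewrite [(_ *m _) j 0]mxE mulr_sumr; apply: ler_sum => i _.
  rewrite mulrA [bomR M j i]mxE; apply: ler_wpM2r; last exact: db.
  by have := xz i; rewrite [leLHS]mxE.
have A0 : 0 <= (bomR M *m (x - z)) j 0.
  rewrite mxE; apply: sumr_ge0 => i _; rewrite [bomR M j i]mxE mulr_ge0//.
  by have := xz i; rewrite [leLHS]mxE.
have Y0 : 0 <= (y - bomR M *m z) j 0 by have := yz j; rewrite [leLHS]mxE.
apply: le_trans (lerD hpart bpart); rewrite -mulrDr; apply: ler_wpM2l.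
  by rewrite invr_ge0 ltW.
move: A0 Y0; rewrite mulmxBr; move: (bomR M *m x) (bomR M *m z) => u v.
rewrite !mxE => A0 Y0; rewrite ler_norml; apply/andP; split; lra.
Qed.

(** The slowest class fixes its supply of a component before seeing any demand of the window, so the
    imbalance is the distance of a compound Poisson variable from a constant. *)
Lemma psi_sqrt_lower : exists2 eps : R, 0 < eps & exists L0 : R,
  forall (L : R) (S : system M) (Y : R -> sspace S -> vecn),
    is_system L S -> is_targets L Y -> L0 <= L ->
    ((eps * Num.sqrt L)%:E <= psi L S K 0 0)%E.
Proof.
have [j jK] := top_class_inhabited.
have [de de0 hde] := alloc_cost_ge_imbalance j.
have r0 := rate_gt0 M.
pose e := \sum_i (bom M j i)%:R * (mu M i 0 / rate M).
have e0 : 0 < e.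
  have [i ai] := bom_row j.
  rewrite /e (bigD1 i)//= ltr_pwDl ?mulr_gt0 ?ltr0n ?invr_gt0//.
  by apply: sumr_ge0 => l _; rewrite mulr_ge0 ?divr_ge0// ltW.
exists (de * (Num.sqrt (rate M) / 128 * e)).
  by rewrite !mulr_gt0// sqrtr_gt0.
(* 1024 = 32^2: the Poisson mean rate * L must satisfy the hypotheses of the spread lemma *)
exists (1024 / rate M) => L S Y hS hY; rewrite ler_pdivrMr// => L0.
have Lpos := L_gt0 hS.
have Lt0 : - L < 0 by rewrite oppr_lt0.
rewrite -(psi_targets mu_gt0 hS (lexx 0) hY).
(* a state of the world at which to read the constant target *)
have [w0 _] : exists w : sspace S, True.
  apply: contrapT => nw; have := @probability_setT _ _ _ (sprob S).
  rewrite (_ : setT = set0) ?measure0; last by apply/seteqP; split=> // w _; apply: nw; exists w.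
  by move=> /eqP; rewrite eq_sym onee_eq0.
pose y := arrived_targets 0 Y w0 j 0.
have l2 : 2 <= rate M * (0 - - L) by lra.
have l32 : 32 <= Num.sqrt (rate M * (0 - - L)).
  by rewrite -(ger0_norm (_ : 0 <= 32 :> R))// -sqrtr_sqr ler_wsqrtr// expr2; lra.
have := compound_poisson_deviation (dem_poisson hS) mu_gt0 (fun i => bom M j i) y Lt0 l2 l32.
rewrite -/e sub0r opprK => dev.
apply: (@le_trans _ _ (de%:E * \int[sprob S]_w (`|(\sum_i bom M j i * vecsub (dem S 0 w) (dem S (- L) w) i 0%R)%N%:R - y|)%:E)%E).
  apply: le_trans (lee_wpmul2l _ dev); last by rewrite lee_fin ltW.
  rewrite -EFinM lee_fin sqrtrM ?(ltW r0)// le_eqVlt; apply/orP; left.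
  by apply/eqP; ring.
rewrite -ge0_integralZl_EFin//; last 2 first.
- apply: discrete_emeasurable.
  apply: (discrete_comp2 (fun u v : 'cV[nat]_(nprod M) =>
    (`|(\sum_i bom M j i * vecsub u v i 0%R)%N%:R - y|)%:E) (@sigma_algebra_measurable _ _)).
    by apply: (dem_discrete hS); exact: ltW.
  by apply: (dem_discrete hS).
- exact: ltW.
apply: ge0_le_lower_integral => w _.
  by rewrite -EFinM lee_fin mulr_ge0// ltW.
apply: le_ereal_inf_tmp => _ [z [zx zy] <-]; rewrite -EFinM lee_fin.
apply: le_trans (hde _ _ _ zx zy).
rewrite -(top_class_target_cst mu_gt0 hS (lexx 0) hY w0 w jK) -/y.
rewrite /known_demand (lead0 hS) sub0r subr0 (dinc_vecsub hS _ (lexx _) (ltW Lt0)).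
rewrite mxE natr_sum.
rewrite (eq_bigr (fun i => bomR M j i * toR R (vecsub (dem S 0 w) (dem S (- L) w)) i 0))//.
by move=> i _; rewrite natrM; congr (_ * _); rewrite [RHS]mxE.
Qed.

End SquareRootGrowth.

(** * Asymptotic optimality *)

Section Limits.
Context {R : realType}.

Lemma limf_esup0_near (F : set_system R) (f : R -> \bar R) (d : R) :
  Filter F -> limf_esup f F = 0%E -> 0 < d -> \forall x \near F, (f x <= d%:E)%E.
Proof.
move=> FF f0 d0; have : (limf_esup f F < d%:E)%E by rewrite f0 lte_fin.
move=> /ereal_inf_lt[_ [V FV <-] Vd]; apply: filterS FV => x Vx.
by apply: le_trans (ltW Vd); apply: ereal_sup_ubound; exists x.
Qed.

Lemma cvge0_squeeze (T : Type) (F : set_system T) (f : T -> \bar R) :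
  Filter F -> (forall e : R, 0 < e -> \forall x \near F, (0 <= f x <= e%:E)%E) ->
  f x @[x --> F] --> 0%E.
Proof.
move=> FF fe; apply/fine_cvgP; split.
  apply: filterS (fe 1 ltr01) => x /andP[f0 f1].
  by rewrite ge0_fin_numE// (le_lt_trans f1) ?ltry.
apply/cvgr0Pnorm_le => e e0; apply: filterS (fe e e0) => x /andP[f0 f1] /=.
rewrite ger0_norm ?fine_ge0// -lee_fin fineK// ge0_fin_numE//.
by rewrite (le_lt_trans f1) ?ltry.
Qed.

End Limits.

Section PolicyCost.
Context {R : realType} {M : network R}.
Local Notation K := (nclass M).
Hypothesis mu_gt0 : forall i, 0 < mu M i 0.
Context {L : R} {S : system M}.
Hypothesis hS : is_system L S.

Lemma cost_ge_psi ro zs : feasible L ro zs -> (psi L S K 0 0 <= cost (S := S) ro zs)%E.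
Proof.
move=> fea; have [C C0 CE] := psi_fin mu_gt0 hS; rewrite CE.
by apply: limsup_average_ge => // t t0; rewrite -CE; exact: (cost_rate_ge hS fea t0).
Qed.

Lemma min_cost_ge_psi : (psi L S K 0 0 <= min_cost L S)%E.
Proof. by apply: le_ereal_inf_tmp => _ [ro [zs [fea ->]]]; exact: cost_ge_psi. Qed.

Variables (ro : R -> sspace S -> 'cV[nat]_(ncomp M)).
Variables (zs : R -> sspace S -> 'cV[nat]_(nprod M)).
Variables (Y : R -> sspace S -> 'cV[R]_(ncomp M)) (BTs : R -> sspace S -> 'cV[R]_(nprod M)).
Hypothesis fea : feasible L ro zs.
Hypothesis hY : is_targets L Y.
Hypothesis hBTs : is_backlog_target (IP_target L Y) BTs.

Definition total_cost_weight : R := \sum_j hcost M j 0 + \sum_i ccost M i 0.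

(** The gaps are bounded uniformly in time, so that the long-run average inherits the bound on the
    cost rate. *)
Lemma cost_le_psi (d : R) :
  (forall j (t : R), (0 <= t)%R -> \int[sprob S]_w (IP_gap (L:=L) ro Y t w j 0)%:E <= d%:E)%E ->
  (forall i (t : R), (0 <= t)%R -> \int[sprob S]_w (backlog_gap zs BTs t w i 0)%:E <= d%:E)%E ->
  (cost (S := S) ro zs <= psi L S K 0 0 + (total_cost_weight * d)%:E)%E.
Proof.
move=> hI hB; have [C C0 CE] := psi_fin mu_gt0 hS; rewrite CE -EFinD.
apply: limsup_average_le => t t0; first exact: (cost_rate_ge0 hS fea t0).
apply: le_trans (cost_rate_le mu_gt0 hS fea hY hBTs t0) _.
rewrite CE mulrDl addrA !EFinD; apply: leeD; first apply: leeD => //.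
  rewrite mulr_suml -sumEFin; apply: lee_sum => j _; rewrite EFinM.
  by apply: lee_wpmul2l; [rewrite lee_fin hcost_ge0|exact: hI].
rewrite mulr_suml -sumEFin; apply: lee_sum => i _; rewrite EFinM.
by apply: lee_wpmul2l; [rewrite lee_fin ccost_ge0|exact: hB].
Qed.

Lemma IP_gap_scaled (d : R) j :
  (ereal_sup [set ('E_(sprob S)[fun w =>
      (`|scale_IP L (IP ro) t w j 0 - scale_IP L (IP_target L Y) t w j 0|)%R])%E
      | t in [set t : R | (- (leadc S j / L) <= t)%R]] <= d%:E)%E ->
  forall t, 0 <= t -> (\int[sprob S]_w (IP_gap (L:=L) ro Y t w j 0)%:E <= (d * Num.sqrt L)%:E)%E.
Proof.
move=> hd t t0; have L0 := L_gt0 hS.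
have sL : 0 < Num.sqrt L by rewrite sqrtr_gt0.
pose a w := IP_gap (L:=L) ro Y t w j 0.
have a0 w : 0 <= a w by rewrite /a mxE.
have ma : measurable_fun setT (fun w => (a w)%:E).
  apply: discrete_emeasurable; apply: (discrete_comp EFin).
  exact: (IP_gap_discrete mu_gt0 hS fea hY j t0).
have : ('E_(sprob S)[fun w =>
    (`|scale_IP L (IP ro) ((t - leadc S j) / L) w j 0
       - scale_IP L (IP_target L Y) ((t - leadc S j) / L) w j 0|)%R] <= d%:E)%E.
  apply: le_trans hd; apply: ereal_sup_ubound; exists ((t - leadc S j) / L) => //=.
  by rewrite -mulNr ler_pM2r ?invr_gt0// lerDr.
rewrite expectation.unlock.
rewrite (eq_integral (fun w => ((Num.sqrt L)^-1)%:E * (a w)%:E)%E); last first.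
  move=> w _; rewrite -EFinM; congr (_%:E).
  rewrite [scale_IP _ _ _ _ _ _]mxE [X in _ - X]mxE -mulrBl opprB addrA subrK.
  rewrite normrM [X in _ * X]ger0_norm ?invr_ge0 ?(ltW sL)// mulrC; congr (_ * _).
  by rewrite mulrC divfK ?gt_eqF// [RHS]mxE.
rewrite ge0_integralZl_EFin//; last by move=> w _; rewrite lee_fin.
move=> h; have := lee_wpmul2l (_ : (0 <= (Num.sqrt L)%:E)%E) h.
by rewrite muleA -EFinM mulfV ?gt_eqF// mul1e -EFinM mulrC; apply; rewrite lee_fin ltW.
Qed.

Lemma backlog_gap_scaled (d : R) i :
  (ereal_sup [set ('E_(sprob S)[fun w =>
      (`|scale_B L (backlog zs) t w i 0 - scale_B L BTs t w i 0|)%R])%E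
      | t in [set t : R | (0 <= t)%R]] <= d%:E)%E ->
  forall t, 0 <= t -> (\int[sprob S]_w (backlog_gap zs BTs t w i 0)%:E <= (d * Num.sqrt L)%:E)%E.
Proof.
move=> hd t t0; have L0 := L_gt0 hS.
have sL : 0 < Num.sqrt L by rewrite sqrtr_gt0.
pose a w := backlog_gap zs BTs t w i 0.
have a0 w : 0 <= a w by rewrite /a mxE.
have ma : measurable_fun setT (fun w => (a w)%:E).
  apply: discrete_emeasurable; apply: (discrete_comp EFin).
  exact: (backlog_gap_discrete mu_gt0 hS fea hY hBTs i t0).
have : ('E_(sprob S)[fun w =>
    (`|scale_B L (backlog zs) (t / L) w i 0 - scale_B L BTs (t / L) w i 0|)%R] <= d%:E)%E.
  apply: le_trans hd; apply: ereal_sup_ubound; exists (t / L) => //=.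
  by rewrite divr_ge0// ltW.
rewrite expectation.unlock.
rewrite (eq_integral (fun w => ((Num.sqrt L)^-1)%:E * (a w)%:E)%E); last first.
  move=> w _; rewrite -EFinM; congr (_%:E).
  rewrite [scale_B _ _ _ _ _ _]mxE [X in _ - X]mxE -mulrBr.
  rewrite normrM ger0_norm ?invr_ge0 ?(ltW sL)//; congr (_ * _).
  by rewrite mulrC divfK ?gt_eqF// [RHS]mxE.
rewrite ge0_integralZl_EFin//; last by move=> w _; rewrite lee_fin.
move=> h; have := lee_wpmul2l (_ : (0 <= (Num.sqrt L)%:E)%E) h.
by rewrite muleA -EFinM mulfV ?gt_eqF// mul1e -EFinM mulrC; apply; rewrite lee_fin ltW.
Qed.

End PolicyCost.

(* The family is indexed by an unbounded set [Ls] of lead times L; the limits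
   for L going to infinity are taken along [Ls]. *)
Theorem theorem3 (R : realType) (M : network R)
  (mu_gt0 : forall i, 0 < mu M i 0)
  (Ls : set R)
  (Ls_gt0 : forall L : R, Ls L -> 0 < L)
  (Ls_unbounded : forall x : R, exists2 L : R, Ls L & x < L)
  (S : R -> system M)
  (hS : forall L : R, Ls L -> is_system L (S L))
  (ro : forall L : R, R -> sspace (S L) -> 'cV[nat]_(ncomp M))
  (zs : forall L : R, R -> sspace (S L) -> 'cV[nat]_(nprod M))
  (Y : forall L : R, R -> sspace (S L) -> 'cV[R]_(ncomp M))
  (BT BTs : forall L : R, R -> sspace (S L) -> 'cV[R]_(nprod M))
  (hpol : forall L : R, Ls L -> is_policy L (ro L) (zs L))
  (hY : forall L : R, Ls L -> is_targets L (Y L))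
  (hro : forall L : R, Ls L -> replenishment_rule L (Y L) (ro L))
  (hBT : forall L : R, Ls L -> is_backlog_target (IP (ro L)) (BT L))
  (hBTs : forall L : R, Ls L -> is_backlog_target (IP_target L (Y L)) (BTs L))
  (hzs : forall L : R, Ls L -> allocation_rule L (ro L) (BT L) (zs L))
  (hIP : forall j, limf_esup (fun L : R =>
     ereal_sup [set ('E_(sprob (S L))[fun w =>
                  (`|scale_IP L (IP (ro L)) t w j 0
                    - scale_IP L (IP_target L (Y L)) t w j 0|)%R])%E
               | t in [set t : R | - (leadc (S L) j / L) <= t]])
     (within Ls +oo) = 0%E)
  (hB : forall i, limf_esup (fun L : R =>
     ereal_sup [set ('E_(sprob (S L))[fun w =>
                  (`|scale_B L (backlog (zs L)) t w i 0
                    - scale_B L (BTs L) t w i 0|)%R])%E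
               | t in [set t : R | 0 <= t]])
     (within Ls +oo) = 0%E) :
  ((cost (ro L) (zs L) - lower_bound L (S L)) / (Num.sqrt L)%:E)%E
    @[L --> within Ls +oo] --> 0%E
  /\
  ((cost (ro L) (zs L) - min_cost L (S L)) / min_cost L (S L))%E
    @[L --> within Ls +oo] --> 0%E.
Proof.
have FF : Filter (within Ls +oo) by exact: within_filter.
pose LB L := psi L (S L) (nclass M) 0 0.
have inLs : \forall L \near within Ls +oo, Ls L by exact: withinT.
have fea L : Ls L -> feasible L (ro L) (zs L).
  by move=> LsL; exact: (policy_feasible (hS _ LsL) (hpol _ LsL) (hBT _ LsL) (hzs _ LsL)).
have lbE L : Ls L -> lower_bound L (S L) = LB L.
  by move=> LsL; exact: (lower_bound_psi mu_gt0 (hS _ LsL)).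
have costlo L : Ls L -> (LB L <= cost (ro L) (zs L))%E.
  by move=> LsL; exact: (cost_ge_psi mu_gt0 (hS _ LsL) (fea L LsL)).
have costhi (d : R) : 0 < d -> \forall L \near within Ls +oo,
    (cost (ro L) (zs L) <= LB L + (total_cost_weight (M := M) * (d * Num.sqrt L))%:E)%E.
  move=> d0.
  have nI : \forall L \near within Ls +oo, forall j, (ereal_sup [set ('E_(sprob (S L))[fun w =>
      (`|scale_IP L (IP (ro L)) t w j 0 - scale_IP L (IP_target L (Y L)) t w j 0|)%R])%E
      | t in [set t : R | (- (leadc (S L) j / L) <= t)%R]] <= d%:E)%E.
    by apply: filter_forall => j; exact: limf_esup0_near (hIP j) d0.
  have nB : \forall L \near within Ls +oo, forall i, (ereal_sup [set ('E_(sprob (S L))[fun w =>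
      (`|scale_B L (backlog (zs L)) t w i 0 - scale_B L (BTs L) t w i 0|)%R])%E
      | t in [set t : R | (0 <= t)%R]] <= d%:E)%E.
    by apply: filter_forall => i; exact: limf_esup0_near (hB i) d0.
  move: inLs nI nB; apply: filterS3 => L LsL dI dB.
  apply: (cost_le_psi mu_gt0 (hS _ LsL) (fea L LsL) (hY _ LsL) (hBTs _ LsL)).
    by move=> j; exact: (IP_gap_scaled mu_gt0 (hS _ LsL) (fea L LsL) (hY _ LsL) (dI j)).
  by move=> i; exact: (backlog_gap_scaled mu_gt0 (hS _ LsL) (fea L LsL) (hY _ LsL) (hBTs _ LsL) (dB i)).
have minlo L : Ls L -> (LB L <= min_cost L (S L))%E.
  by move=> LsL; exact: (min_cost_ge_psi mu_gt0 (hS _ LsL)).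
have minhi L : Ls L -> (min_cost L (S L) <= cost (ro L) (zs L))%E.
  by move=> LsL; apply: ereal_inf_lbound; exists (ro L), (zs L); split=> //; exact: fea.
have W0 : 0 <= total_cost_weight (M := M).
  by apply: addr_ge0; apply: sumr_ge0 => ? _; [exact: hcost_ge0|exact: ccost_ge0].
set W := total_cost_weight (M := M) in costhi W0.
have Wd x : 0 <= x -> W * (x / (W + 1)) <= x.
  by move=> x0; rewrite mulrA ler_pdivrMr ?ltr_pwDr// mulrDr mulr1 [W * x]mulrC lerDl.
have [eps eps0 [L0 hL0]] := psi_sqrt_lower mu_gt0.
split; apply: cvge0_squeeze => e e0.
  have d0 : 0 < e / (W + 1) by rewrite divr_gt0// ltr_pwDr.
  move: inLs (costhi _ d0); apply: filterS2 => L LsL hi; rewrite lbE//.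
  have sL : 0 < Num.sqrt L by rewrite sqrtr_gt0 Ls_gt0.
  have := costlo L LsL; have [C C0 CE] := psi_fin mu_gt0 (hS _ LsL).
  move: hi; rewrite /LB CE -EFinD; case: (cost _ _) => // c.
  rewrite !lee_fin inver gt_eqF// -EFinB -EFinM !lee_fin => hi lo.
  rewrite divr_ge0 ?subr_ge0 ?(ltW sL)//= ler_pdivrMr// lerBlDl.
  by apply: le_trans hi _; rewrite lerD2l mulrA ler_wpM2r ?(ltW sL)// Wd// ltW.
have d0 : 0 < e * eps / (W + 1) by rewrite divr_gt0 ?mulr_gt0// ltr_pwDr.
have big : \forall L \near within Ls +oo, L0 <= L.
  rewrite near_withinE; apply: filterS (nbhs_pinfty_ge (num_real L0)) => L h _.
  exact: h.
move: inLs (costhi _ d0) big; apply: filterS3 => L LsL hi L0L.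
have sL : 0 < Num.sqrt L by rewrite sqrtr_gt0 Ls_gt0.
have := hL0 L (S L) (Y L) (hS _ LsL) (hY _ LsL) L0L.
have := minlo L LsL; have := minhi L LsL.
have [C C0 CE] := psi_fin mu_gt0 (hS _ LsL).
move: hi; rewrite /LB CE -EFinD; case: (cost _ _) => [c| |]; case: (min_cost _ _) => [m| |]//.
rewrite !lee_fin => hi mc Cm eC.
have m0 : 0 < m by apply: lt_le_trans Cm; apply: lt_le_trans eC; rewrite mulr_gt0.
rewrite inver gt_eqF// -EFinB -EFinM !lee_fin divr_ge0 ?subr_ge0 ?(ltW m0)//=.
rewrite ler_pdivrMr// lerBlDl; apply: (le_trans hi); apply: lerD => //.
apply: (@le_trans _ _ (e * (eps * Num.sqrt L))); last first.
  by rewrite ler_wpM2l ?(ltW e0)//; exact: le_trans eC Cm.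
rewrite [leLHS]mulrA [leRHS]mulrA ler_wpM2r ?(ltW sL)// Wd// ltW// mulr_gt0//.
Qed.
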